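(* Let $(m(n))_{n\ge1}$ be a sequence of non-negative integers. (i) If $m(n)=o(n)$, then, under $\mathsf{Q}^{\triangle\bullet\bullet}_{n,m(n)}$, as $n\to+\infty$, $(X^{(n)},Y^{(n)})$ converges in probability in $C([0,1],\mathbb R)^2$ (uniform topology) to $(X,Y)$, where $X_t=2-2t$ and $Y_t=2t(1-t)$ for $t\in[0,1]$. (ii) If $m(n)/n\to+\infty$, then, under $\mathsf{Q}^{\triangle\bullet\bullet}_{n,m(n)}$, the Hausdorff distance $d_H\big(\mathsf{CH}(\{U_1,\dots,U_{n+m(n)}\}),ABC\big)$ converges to $0$ in probability as $n\to+\infty$.
   Context: $\mathsf{CH}$ denotes the convex hull and $d_H$ the Hausdorff distance between compact subsets of $\mathbb R^2$. Let $ABC$ be the (filled) triangle of area 1 with vertices $A=(0,0)$, $B=(2,0)$, $C=(1,1)$. For $N\ge 0$ let $U_1,\dots,U_N$ be i.i.d. uniform points in $ABC$, and let $\mathbf n(N)$ be the number of the $U_i$ that are vertices of $\mathsf{CH}(\{A,B,U_1,\dots,U_N\})$ (so $A,B$ are not counted). For $n\ge1$, $m\ge0$, $\mathsf{Q}^{\triangle\bullet\bullet}_{n,m}$ denotes the conditional law of $(U_1,\dots,U_{n+m})$ given $\mathbf n(n+m)=n$. Under $\mathsf{Q}^{\triangle\bullet\bullet}_{n,m}$, the vertices of $\mathsf{CH}(\{A,B,U_1,\dots,U_{n+m}\})$ are listed as $V_0=B,V_1,\dots,V_n,V_{n+1}=A$ in order of decreasing abscissa, with $V_i=(X_i,Y_i)$.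 The sequences $(X_i)_{0\le i\le n+1}$, $(Y_i)_{0\le i\le n+1}$ are extended to real indices in $[0,n+1]$ by linear interpolation, and $X^{(n)}(x)=X_{x(n+1)}$, $Y^{(n)}(x)=Y_{x(n+1)}$ for $x\in[0,1]$. *)

(* Defs.v *)
From HB Require Import structures.
From mathcomp Require Import all_boot all_order all_algebra.
From mathcomp Require Import all_classical all_reals all_analysis.

Set Implicit Arguments.
Unset Strict Implicit.
Unset Printing Implicit Defensive.

Import Order.TTheory GRing.Theory Num.Theory.
Import numFieldNormedType.Exports.

Local Open Scope classical_set_scope.
Local Open Scope ring_scope.

Section plane_geometry.
Context {R : realType}.
Implicit Types (K L : set (R * R)) (p q : R * R).

Definition hull (S : set (R * R)) : set (R * R) := smallest (@convex_set R _) S.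

(* The vertices of a convex polygon are its extreme points. *)
Definition vertex K p : Prop :=
  K p /\ forall q1 q2 (t : R), K q1 -> K q2 -> 0 < t < 1 ->
    p = t *: q1 + (1 - t) *: q2 -> q1 = q2.

(* The norm that the library puts on [R * R] is the max norm. *)
Definition eucl_dist p q : R :=
  Num.sqrt ((p.1 - q.1) ^+ 2 + (p.2 - q.2) ^+ 2).

Definition dist_to_set p L : R := inf [set eucl_dist p q | q in L].

Definition hausdorff_dist K L : R :=
  Num.max (sup [set dist_to_set p L | p in K])
          (sup [set dist_to_set q K | q in L]).

Definition ptA : R * R := (0, 0).
Definition ptB : R * R := (2, 0).
Definition ptC : R * R := (1, 1).
Definition triangle : set (R * R) := hull [set ptA; ptB; ptC].

Definition area : set (R * R) -> \bar R :=
  (@lebesgue_measure R \x @lebesgue_measure R)%E.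

End plane_geometry.

Section configurations.
Context {R : realType} {N : nat}.
Implicit Type u : 'I_N -> R * R.

Definition hullAB u : set (R * R) := hull ([set ptA; ptB] `|` range u).

Definition vertex_count u : nat :=
  #|[pred i : 'I_N | `[< vertex (hullAB u) (u i) >]]|.

(* All the vertices, [ptA] and [ptB] included, by decreasing abscissa; for
   almost every configuration no two vertices share their abscissa, so the
   order of ties is immaterial. *)
Definition vertex_seq u : seq (R * R) :=
  sort (fun p q => q.1 <= p.1)
    (undup [seq p <- ptB :: ptA :: codom u | `[< vertex (hullAB u) p >]]).

End configurations.

Section interpolation.
Context {R : realType}.

Definition interp (x : nat -> R) (s : R) : R :=
  let k := Num.truncn s in x k + (s - k%:R) * (x k.+1 - x k).

Definition Xn (n : nat) {N : nat} (u : 'I_N -> R * R) (t : R) : R :=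
  interp (fun i => (nth (0, 0) (vertex_seq u) i).1) (t * n.+1%:R).

Definition Yn (n : nat) {N : nat} (u : 'I_N -> R * R) (t : R) : R :=
  interp (fun i => (nth (0, 0) (vertex_seq u) i).2) (t * n.+1%:R).

Definition Xlim (t : R) : R := 2 - 2 * t.
Definition Ylim (t : R) : R := 2 * t * (1 - t).

Definition unif_dist (f g : R -> R) : R :=
  sup [set `|f t - g t| | t in `[0, 1]].

(* Distance on C([0,1])^2 inducing the product of the uniform topologies. *)
Definition unif_dist2 (f g : (R -> R) * (R -> R)) : R :=
  Num.max (unif_dist f.1 g.1) (unif_dist f.2 g.2).

End interpolation.

Section probability.
Context {R : realType}.
Local Open Scope ereal_scope.

Definition uniform_on d (T : measurableType d) (P : probability T R)
    (D : set (R * R)) (X : {RV P >-> (R * R)%type}) : Prop :=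
  forall S : set (R * R), measurable S ->
    distribution P X S = area (S `&` D) / area D.

Definition mutually_independent d (T : measurableType d) (P : probability T R)
    (I : finType) d' (T' : measurableType d') (X : I -> {RV P >-> T'}) : Prop :=
  forall (J : {set I}) (S : I -> set T'), (forall i, measurable (S i)) ->
    P (\bigcap_(i in [set` J]) (X i @^-1` S i)) =
    \prod_(i in J) P (X i @^-1` S i).

Definition iid_uniform_triangle d (T : measurableType d) (P : probability T R)
    (N : nat) (U : 'I_N -> {RV P >-> (R * R)%type}) : Prop :=
  mutually_independent U /\ forall i, uniform_on triangle (U i).

Definition cond_prob d (T : measurableType d) (P : probability T R)
  (E F : set T) : \bar R := P (E `&` F) / P F.

(* The law Q_{n,m}, with m = N - n, as a function of sets of configurations. *)
Definition Qlaw d (T : measurableType d) (P : probability T R) (N : nat)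
    (U : 'I_N -> {RV P >-> (R * R)%type}) (n : nat)
    (S : set ('I_N -> R * R)) : \bar R :=
  let conf w := fun i => U i w in
  cond_prob P (conf @^-1` S) [set w | vertex_count (conf w) = n].

Definition cvg0_in_prob (Om : nat -> Type) (Q : forall n, set (Om n) -> \bar R)
    (D : forall n, Om n -> R) : Prop :=
  forall eps : R, (0 < eps)%R ->
    Q n [set w | (eps < D n w)%R] @[n --> \oo] --> 0.

End probability.

(* Main.v *)
Require Import Defs.
From HB Require Import structures.
From mathcomp Require Import all_boot all_order all_algebra all_fingroup.
From mathcomp Require Import all_classical all_reals all_analysis measurable_realfun.
From mathcomp Require Import ring lra.
Set Implicit Arguments.
Unset Strict Implicit.
Unset Printing Implicit Defensive.
Import Order.TTheory GRing.Theory Num.Theory.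
Import numFieldNormedType.Exports.
Local Open Scope classical_set_scope.
Local Open Scope ring_scope.

(** Use the coordinates [(a, b)] of [Phi], in which the base corners [ptB] and [ptA] are
    [(0, 0)] and [(1, 1)]. The vertices from [ptB] to [ptA] are then the corners of a
    chain of [n + 1] edges with positive coordinates, sorted by increasing slope, whose
    sum is [(1, 1)]. Conversely a chain of sample points is the list of vertices when the
    remaining points lie under it. Sum over the choice of the [n] vertices among the
    [n + m] points. The law of the edges of [n] given points is, up to a constant,
    Lebesgue measure in dimension [2 n] ([law_increments]). Up to ties, which are null,
    sorting the edges by slope divides volumes by [n!], and asking that the last edge be
    the steepest costs at most a factor [n + 1], because exchanging an edge with the last
    one preserves volume ([powm_sorted_le], [le_powm_sorted],
    [simplex_le_last_steepest]). Number of choices and constants are the same for the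
    event of interest and for the conditioning event. What remains is to compare volumes
    of permutation-invariant sets of [n]-tuples of edges in the simplex, whose full
    volume is [(e^2 / n^2)^n] to exponential precision ([simplex_upper],
    [simplex_lower]).

    In this simplex edges behave like independent pairs of exponential variables of mean
    [1 / n]. The edges of slope at most [s / (1 - s)] number about [n s] and have sum about
    [(2 s - s^2, s^2)]; exponential Markov inequalities make deviations exponentially
    unlikely ([chernoff]). Since the chain is sorted, these edges are its beginning, so a
    finite grid of values of [s] controls the whole path by monotonicity
    ([chain_near_parabola]), and the limit is the parabola.

    For the first claim the lower bound for the conditioning event uses typical chains and
    asks the [m] other points to lie in a fixed triangle below them. This costs [3^-m],
    which is no match for the exponential bounds when [m = o(n)] ([near_parabola]). For the
    second claim the roles are exchanged: if the hull is far from the triangle, a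
    neighbourhood of one of the three corners is empty, which costs [t^m] with [t < 1], while
    chains that pass close enough to [ptC] leave almost the whole triangle to the other
    points and cost only an exponential in [n] ([flat_lower], [fill_triangle]).

    All events have to be measurable. This is obtained by replacing hulls by convex
    combinations with rational weights ([measurable_vertex], [vertex_seq_order],
    [one_sided_gt]). *)

(** * Powers of a sigma-finite measure *)

Section product_sigma_finite.
Local Open Scope ereal_scope.
Context d1 d2 (T1 : measurableType d1) (T2 : measurableType d2) (R : realType).
Variable m1 : {sigma_finite_measure set T1 -> \bar R}.
Variable m2 : {sigma_finite_measure set T2 -> \bar R}.

Definition prodm : set (T1 * T2) -> \bar R := m1 \x m2.

HB.instance Definition _ := Measure.on prodm.

Let prodm_sigma_finite : sigma_finite setT prodm.
Proof.
have /sigma_finiteP[F [UF ndF Foo]] := sigma_finiteT m1.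
have /sigma_finiteP[G [UG ndG Goo]] := sigma_finiteT m2.
exists (fun k => F k `*` G k).
  apply/esym/seteqP; split=> // -[x y] _.
  have [[i _ Fx] [j _ Gy]] : (\bigcup_k F k) x /\ (\bigcup_k G k) y.
    by rewrite -UF -UG.
  exists (maxn i j) => //; split=> /=.
    by have /subsetPset := ndF _ _ (leq_maxl i j); exact.
  by have /subsetPset := ndG _ _ (leq_maxr i j); exact.
move=> k; have [mF Fk] := Foo k; have [mG Gk] := Goo k.
split; first exact: measurableX.
by rewrite /prodm product_measure1E// lte_mul_pinfty// ge0_fin_numE.
Qed.

HB.instance Definition _ := Measure_isSigmaFinite.Build _ _ _ prodm
  prodm_sigma_finite.

End product_sigma_finite.

Section tuple_power.
Local Open Scope ereal_scope.
Context d (T : measurableType d) (R : realType).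

Definition box n (A : 'I_n -> set T) : set (n.-tuple T) :=
  [set s | forall i, A i (tnth s i)].

Lemma boxE n (A : 'I_n -> set T) :
  box A = \bigcap_(i in [set: 'I_n]) ((@tnth n T)^~ i @^-1` A i).
Proof. by apply/seteqP; split=> [s As i _|s As i]; [exact: As|exact: As i I]. Qed.

Lemma measurable_box n (A : 'I_n -> set T) :
  (forall i, measurable (A i)) -> measurable (box A).
Proof.
move=> mA; rewrite boxE; apply: fin_bigcap_measurable => // i _.
by rewrite -[_ @^-1` _]setTI; exact: measurable_tnth.
Qed.

(** Boxes form a pi-system that generates the sigma-algebra of tuples. *)
Lemma box_unique n (m1 m2 : {measure set (n.-tuple T) -> \bar R}) (F : (set T)^nat) :
  (forall k, measurable (F k)) -> nondecreasing_seq F -> \bigcup_k F k = setT ->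
  (forall k, m1 (box (fun=> F k)) < +oo) ->
  (forall A, (forall i, measurable (A i)) -> m1 (box A) = m2 (box A)) ->
  forall S, measurable S -> m1 S = m2 S.
Proof.
move=> mF ndF UF Foo m12 S mS.
pose G := [set box A | A in [set A : 'I_n -> set T | forall i, measurable (A i)]].
apply: (measure_unique G (fun k => box (fun=> F k))) => //.
- apply/seteqP; split; last first.
    apply: smallest_sub; first exact: sigma_algebra_measurable.
    by move=> _ [A mA <-]; exact: measurable_box.
  apply: smallest_sub; first exact: smallest_sigma_algebra.
  rewrite -bigcup_seq => _ [i _ [B mB <-]]; apply: sub_sigma_algebra.
  exists (fun j => if j == i then B else setT).
    by move=> j /=; case: ifP.
  rewrite setTI; apply/seteqP; split=> [s /(_ i)|s Bs j]; first by rewrite eqxx.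
  by case: eqP => // ->.
- move=> _ _ [A mA <-] [B mB <-]; exists (fun i => A i `&` B i).
    by move=> i; exact: measurableI.
  apply/seteqP; split=> [s AB|s [As Bs] i]; last by split.
  by split=> i; have [] := AB i.
- by move=> k; exists (fun=> F k).
- apply/seteqP; split=> // s _.
  have /choice[k Fk] (i : 'I_n) : exists k, F k (tnth s i).
    by have : [set: T] (tnth s i) by []; rewrite -UF => -[k _ Fk]; exists k.
  exists (\max_(i < n) k i) => // i.
  have /subsetPset : F (k i) `<=` F (\max_(i < n) k i)%N.
    by apply/subsetPset/ndF/leq_bigmax.
  by move=> /subsetPset; apply; exact: Fk.
- by move=> _ [A mA <-]; exact: m12.
Qed.

Definition consp n (p : T * n.-tuple T) : n.+1.-tuple T := [tuple of p.1 :: p.2].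

Lemma measurable_consp n : measurable_fun setT (@consp n).
Proof. exact: measurable_cons. Qed.

Lemma consp_box n (A : 'I_n.+1 -> set T) :
  @consp n @^-1` box A = A ord0 `*` box (fun i => A (lift ord0 i)).
Proof.
apply/seteqP; split=> [[x s] /= As|[x s] /= [Ax As] i].
  split; first by have := As ord0.
  by move=> i /=; have := As (lift ord0 i); rewrite tnthS.
by case: (unliftP ord0 i) => [j ->|->//]; rewrite tnthS; exact: As.
Qed.

Section step.
Variables (mu : {sigma_finite_measure set T -> \bar R}) (n : nat).
Variable nu : {sigma_finite_measure set (n.-tuple T) -> \bar R}.

Definition powm_step : set (n.+1.-tuple T) -> \bar R :=
  pushforward (prodm mu nu) (@consp n).

HB.instance Definition _ := Measure.copy powm_step
  (measure_function_pushforward__canonical__measure_function_Measure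
     (prodm mu nu) (@measurable_consp n)).

Let powm_step_sigma_finite : sigma_finite setT powm_step.
Proof.
have [F UF Foo] := sigma_finiteT (prodm mu nu).
exists (fun k => (fun s : n.+1.-tuple T => (thead s, [tuple of behead s])) @^-1` F k).
  by rewrite -preimage_bigcup -UF preimage_setT.
move=> k; have [mF Fk] := Foo k; split.
  rewrite -[X in measurable X]setTI; apply: measurable_fun_pair => //.
    exact: measurable_tnth.
  exact: measurable_behead.
rewrite /powm_step /pushforward -comp_preimage (_ : _ \o _ = id)//.
by apply/funext => -[x s]; rewrite /= theadE; congr pair; exact/val_inj.
Qed.

HB.instance Definition _ := Measure_isSigmaFinite.Build _ _ _ powm_step
  powm_step_sigma_finite.

End step.

(** Power measures on tuples, built one coordinate at a time so that inductions on the
    number of points reduce to the product of two measures. *)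
Fixpoint powm (mu : {sigma_finite_measure set T -> \bar R}) n :
    {sigma_finite_measure set (n.-tuple T) -> \bar R} :=
  match n with
  | 0 => \d_[tuple]
  | n'.+1 => powm_step mu (powm mu n')
  end.

Variable mu : {sigma_finite_measure set T -> \bar R}.

Lemma powmS n S : powm mu n.+1 S = (mu \x powm mu n) (@consp n @^-1` S).
Proof. by []. Qed.

Lemma powm_box n (A : 'I_n -> set T) : (forall i, measurable (A i)) ->
  powm mu n (box A) = \prod_(i < n) mu (A i).
Proof.
elim: n A => [A mA|n IHn A mA].
  by rewrite big_ord0 /= diracE mem_set// => -[].
rewrite powmS consp_box product_measure1E//; last exact: measurable_box.
by rewrite IHn// big_ord_recl.
Qed.

Lemma powm_unique n (m2 : {measure set (n.-tuple T) -> \bar R}) :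
  (forall A, (forall i, measurable (A i)) -> \prod_(i < n) mu (A i) = m2 (box A)) ->
  forall S, measurable S -> powm mu n S = m2 S.
Proof.
move=> m2E.
have /sigma_finiteP[F [TF ndF Foo]] := sigma_finiteT mu.
apply: (@box_unique _ _ _ F) => //.
- by move=> k; have [] := Foo k.
- move=> k; rewrite [ltLHS](powm_box (fun=> (Foo k).1)).
  suff: 0 <= \prod_(i < n) mu (F k) < +oo by case/andP.
  elim/big_ind: _ => /=; first by rewrite lee01 ltey.
    move=> x y /andP[x0 xoo] /andP[y0 yoo].
    by rewrite mule_ge0//= lte_mul_pinfty// ge0_fin_numE.
  by move=> _ _; rewrite measure_ge0/=; have [] := Foo k.
- by move=> A mA; rewrite [LHS](powm_box mA); exact: m2E.
Qed.

Lemma powmS_ysection n S : measurable S ->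
  powm mu n.+1 S = \int[powm mu n]_s mu [set x | S (consp (x, s))].
Proof.
move=> mS; have mS' : measurable (@consp n @^-1` S).
  by rewrite -[X in measurable X]setTI; exact: measurable_consp.
rewrite powmS (@product_measure_unique _ _ _ _ _ mu (powm mu n) (mu \x^ powm mu n))//.
  apply: eq_integral => s _ /=; congr (mu _); apply/seteqP.
  by split=> x /=; rewrite /ysection /= in_setE.
by move=> A B mA mB; exact: product_measure2E.
Qed.

Lemma powmS_xsection n S : measurable S ->
  powm mu n.+1 S = \int[mu]_x powm mu n [set s | S (consp (x, s))].
Proof.
move=> mS; apply: eq_integral => x _ /=; congr (powm mu n _); apply/seteqP.
by split=> s /=; rewrite /xsection /= in_setE.
Qed.

Definition permt n (s : 'S_n) (t : n.-tuple T) : n.-tuple T :=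
  [tuple tnth t (s i) | i < n].

Lemma measurable_permt n (s : 'S_n) : measurable_fun setT (permt s).
Proof.
apply/measurable_fun_tnthP => i.
rewrite (_ : _ \o _ = (@tnth n T)^~ (s i)); first exact: measurable_tnth.
by apply/funext => t; rewrite /= tnth_mktuple.
Qed.

Lemma powm_perm n (s : 'S_n) S : measurable S ->
  powm mu n (permt s @^-1` S) = powm mu n S.
Proof.
move=> mS; apply/esym.
pose nu := measure_function_pushforward__canonical__measure_function_Measure
     (powm mu n) (measurable_permt s).
apply: (@powm_unique _ nu) => // A mA.
rewrite /nu /= /pushforward (_ : _ @^-1` _ = box (fun i => A ((s^-1)%g i))); last first.
  apply/seteqP; split=> [t At i|t At i]; last first.
    by have := At (s i); rewrite permK tnth_mktuple.
  by have := At ((s^-1)%g i); rewrite tnth_mktuple permKV.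
rewrite powm_box// (reindex_inj (@perm_inj _ (s^-1)%g))//.
Qed.

Lemma powm_prod_integral n (phi : T -> R) :
  measurable_fun setT phi -> (forall x, (0 <= phi x)%R) ->
  \int[powm mu n]_s (\prod_(i < n) phi (tnth s i))%:E = (\int[mu]_x (phi x)%:E) ^+ n.
Proof.
move=> mphi phi0.
have mprod k : measurable_fun setT (EFin \o (fun s : k.-tuple T => \prod_(i < k) phi (tnth s i)))%R.
  apply/measurable_EFinP/measurable_prod => i _.
  by apply: measurableT_comp => //; exact: measurable_tnth.
elim: n => [|n IHn].
  rewrite (eq_integral (cst 1)); last by move=> s _; rewrite big_ord0.
  by rewrite integral_cst// mul1e; exact: diracT.
have prod0 k (s : k.-tuple T) : 0 <= (\prod_(i < k) phi (tnth s i))%:E.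
  by rewrite lee_fin prodr_ge0.
rewrite [LHS](ge0_integral_pushforward (@measurable_consp n) _ measurableT (mprod _)); last by move=> s _; exact: prod0.
rewrite preimage_setT [LHS](@fubini_tonelli1 _ _ _ _ _ mu (powm mu n))//; first last.
- by move=> s; exact: prod0.
- exact: (measurableT_comp (mprod _) (@measurable_consp n)).
rewrite /fubini_F expeS -IHn -ge0_integralZr//.
- apply: eq_integral => x _ /=; rewrite -ge0_integralZl//.
  + apply: eq_integral => s _; rewrite big_ord_recl EFinM; congr (_%:E * _%:E).
    by apply: eq_bigr => i _; rewrite tnthS.
  + exact: mprod.
  + by move=> s _; exact: prod0.
  + by rewrite lee_fin.
- exact/measurable_EFinP.
- by move=> x _; rewrite lee_fin.
- by apply: integral_ge0 => s _; exact: prod0.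
Qed.

End tuple_power.

(** * Plane measure, and chains described by their edges *)

Section plane.
Local Open Scope ereal_scope.
Context (R : realType).

Definition leb : set R -> \bar R :=
  pushforward lebesgue_measure (idfun : measurableTypeR R -> R).

Let measurable_idR : measurable_fun setT (idfun : measurableTypeR R -> R).
Proof. exact: measurable_id. Qed.

HB.instance Definition _ := Measure.copy leb
  (measure_function_pushforward__canonical__measure_function_Measure
     (@lebesgue_measure R) measurable_idR).

Let leb_sigma_finite : sigma_finite setT leb.
Proof. exact: (@sigma_finiteT _ _ _ (@lebesgue_measure R)). Qed.

HB.instance Definition _ := Measure_isSigmaFinite.Build _ _ _ leb leb_sigma_finite.

(** The measure [area], with its sigma-finiteness attached so that it can be raised to powers. *)
Definition plane : {sigma_finite_measure set (R * R)%type -> \bar R} := prodm leb leb.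

Lemma plane_rect A B : measurable A -> measurable B ->
  plane (A `*` B) = leb A * leb B.
Proof. exact: product_measure1E. Qed.

Lemma area_plane A : measurable A -> area A = plane A.
Proof.
move=> mA.
have id2 : measurable_fun setT (idfun : (measurableTypeR R * measurableTypeR R)%type -> (R * R)%type).
  exact: measurable_id.
pose nu := measure_function_pushforward__canonical__measure_function_Measure
  (@lebesgue_measure R \x @lebesgue_measure R) id2.
apply/esym; apply: (@product_measure_unique _ _ _ _ _ leb leb nu) => // B C mB mC.
exact: product_measure1E.
Qed.

Lemma measurable_affine (c s : R) : measurable_fun setT (fun x : R => (c + s * x)%R).
Proof. by apply: measurable_funD => //; exact: measurable_funM. Qed.

Lemma leb_affine (c s : R) A : s != 0%R -> measurable A ->
  leb A = `|s|%:E * leb [set x | A (c + s * x)%R].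
Proof.
move=> s0 mA.
have mf : measurable_fun setT (fun x : measurableTypeR R => (c + s * x)%R : measurableTypeR R).
  exact: measurable_affine.
pose nu := mscale (NngNum (normr_ge0 s))
  (measure_function_pushforward__canonical__measure_function_Measure
  (@lebesgue_measure R) mf).
apply: (@lebesgue_measure_unique R nu) => // _ [[a b] _ <-].
rewrite -[RHS]/(`|s|%:E * lebesgue_measure [set x : R | `]a, b]%classic (c + s * x)%R]).
have [s_gt0|s_le0] := ltP 0%R s.
  rewrite [X in _ * lebesgue_measure X](_ : _ = `]((a - c) / s)%R, ((b - c) / s)%R]%classic).
    rewrite !lebesgue_measure_itv/= !lte_fin ltr_pM2r ?invr_gt0// ltrD2r.
    case: ifP => _; last by rewrite mule0.
    by rewrite -EFinD -EFinM gtr0_norm//; congr EFin; field.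
  apply/seteqP; split => x /=; rewrite !in_itv/= ltr_pdivrMr// ler_pdivlMr//;
    by rewrite ltrBlDr lerBrDr addrC mulrC.
have s_lt0 : (s < 0)%R by rewrite lt_neqAle s0.
rewrite [X in _ * lebesgue_measure X](_ : _ = `[((b - c) / s)%R, ((a - c) / s)%R[%classic).
  rewrite !lebesgue_measure_itv/= !lte_fin ltr_nM2r ?invr_lt0// ltrD2r.
  case: ifP => _; last by rewrite mule0.
  by rewrite -EFinD -EFinM ltr0_norm//; congr EFin; field.
apply/seteqP; split => x /=; rewrite !in_itv/= ltr_ndivlMr// ler_ndivrMr//;
  by rewrite ltrBlDr lerBrDr addrC mulrC andbC.
Qed.

Lemma measurable_diag (c s : R * R) :
  measurable_fun setT (fun p : R * R => (c.1 + s.1 * p.1, c.2 + s.2 * p.2)%R).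
Proof.
apply: measurable_fun_pair; apply: measurable_funD => //;
  by apply: measurable_funM.
Qed.

Lemma plane_diag (c s : R * R) A : s.1 != 0%R -> s.2 != 0%R -> measurable A ->
  plane A = `|s.1 * s.2|%:E * plane [set p | A (c.1 + s.1 * p.1, c.2 + s.2 * p.2)%R].
Proof.
move=> s1 s2 mA.
pose nu := mscale (NngNum (normr_ge0 (s.1 * s.2)%R))
  (measure_function_pushforward__canonical__measure_function_Measure
  plane (measurable_diag c s)).
apply: (@product_measure_unique _ _ _ _ _ leb leb nu) => // B C mB mC.
rewrite -[LHS]/(`|s.1 * s.2|%:E *
    plane [set p : R * R | (B `*` C) (c.1 + s.1 * p.1, c.2 + s.2 * p.2)%R]).
have mpre (c0 s0 : R) D : measurable D -> measurable [set x | D (c0 + s0 * x)%R].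
  by move=> mD; rewrite -[X in measurable X]setTI; exact: measurable_affine.
rewrite [X in _ * plane X](_ : _ = [set x | B (c.1 + s.1 * x)%R] `*` [set x | C (c.2 + s.2 * x)%R])//.
rewrite plane_rect//; [|exact: mpre..].
transitivity ((`|s.1|%:E * leb [set x | B (c.1 + s.1 * x)%R]) *
    (`|s.2|%:E * leb [set x | C (c.2 + s.2 * x)%R])).
  by rewrite normrM EFinM muleACA.
by congr (_ * _); apply/esym/leb_affine.
Qed.

Lemma plane_translate (c : R * R) A : measurable A ->
  plane [set p | A (c + p)%R] = plane A.
Proof.
move=> mA; rewrite (@plane_diag c (1, 1)%R A) ?oner_eq0//= mulr1 normr1 mul1e.
by congr (plane _); apply/seteqP; split=> -[x y] /=; rewrite !mul1r.
Qed.

Lemma plane_reflect (c : R * R) A : measurable A ->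
  plane [set p | A (c - p)%R] = plane A.
Proof.
move=> mA; rewrite (@plane_diag c (-1, -1)%R A) ?oppr_eq0 ?oner_eq0//= mulrNN mulr1 normr1 mul1e.
by congr (plane _); apply/seteqP; split=> -[x y] /=; rewrite !mulN1r.
Qed.

Lemma plane_swap A : measurable A -> plane [set p | A (p.2, p.1)] = plane A.
Proof.
move=> mA; apply/esym.
have ms : measurable_fun setT (fun p : R * R => (p.2, p.1)).
  by apply: measurable_fun_pair.
pose nu := measure_function_pushforward__canonical__measure_function_Measure
  plane ms.
apply: (@product_measure_unique _ _ _ _ _ leb leb nu) => // B C mB mC.
rewrite -[LHS]/(plane [set p : R * R | (B `*` C) (p.2, p.1)])
  [X in plane X](_ : _ = C `*` B).
  by rewrite plane_rect// [LHS]muleC.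
by apply/seteqP; split=> -[x y] [].
Qed.

Lemma measurable_shear (k : R) :
  measurable_fun setT (fun p : R * R => (p.1, p.2 + k * p.1)%R).
Proof.
apply: measurable_fun_pair => //; apply: measurable_funD => //.
exact: measurable_funM.
Qed.

Lemma plane_shear (k : R) A : measurable A ->
  plane [set p | A (p.1, p.2 + k * p.1)%R] = plane A.
Proof.
move=> mA; apply: eq_integral => x _ /=.
have mAx : measurable (xsection A x) by exact: measurable_xsection.
rewrite [RHS](@leb_affine (k * x) 1)%R ?oner_eq0// normr1 mul1e; congr (leb _).
apply/seteqP; split=> y; rewrite /xsection /= !in_setE/= mul1r addrC//.
Qed.

(** Barycentric-like coordinates of the triangle: [Phi] sends the origin to
    [ptB], [(1, 0)] to [ptC] and [(1, 1)] to [ptA]. *)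
Definition Phi (c : R * R) : R * R := (2 - c.1 - c.2, c.1 - c.2)%R.

Lemma measurable_Phi : measurable_fun setT Phi.
Proof.
apply: measurable_fun_pair; apply: measurable_funB => //.
exact: measurable_funB.
Qed.

Lemma plane_Phi A : measurable A -> plane A = 2%:E * plane (Phi @^-1` A).
Proof.
move=> mA.
pose A1 := [set p : R * R | A (p.2, p.1)].
pose A2 := [set p : R * R | A1 (0 + 1 * p.1, 2 + (- 2) * p.2)%R].
pose A3 := [set p : R * R | A2 (p.1, p.2 + 2^-1 * p.1)%R].
pose A4 := [set p : R * R | A3 (p.2, p.1)].
pose A5 := [set p : R * R | A4 (p.1, p.2 + (-1) * p.1)%R].
have msw (B : set (R * R)%type) : measurable B -> measurable [set p : R * R | B (p.2, p.1)].
  move=> mB; rewrite -[X in measurable X]setTI.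
  have ms : measurable_fun setT (fun p : R * R => (p.2, p.1)).
    by apply: measurable_fun_pair.
  exact: ms.
have m1 : measurable A1 by exact: msw.
have m2 : measurable A2.
  by rewrite -[X in measurable X]setTI; exact: (measurable_diag (0, 2)%R (1, -2)%R).
have m3 : measurable A3.
  by rewrite -[X in measurable X]setTI; exact: measurable_shear.
have m4 : measurable A4 by exact: msw.
have m5 : measurable A5.
  by rewrite -[X in measurable X]setTI; exact: measurable_shear.
have n2 : (- 2 : R)%R != 0%R by rewrite oppr_eq0 pnatr_eq0.
rewrite -(plane_swap mA) -/A1 (@plane_diag (0, 2)%R (1, -2)%R _ (oner_neq0 _) n2 m1)/=.
rewrite mul1r normrN normr_nat; congr (_ * _).
rewrite -/A2 -(plane_shear 2^-1 m2) -/A3 -(plane_swap m3) -/A4.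
rewrite -(plane_shear (-1)%R m4) -/A5 -(plane_swap m5); congr (plane _).
apply/funext => -[a b]; rewrite /A5 /A4 /A3 /A2 /A1 /Phi /preimage /=.
by congr A; congr pair; lra.
Qed.

Opaque plane powm.

Definition cumul n (c : R * R) (e : n.-tuple (R * R)) : n.-tuple (R * R) :=
  [tuple of scanl +%R c e].

Definition chain_pts n (c : R * R) (e : n.-tuple (R * R)) : n.-tuple (R * R) :=
  map_tuple Phi (cumul c e).

Lemma chain_pts_consp n c x (e : n.-tuple (R * R)) :
  chain_pts c (consp (x, e)) = consp (Phi (c + x)%R, chain_pts (c + x)%R e).
Proof. exact: val_inj. Qed.

Lemma measurable_addc (c : R * R) : measurable_fun setT (fun p : R * R => (c + p)%R).
Proof.
have -> : (fun p : R * R => (c + p)%R) = fun p => (c.1 + 1 * p.1, c.2 + 1 * p.2)%R.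
  by apply/funext => -[x y]; rewrite !mul1r.
exact: (measurable_diag c (1, 1)%R).
Qed.

Lemma measurable_addpair :
  measurable_fun setT (fun p : (R * R) * (R * R) => (p.1 + p.2)%R).
Proof.
rewrite (_ : (fun _ => _) = fun p : (R * R) * (R * R) => (p.1.1 + p.2.1, p.1.2 + p.2.2)%R)//.
by apply: measurable_fun_pair; apply: measurable_funD; exact: measurableT_comp.
Qed.

Lemma measurable_chain_pts n :
  measurable_fun setT (fun p : (R * R) * n.-tuple (R * R) => chain_pts p.1 p.2).
Proof.
elim: n => [|n IHn].
  by apply/measurable_fun_tnthP => -[].
rewrite (_ : (fun p => _) = fun p : (R * R) * n.+1.-tuple (R * R) =>
  consp (Phi (p.1 + thead p.2), chain_pts (p.1 + thead p.2) [tuple of behead p.2])%R); last first.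
  by apply/funext => -[c s]; rewrite -chain_pts_consp; congr chain_pts; rewrite [LHS]tuple_eta.
have mh : measurable_fun setT (fun p : (R * R) * n.+1.-tuple (R * R) => (p.1 + thead p.2)%R).
  have m2 : measurable_fun setT (fun p : (R * R) * n.+1.-tuple (R * R) => (p.1, thead p.2)).
    apply: measurable_fun_pair => //.
    exact: (measurableT_comp (measurable_tnth ord0) measurable_snd).
  exact: (measurableT_comp measurable_addpair m2).
have mb : measurable_fun setT (fun p : (R * R) * n.+1.-tuple (R * R) => ((p.1 + thead p.2)%R, [tuple of behead p.2])).
  apply: measurable_fun_pair => //.
  exact: (measurableT_comp (@measurable_behead _ _ n) measurable_snd).
apply: measurable_cons; first exact: (measurableT_comp measurable_Phi mh).
exact: (measurableT_comp IHn mb).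
Qed.

Lemma measurable_chain_pts0 n c : measurable_fun setT (@chain_pts n c).
Proof.
exact: (measurableT_comp (@measurable_chain_pts n) (pair1_measurable c)).
Qed.

Lemma plane_Phi_translate c A : measurable A ->
  plane A = 2%:E * plane [set e | A (Phi (c + e)%R)].
Proof.
move=> mA; have mP : measurable (Phi @^-1` A).
  by rewrite -[X in measurable X]setTI; exact: measurable_Phi.
by rewrite (plane_Phi mA) -[in LHS](plane_translate c mP).
Qed.

Lemma measurable_Phi_translate (c : R * R) : measurable_fun setT (fun e => Phi (c + e)%R).
Proof. exact: (measurableT_comp measurable_Phi (measurable_addc c)). Qed.

Lemma integral_Phi_translate c (g : R * R -> \bar R) :
  measurable_fun setT g -> (forall x, 0 <= g x) ->
  \int[plane]_x g x = 2%:E * \int[plane]_e g (Phi (c + e)%R).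
Proof.
move=> mg g0.
pose push := measure_function_pushforward__canonical__measure_function_Measure
  plane (measurable_Phi_translate c).
pose nu := mscale (NngNum (ler0n R 2)) push.
transitivity (\int[nu]_x g x).
  by apply: (@eq_measure_integral _ _ _ setT nu plane g) => A mA _; exact: plane_Phi_translate.
have E1 := @ge0_integral_mscale _ _ _ push setT measurableT (NngNum (ler0n R 2))
  g mg (fun x _ => g0 x).
have E2 := ge0_integral_pushforward (measurable_Phi_translate c) plane measurableT
  mg (fun x _ => g0 x).
by rewrite preimage_setT in E2; rewrite -[in RHS]E2; exact: E1.
Qed.

Lemma measurable_powm_section n (S : set (n.+1.-tuple (R * R))) : measurable S ->
  measurable_fun setT (fun x => powm plane n [set s | S (consp (x, s))]).
Proof.
move=> mS; rewrite (_ : (fun x => _) = powm plane n \o xsection (@consp _ _ n @^-1` S)); last first.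
  by apply/funext => x; congr (powm plane n _); apply/funext => s;
    rewrite /xsection /= in_setE.
have mC : measurable (@consp _ _ n @^-1` S).
  by rewrite -[X in measurable X]setTI; exact: measurable_consp.
exact: (@measurable_fun_xsection _ _ _ _ _ (powm plane n) _ mC).
Qed.

(** Passing from the vertices of a chain to its edges is a triangular linear map
    followed by [Phi] on each vertex; the factor [2] of each vertex comes from [Phi]. *)
Lemma powm_chain_pts n c (S : set (n.-tuple (R * R))) : measurable S ->
  powm plane n S = (2 ^+ n)%:E * powm plane n (chain_pts c @^-1` S).
Proof.
elim: n c S => [|n IHn] c S mS.
  rewrite expr0 mul1e; congr (powm plane 0 _); apply/funext => s.
  by congr (S _); rewrite [LHS]tuple0 [RHS]tuple0.
have mS' : measurable (chain_pts c @^-1` S).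
  by rewrite -[X in measurable X]setTI; exact: measurable_chain_pts0.
have mSx x : measurable [set s | S (consp (x, s))].
  rewrite -[X in measurable X]setTI.
  exact: (measurableT_comp (@measurable_consp _ _ n) (pair1_measurable x)).
rewrite !powmS_xsection//.
pose g x := powm plane n [set s | S (consp (x, s))].
have mg : measurable_fun setT g by exact: measurable_powm_section.
rewrite (integral_Phi_translate c mg)// exprS EFinM -muleA; congr (_ * _).
have mh := measurable_powm_section mS'.
have k0 : (0 <= 2 ^+ n :> R)%R by rewrite exprn_ge0.
rewrite -(@ge0_integralZl_EFin _ _ _ plane setT measurableT _
  (fun x _ => measure_ge0 _ _) mh _ k0).
apply: eq_integral => x _; rewrite /= /g (IHn (c + x)%R)//.
congr (_ * powm plane n _); apply/funext => s.
by rewrite /preimage /= chain_pts_consp.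
Qed.

(** Reflecting one increment through the sum of all the others exchanges it
    with the last edge of the chain. *)
Definition reflect_head n (c : R * R) (e : n.+1.-tuple (R * R)) :=
  consp ((c - \sum_(x <- e) x)%R, [tuple of behead e]).

Lemma powm_reflect n c (S : set (n.+1.-tuple (R * R))) :
  measurable S -> measurable (reflect_head c @^-1` S) ->
  powm plane n.+1 (reflect_head c @^-1` S) = powm plane n.+1 S.
Proof.
move=> mS mS'; rewrite (powmS_ysection plane mS) (powmS_ysection plane mS'); apply: eq_integral => s _.
have mSs : measurable [set x | S (consp (x, s))].
  rewrite -[X in measurable X]setTI.
  exact: (measurableT_comp (@measurable_consp _ _ n) (pair2_measurable s)).
rewrite -[RHS](plane_reflect (c - \sum_(x <- s) x)%R mSs); congr (plane _).
apply/funext => x; rewrite /preimage /reflect_head /= big_cons.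
have -> : [tuple of behead (consp (x, s))] = s by exact: val_inj.
by rewrite opprD [(- x - _)%R]addrC addrA.
Qed.

End plane.

Section finite_additivity.
Local Open Scope ereal_scope.
Context d (T : measurableType d) (R : realType) (mu : {measure set T -> \bar R}).
Variables (I : finType).

Lemma measure_le_sum (S : set T) (A : I -> set T) :
  measurable S -> (forall i, measurable (A i)) ->
  (forall x, S x -> exists i, A i x) -> mu S <= \sum_(i : I) mu (A i).
Proof.
move=> mS mA SA; rewrite (fsbig_seq _ _ (index_enum_uniq I)).
apply: content_sub_fsum => // x /SA[i Ai]; exists i => //.
by rewrite /= mem_index_enum.
Qed.

Lemma measure_ge_sum (S : set T) (A : I -> set T) :
  measurable S -> (forall i, measurable (A i)) ->
  (forall i x, A i x -> S x) -> (forall i j x, A i x -> A j x -> i = j) ->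
  \sum_(i : I) mu (A i) <= mu S.
Proof.
move=> mS mA AS Adisj; rewrite (fsbig_seq _ _ (index_enum_uniq I)) -measure_fin_bigcup//.
  apply: le_measure; rewrite ?inE//; last by move=> x [i _]; exact: AS.
  exact: fin_bigcup_measurable.
by move=> i j _ _ [x [Aix Ajx]]; exact: (Adisj i j x).
Qed.

End finite_additivity.

(** * Edges, slopes and convex chains *)

Section increments.
Context (R : realType).
Notation pt := (R * R)%type.
Implicit Types (p q : pt) (s : seq pt).

(** Comparison of slopes without division. *)
Definition steeper p q : bool := p.2 * q.1 < p.1 * q.2.
Definition ptpos p : bool := (0 < p.1) && (0 < p.2).
Definition edge_sum s : pt := \sum_(x <- s) x.
(** Chains join the origin to [(1, 1)]; the last edge is what the others leave. *)
Definition last_edge s : pt := (1, 1) - edge_sum s.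
Definition simplex s : bool := all ptpos s && ptpos (last_edge s).
Definition convex_chain s : bool :=
  [&& simplex s, pairwise steeper s & all (steeper^~ (last_edge s)) s].

Lemma edge_sum1E s : (edge_sum s).1 = \sum_(x <- s) x.1.
Proof. by rewrite /edge_sum; elim/big_rec2: _ => //= x a b _ ->. Qed.

Lemma edge_sum2E s : (edge_sum s).2 = \sum_(x <- s) x.2.
Proof. by rewrite /edge_sum; elim/big_rec2: _ => //= x a b _ ->. Qed.

Lemma perm_edge_sum s s' : perm_eq s s' -> edge_sum s = edge_sum s'.
Proof. exact: perm_big. Qed.

Lemma perm_simplex s s' : perm_eq s s' -> simplex s = simplex s'.
Proof.
by move=> ss'; rewrite /simplex (perm_all _ ss') /last_edge (perm_edge_sum ss').
Qed.

Lemma steeper_asym p q : steeper p q -> ~~ steeper q p.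
Proof. by rewrite /steeper -leNgt => /ltW; rewrite [q.1 * _]mulrC [q.2 * _]mulrC. Qed.

Lemma steeper_trans : {in ptpos & &, transitive steeper}.
Proof.
move=> q p r /andP[q1 q2] /andP[p1 p2] /andP[r1 r2]; rewrite /steeper => pq qr.
have : (p.2 * q.1) * (q.2 * r.1) < (p.1 * q.2) * (q.1 * r.2).
  by apply: ltr_pM => //; apply/ltW/mulr_gt0.
have -> : p.2 * q.1 * (q.2 * r.1) = (q.1 * q.2) * (p.2 * r.1) by ring.
have -> : p.1 * q.2 * (q.1 * r.2) = (q.1 * q.2) * (p.1 * r.2) by ring.
by rewrite ltr_pM2l// mulr_gt0.
Qed.

Definition gentler p q : bool := ~~ steeper q p.

Lemma gentler_total : total gentler.
Proof.
move=> p q; rewrite /gentler; case: (boolP (steeper q p)) => //= qp.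
exact: steeper_asym.
Qed.

Lemma gentler_trans : {in ptpos & &, transitive gentler}.
Proof.
move=> q p r /andP[q1 q2] /andP[p1 p2] /andP[r1 r2].
rewrite /gentler /steeper -!leNgt => pq qr.
have : (q.1 * p.2) * (r.1 * q.2) <= (q.2 * p.1) * (r.2 * q.1).
  by apply: ler_pM => //; apply: mulr_ge0; exact: ltW.
have -> : q.1 * p.2 * (r.1 * q.2) = (q.1 * q.2) * (r.1 * p.2) by ring.
have -> : q.2 * p.1 * (r.2 * q.1) = (q.1 * q.2) * (r.2 * p.1) by ring.
by rewrite ler_pM2l ?mulr_gt0.
Qed.

(** Sorting by slope: [gentler] is total, and only parallel edges can be tied. *)
Definition parallel p q : bool := p.2 * q.1 == p.1 * q.2.

Lemma gentler_steeper p q : gentler p q -> ~~ parallel p q -> steeper p q.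
Proof.
rewrite /gentler /steeper /parallel -leNgt lt_neqAle => pq ->/=.
by rewrite mulrC [leRHS]mulrC.
Qed.

Lemma pairwise_tnthP (T : Type) (r : rel T) n (t : n.-tuple T) :
  reflect (forall i j : 'I_n, (i < j)%N -> r (tnth t i) (tnth t j)) (pairwise r t).
Proof.
case: n t => [|n] t; first by rewrite [t]tuple0; apply: ReflectT => -[].
pose x0 := thead t; apply: (iffP (pairwiseP x0)) => [H i j ij|H i j].
  by rewrite !(tnth_nth x0); apply: H; rewrite // inE size_tuple.
rewrite !inE !size_tuple => ni nj ij.
by have := H (Ordinal ni) (Ordinal nj) ij; rewrite !(tnth_nth x0).
Qed.

Definition noparallel n (e : n.-tuple pt) :=
  forall i j : 'I_n, i != j -> ~~ parallel (tnth e i) (tnth e j).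

Lemma sort_steeper n (e : n.-tuple pt) : all ptpos e -> noparallel e ->
  exists s : 'S_n, pairwise steeper (permt s e).
Proof.
move=> e0 en; have /tuple_permP[s es] : perm_eq (sort gentler e) e.
  by rewrite perm_sort.
exists s; apply/pairwise_tnthP => i j ij; rewrite !tnth_mktuple.
apply: gentler_steeper; last first.
  by apply: en; rewrite (inj_eq perm_inj) neq_ltn ij.
have : pairwise gentler (sort gentler e).
  rewrite -(sorted_pairwise_in gentler_trans) ?all_sort//.
  exact: (sort_sorted gentler_total).
rewrite es => /pairwise_tnthP/(_ i j ij).
by rewrite !tnth_mktuple.
Qed.

Lemma mono_perm1 n (s : 'S_n) : (forall i j : 'I_n, (i < j)%N -> (s i < s j)%N) -> s = 1%g.
Proof.
move=> smono; apply/permP => i; rewrite perm1; apply: val_inj => /=.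
have E : [seq val (s j) | j <- enum 'I_n] = [seq val j | j <- enum 'I_n].
  apply: (irr_sorted_eq ltn_trans ltnn) => //.
  - rewrite sorted_map; have : sorted ltn (map val (enum 'I_n)).
      by rewrite val_enum_ord; exact: iota_ltn_sorted.
    rewrite sorted_map; apply: sub_sorted => x y /=; exact: smono.
  - by rewrite val_enum_ord; exact: iota_ltn_sorted.
  move=> k; apply/mapP/mapP => -[j _ ->]; last first.
    by exists ((s^-1)%g j); rewrite ?mem_enum// permKV.
  by exists (s j); rewrite ?mem_enum.
by move/eq_in_map: E; apply; rewrite mem_enum.
Qed.

(** At most one permutation sorts given edges by slope, since a monotone permutation is trivial. *)
Lemma steeper_perm_uniq n (e : n.-tuple pt) (s t : 'S_n) :
  pairwise steeper (permt s e) -> pairwise steeper (permt t e) -> s = t.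
Proof.
move=> /pairwise_tnthP es /pairwise_tnthP et.
have : (s * t^-1)%g = 1%g.
  apply: mono_perm1 => i j ij; rewrite ltnNge; apply/negP => ji.
  have : steeper (tnth e (s i)) (tnth e (s j)).
    by have := es _ _ ij; rewrite !tnth_mktuple.
  apply/negP; apply: steeper_asym.
  have /orP[/eqP/val_inj E|ji'] : (val ((s * t^-1)%g j) == val ((s * t^-1)%g i)) || ((s * t^-1)%g j < (s * t^-1)%g i)%N.
      by rewrite -leq_eqVlt.
    by move: ij; rewrite (perm_inj E) ltnn.
  by have := et _ _ ji'; rewrite !tnth_mktuple !permM !permKV.
by move=> /(congr1 (fun u => (u * t)%g)); rewrite mulgKV mul1g.
Qed.

End increments.

Arguments ptpos {R}.
Arguments steeper {R}.
Arguments gentler {R}.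
Arguments parallel {R}.
Arguments simplex {R}.
Arguments convex_chain {R}.

Section measurability.
Context d (T : measurableType d).

Lemma measurable_setb (f : T -> bool) :
  measurable_fun setT f -> measurable [set x | f x].
Proof.
move=> mf; rewrite (_ : mkset _ = setT `&` f @^-1` [set true]).
  exact: mf.
by rewrite setTI; apply/seteqP; split=> x.
Qed.

Lemma measurable_forall (I : finType) (A : I -> set T) :
  (forall i, measurable (A i)) -> measurable [set x | forall i, A i x].
Proof.
move=> mA; rewrite (_ : mkset _ = \bigcap_(i in [set: I]) A i).
  by apply: fin_bigcap_measurable.
by apply/seteqP; split=> [x Ax i _|x Ax i]; [exact: Ax|exact: Ax].
Qed.

Lemma measurable_imply (P : Prop) (A : set T) :
  (P -> measurable A) -> measurable [set x | P -> A x].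
Proof.
move=> mA; have [p|np] := pselect P.
  by rewrite (_ : mkset _ = A); [exact: mA|apply/seteqP; split=> [x /(_ p)|x Ax _]].
by rewrite (_ : mkset _ = setT)//; apply/seteqP; split=> // x _ /np.
Qed.

Context (R : realType).

Lemma measurable_set_lt (f g : T -> R) :
  measurable_fun setT f -> measurable_fun setT g -> measurable [set x | f x < g x].
Proof. by move=> mf mg; apply: measurable_setb; exact: measurable_fun_ltr. Qed.

Lemma measurable_set_le (f g : T -> R) :
  measurable_fun setT f -> measurable_fun setT g -> measurable [set x | f x <= g x].
Proof. by move=> mf mg; apply: measurable_setb; exact: measurable_fun_ler. Qed.

Lemma measurable_set_eq (f g : T -> R) :
  measurable_fun setT f -> measurable_fun setT g -> measurable [set x | f x == g x].
Proof. by move=> mf mg; apply: measurable_setb; exact: measurable_fun_eqr. Qed.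

Lemma measurable_steeper (f g : T -> (R * R)%type) :
  measurable_fun setT f -> measurable_fun setT g ->
  measurable [set x | steeper (f x) (g x)].
Proof.
move=> mf mg; apply: measurable_set_lt; apply: measurable_funM;
  exact: measurableT_comp.
Qed.

Lemma measurable_parallel (f g : T -> (R * R)%type) :
  measurable_fun setT f -> measurable_fun setT g ->
  measurable [set x | parallel (f x) (g x)].
Proof.
move=> mf mg; apply: measurable_set_eq; apply: measurable_funM;
  exact: measurableT_comp.
Qed.

Lemma measurable_ptpos (f : T -> (R * R)%type) :
  measurable_fun setT f -> measurable [set x | ptpos (f x)].
Proof.
move=> mf; rewrite (_ : mkset _ = [set x | 0 < (f x).1] `&` [set x | 0 < (f x).2]).
  by apply: measurableI; apply: measurable_set_lt => //; exact: measurableT_comp.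
by apply/seteqP; split=> [x /andP[]|x /andP].
Qed.

End measurability.

Section measurable_increments.
Context (R : realType) (n : nat).
Notation pt := (R * R)%type.
Implicit Types e : n.-tuple pt.

Lemma measurable_edge_sum : measurable_fun setT (fun e => edge_sum e).
Proof.
rewrite (_ : (fun _ => _) = fun e => (\sum_(i < n) (tnth e i).1, \sum_(i < n) (tnth e i).2)).
  apply: measurable_fun_pair; apply: measurable_sum => i;
    by apply: measurableT_comp => //; exact: measurable_tnth.
apply/funext => e; rewrite [LHS]surjective_pairing edge_sum1E edge_sum2E.
by rewrite !big_tuple.
Qed.

Lemma measurable_last_edge : measurable_fun setT (fun e => last_edge e).
Proof.
have mt := measurable_edge_sum.
rewrite (_ : (fun _ => _) = fun e => (1 - (edge_sum e).1, 1 - (edge_sum e).2))//.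
by apply: measurable_fun_pair; apply: measurable_funB => //; exact: measurableT_comp.
Qed.

Lemma measurable_all (P : pred pt) :
  measurable [set p | P p] -> measurable [set e : n.-tuple pt | all P e].
Proof.
move=> mP; rewrite (_ : mkset _ = [set e : n.-tuple pt | forall i, [set e : n.-tuple pt | P (tnth e i)] e]).
  apply: measurable_forall => i; rewrite -[X in measurable X]setTI.
  exact: (measurable_tnth i measurableT mP).
by apply/seteqP; split=> [e /all_tnthP|e H]; last exact/all_tnthP.
Qed.

Lemma measurable_simplex : measurable [set e : n.-tuple pt | simplex e].
Proof.
rewrite (_ : mkset _ = [set e : n.-tuple pt | all ptpos e] `&` [set e : n.-tuple pt | ptpos (last_edge e)]).
  apply: measurableI.
    apply: measurable_all; exact: (measurable_ptpos (@measurable_id _ _ setT)).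
  exact: (measurable_ptpos measurable_last_edge).
by apply/seteqP; split=> [e /andP[]|e /andP].
Qed.

Lemma measurable_last_steepest : measurable [set e : n.-tuple pt | all (steeper^~ (last_edge e)) e].
Proof.
rewrite (_ : mkset _ = [set e : n.-tuple pt | forall i, [set e : n.-tuple pt | steeper (tnth e i) (last_edge e)] e]).
  apply: measurable_forall => i.
  exact: (measurable_steeper (measurable_tnth i) measurable_last_edge).
by apply/seteqP; split=> [e /all_tnthP|e H]; last exact/all_tnthP.
Qed.

Lemma measurable_pairwise_steeper : measurable [set e : n.-tuple pt | pairwise steeper e].
Proof.
rewrite (_ : mkset _ = [set e : n.-tuple pt | forall i : 'I_n, [set e : n.-tuple pt | forall j : 'I_n,
    [set e : n.-tuple pt | (i < j)%N -> [set e : n.-tuple pt | steeper (tnth e i) (tnth e j)] e] e] e]).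
  apply: measurable_forall => i; apply: measurable_forall => j.
  apply: measurable_imply => _.
  exact: (measurable_steeper (measurable_tnth i) (measurable_tnth j)).
by apply/seteqP; split=> [e /pairwise_tnthP|e H]; last exact/pairwise_tnthP.
Qed.

End measurable_increments.

(** * Sorting the edges by slope *)

Section null_sets.
Local Open Scope ereal_scope.
Context (R : realType).
Notation pt := (R * R)%type.
Notation plane := (@plane R).
Notation leb := (@leb R).

Lemma leb_set1 (x : R) : leb [set x] = 0.
Proof. exact: lebesgue_measure_set1. Qed.

Lemma plane_line0 (a b c : R) : b != 0%R ->
  plane [set p | a * p.1 + b * p.2 == c]%R = 0.
Proof.
move=> b0; rewrite -[LHS]/(\int[leb]_x leb (xsection [set p | a * p.1 + b * p.2 == c]%R x)).
apply: integral0_eq => x _.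
rewrite (_ : xsection _ x = [set ((c - a * x) / b)%R]) ?leb_set1//.
apply/seteqP; split=> y; rewrite /xsection /= in_setE/=.
  by move=> /eqP <-; rewrite addrC addKr mulrAC divff// mul1r.
by move=> ->; apply/eqP; field.
Qed.

Lemma plane_parallel0 (q : pt) : ptpos q -> plane [set p | parallel p q] = 0.
Proof.
move=> /andP[q1 q2]; apply: etrans (@plane_line0 (- q.2)%R q.1 0%R _); last by rewrite gt_eqF.
congr (plane _); apply/seteqP; split=> p; rewrite /parallel /=.
  by move=> /eqP E; apply/eqP; rewrite [(q.1 * _)%R]mulrC E; ring.
by rewrite mulNr addrC subr_eq0 => /eqP E; apply/eqP; rewrite mulrC E mulrC.
Qed.

Variable n : nat.
Notation mu := (powm plane).

Lemma powm_head0 (A : set (n.+1.-tuple pt)) : measurable A ->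
  (forall s : n.-tuple pt, plane [set x | A (consp (x, s))] = 0) -> mu n.+1 A = 0.
Proof.
move=> mA A0; rewrite (powmS_ysection plane mA).
by apply: integral0_eq => s _; exact: A0.
Qed.

Lemma measurable_section_head (A : set (n.+1.-tuple pt)) (s : n.-tuple pt) :
  measurable A -> measurable [set x | A (consp (x, s))].
Proof.
move=> mA; rewrite -[X in measurable X]setTI.
exact: (measurableT_comp (@measurable_consp _ _ n) (pair2_measurable s)).
Qed.

End null_sets.

Section symmetrization.
Local Open Scope ereal_scope.
Context (R : realType).
Notation pt := (R * R)%type.
Notation plane := (@plane R).
Notation mu := (powm plane).

Lemma permtK n (s : 'S_n) (e : n.-tuple pt) : permt (s^-1)%g (permt s e) = e.
Proof. by apply: eq_from_tnth => i; rewrite !tnth_mktuple permKV. Qed.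

Lemma perm_eq_permt n (s : 'S_n) (e : n.-tuple pt) : perm_eq (permt s e) e.
Proof. by apply/tuple_permP; exists s. Qed.

Lemma measurable_permt_pre n (s : 'S_n) (A : set (n.-tuple pt)) :
  measurable A -> measurable (permt s @^-1` A).
Proof. by move=> mA; rewrite -[X in measurable X]setTI; exact: measurable_permt. Qed.

Definition tie n (i j : 'I_n) : set (n.-tuple pt) :=
  [set e | ptpos (tnth e j)] `&` [set e | parallel (tnth e i) (tnth e j)].

Lemma measurable_tie n (i j : 'I_n) : measurable (tie i j).
Proof.
apply: measurableI.
  exact: (measurable_ptpos (measurable_tnth j)).
exact: (measurable_parallel (measurable_tnth i) (measurable_tnth j)).
Qed.

(** Given one of the two edges, the other one is confined to a line. *)
Lemma tie_null n (i j : 'I_n) : i != j -> mu n (tie i j) = 0.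
Proof.
case: n i j => [|n] i j ij; first by case: i ij => [].
have tie0 (k : 'I_n) : mu n.+1 (tie ord0 (lift ord0 k)) = 0.
  apply: powm_head0; first exact: measurable_tie.
  move=> s; have [sk|sk] := boolP (ptpos (tnth s k)); last first.
    rewrite (_ : mkset _ = set0) ?measure0//.
    apply/seteqP; split=> // x [] /=; rewrite tnthS => skp.
    by rewrite skp in sk.
  rewrite -(plane_parallel0 sk); congr (plane _).
  by apply/seteqP; split=> x; rewrite /tie /= tnthS; [case|split].
have : tperm i ord0 j != ord0.
  by apply: contra ij => /eqP/(canRL (tpermK _ _)); rewrite tpermR eq_sym => ->.
rewrite eq_sym => /unlift_some[k jk _].
rewrite -(tie0 k) -(powm_perm plane (tperm i ord0) (measurable_tie ord0 (lift ord0 k))); congr (mu _ _).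
apply/seteqP; split=> e; rewrite /tie /= !tnth_mktuple tpermR -jk tpermK //.
Qed.

Section invariant_set.
Variables (n : nat) (H : set (n.-tuple pt)).
Hypothesis mH : measurable H.
Hypothesis Hperm : forall (s : 'S_n) e, H e -> H (permt s e).

Let sorted_H := [set e : n.-tuple pt | pairwise steeper e] `&` H.

Let msorted_H : measurable sorted_H.
Proof. by apply: measurableI => //; exact: measurable_pairwise_steeper. Qed.

Let sum_perm : \sum_(s : 'S_n) mu n (permt s @^-1` sorted_H) =
  (n`!)%:R%:E * mu n sorted_H.
Proof.
rewrite (eq_bigr (fun=> mu n sorted_H)); last by move=> s _; exact: powm_perm.
by rewrite sumr_const card_Sn mule_natl.
Qed.

(** The [n!] rearrangements of the sorted part of [H] are disjoint subsets of [H] of the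
    same measure. *)
Lemma powm_sorted_le : (n`!)%:R%:E * mu n sorted_H <= mu n H.
Proof.
rewrite -sum_perm; apply: measure_ge_sum => //.
- by move=> s; exact: measurable_permt_pre.
- by move=> s e [_ He]; rewrite -(permtK s e); exact: Hperm.
- by move=> s t e [es _] [et _]; exact: steeper_perm_uniq es et.
Qed.

(** The rearrangements of the sorted part of [H] cover [H] up to the null set of ties. *)
Lemma le_powm_sorted : (forall e, H e -> all ptpos e) ->
  mu n H <= (n`!)%:R%:E * mu n sorted_H.
Proof.
move=> Hpos; rewrite -sum_perm.
pose A (x : 'S_n + 'I_n * 'I_n) := match x with
  | inl s => permt s @^-1` sorted_H
  | inr ij => if ij.1 == ij.2 then set0 else tie ij.1 ij.2
  end.
have := @measure_le_sum _ _ _ (mu n) _ H A mH.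
rewrite big_sumType/= [X in _ + X]big1 ?adde0; last first.
  by move=> [i j] _ /=; case: ifPn => ij; rewrite ?measure0//; exact: tie_null.
apply=> [[s|[i j]] /=|e He].
- exact: measurable_permt_pre.
- by case: ifP => // _; exact: measurable_tie.
have [en|] := pselect (noparallel e).
  have [s es] := sort_steeper (Hpos _ He) en.
  by exists (inl s); split => //; exact: Hperm.
move=> /existsNP[i /existsNP[j /not_implyP[ij /negP/negPn eij]]].
exists (inr (i, j)) => /=; rewrite (negPf ij); split=> //=.
by have /all_tnthP := Hpos _ He; exact.
Qed.

End invariant_set.

Section last_edge.
Variable n : nat.
Implicit Types e : n.-tuple pt.

Lemma exists_steepest (s : seq pt) : s != [::] -> all ptpos s ->
  exists2 m, m \in s & all (gentler^~ m) s.
Proof.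
elim: s => //= x s IHs _ /andP[x0 s0].
have [s_nil|sn] := eqVneq s [::].
  exists x; rewrite ?mem_head//= s_nil/= andbT.
  by have := gentler_total x x; rewrite orbb.
have [m ms ml] := IHs sn s0.
have m0 : ptpos m by exact: (allP s0).
have [xm|] := boolP (gentler x m).
  by exists m; rewrite ?inE ?ms ?orbT//= xm.
move=> /negPn xm; have mx : gentler m x.
  by have := gentler_total m x; rewrite /gentler xm orbF.
exists x; rewrite ?mem_head//=; apply/andP; split.
  by have := gentler_total x x; rewrite orbb.
apply/allP => y ys; apply: (@gentler_trans _ m) => //.
  exact: (allP s0).
exact: (allP ml).
Qed.

Definition edge (e : n.-tuple pt) (o : option 'I_n) : pt :=
  if o is Some i then tnth e i else last_edge e.

Definition steepest o : set (n.-tuple pt) :=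
  [set e : n.-tuple pt | simplex e && all (gentler^~ (edge e o)) (last_edge e :: e)].

Lemma measurable_gentler d (T : measurableType d) (f g : T -> pt) :
  measurable_fun setT f -> measurable_fun setT g ->
  measurable [set x | gentler (f x) (g x)].
Proof.
move=> mf mg; rewrite (_ : mkset _ = ~` [set x | steeper (g x) (f x)]).
  by apply: measurableC; exact: measurable_steeper.
by apply/seteqP; split=> x /negP.
Qed.

Lemma measurable_edge o : measurable_fun setT (fun e : n.-tuple pt => edge e o).
Proof. by case: o => [i|]; [exact: measurable_tnth|exact: measurable_last_edge]. Qed.

Lemma measurable_steepest o : measurable (steepest o).
Proof.
have -> : steepest o = [set e : n.-tuple pt | simplex e] `&`
    [set e : n.-tuple pt | forall o', [set e : n.-tuple pt | gentler (edge e o') (edge e o)] e].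
  apply/seteqP; split=> e.
    move=> /andP[se /= /andP[eo /all_tnthP H]]; split=> //= -[i|] //; exact: H.
  move=> [/= se H]; apply/andP; split=> //; apply/andP; split; first exact: H None.
  by apply/all_tnthP => i; exact: H (Some i).
apply: measurableI; first exact: measurable_simplex.
apply: measurable_forall => o'.
exact: (measurable_gentler (measurable_edge o') (measurable_edge o)).
Qed.

Lemma simplex_steepest e : simplex e -> exists o, steepest o e.
Proof.
move=> es; have /andP[e0 l0] := es.
have H : all ptpos (last_edge e :: e) by rewrite /= l0.
have [m] := @exists_steepest (last_edge e :: e) isT H.
rewrite inE => /orP[/eqP->|/tnthP[i ->]] em.
  by exists None; rewrite /steepest /= es.
by exists (Some i); rewrite /steepest /= es.
Qed.

End last_edge.

Lemma perm_last_edge (s s' : seq pt) : perm_eq s s' -> last_edge s = last_edge s'.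
Proof. by move=> ss'; rewrite /last_edge (perm_edge_sum ss'). Qed.

Lemma reflect_head_consp n x (s : n.-tuple pt) :
  reflect_head (1, 1)%R (consp (x, s)) = consp (last_edge (consp (x, s)), s).
Proof. exact: val_inj. Qed.

Lemma last_edge_reflect x (s : seq pt) : last_edge (last_edge (x :: s) :: s) = x.
Proof. by rewrite /last_edge /edge_sum !big_cons opprD opprB addrCA addrA subrK addrK. Qed.

Lemma measurable_reflect_head n c :
  measurable_fun setT (@reflect_head R n c).
Proof.
apply: measurable_cons; last exact: measurable_behead.
have -> : (fun e : n.+1.-tuple pt => c - \sum_(x <- e) x)%R =
    (fun p : pt => (c.1 + (-1) * p.1, c.2 + (-1) * p.2)%R) \o (fun e : n.+1.-tuple pt => edge_sum e).
  by apply/funext => e /=; rewrite !mulN1r.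
exact: (measurableT_comp (measurable_diag c (-1, -1)%R) (@measurable_edge_sum R n.+1)).
Qed.

(** Exchanging an edge with the last one preserves the measure. *)
Lemma powm_steepest n (o : option 'I_n) : mu n (steepest o) = mu n (steepest None).
Proof.
case: o => // i; case: n i => [|n] i; first by case: i.
transitivity (mu n.+1 (steepest (Some ord0))).
  rewrite -(powm_perm plane (tperm i ord0) (measurable_steepest (Some ord0))).
  congr (mu _ _); apply/funext => e; rewrite /preimage /steepest /=.
  rewrite (perm_simplex (perm_eq_permt _ e)) (perm_last_edge (perm_eq_permt _ e)).
  by rewrite tnth_mktuple tpermR -(perm_all _ (perm_eq_permt (tperm i ord0) e)).
have mpre : measurable (reflect_head (1, 1)%R @^-1` @steepest n.+1 None).
  rewrite -[X in measurable X]setTI.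
  exact: (measurable_reflect_head _ measurableT (measurable_steepest None)).
rewrite -(powm_reflect (measurable_steepest None) mpre); congr (mu _ _).
apply/funext => e.
have [x [s ->]] : exists x s, e = consp (x, s).
  by exists (thead e), [tuple of behead e]; rewrite [LHS]tuple_eta.
rewrite -[RHS]/(steepest None (reflect_head (1, 1)%R (consp (x, s)))).
rewrite reflect_head_consp /steepest /edge /= last_edge_reflect.
rewrite /simplex /= last_edge_reflect.
have -> : gentler x x by have := gentler_total x x; rewrite orbb.
congr is_true; rewrite (_ : tnth _ ord0 = x)//.
by case: (ptpos x); case: (all ptpos s); case: (ptpos (last_edge _)).
Qed.

Definition last_steepest n : set (n.-tuple pt) :=
  [set e : n.-tuple pt | all (steeper^~ (last_edge e)) e].

Definition tie_last n (i : 'I_n) : set (n.-tuple pt) :=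
  [set e : n.-tuple pt | simplex e] `&` [set e : n.-tuple pt | parallel (tnth e i) (last_edge e)].

Lemma measurable_tie_last n (i : 'I_n) : measurable (tie_last i).
Proof.
apply: measurableI; first exact: measurable_simplex.
exact: (measurable_parallel (measurable_tnth i) (@measurable_last_edge R n)).
Qed.

Lemma tie_last_null n (i : 'I_n) : mu n (tie_last i) = 0.
Proof.
case: n i => [|n] i; first by case: i.
transitivity (mu n.+1 (tie_last ord0)).
  rewrite -(powm_perm plane (tperm i ord0) (measurable_tie_last ord0)).
  congr (mu _ _); apply/funext => e; rewrite /preimage /tie_last /=.
  rewrite (perm_simplex (perm_eq_permt _ e)) (perm_last_edge (perm_eq_permt _ e)).
  by rewrite tnth_mktuple tpermR.
apply: powm_head0; first exact: measurable_tie_last.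
move=> s; pose w : pt := last_edge s.
have lw x : last_edge (x :: s) = (w - x)%R.
  by rewrite /w /last_edge /edge_sum big_cons opprD addrCA addrC.
have [w0|w0] := boolP (ptpos w); last first.
  rewrite (_ : mkset _ = set0) ?measure0//.
  apply/seteqP; split=> // x [] /= + _; rewrite /simplex /= lw => /andP[/andP[x0 _] wx0].
  apply: (negP w0); move: x0 wx0 => /andP[x1 x2] /andP[/= wx1 wx2].
  have {}wx1 : (0 < w.1 - x.1)%R by exact: wx1.
  have {}wx2 : (0 < w.2 - x.2)%R by exact: wx2.
  by apply/andP; split; lra.
apply/eqP; rewrite -measure_le0 -(plane_parallel0 w0); apply: le_measure.
- by rewrite inE; apply: measurable_section_head; exact: measurable_tie_last.
- by rewrite inE; exact: (measurable_parallel (@measurable_id _ _ setT) (@measurable_cst _ _ _ _ setT w)).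
move=> x [] /= _; rewrite /parallel lw /= => /eqP E; apply/eqP.
have E' : (x.2 * (w.1 - x.1) = x.1 * (w.2 - x.2))%R by exact: E.
lra.
Qed.

(** Each of the [n + 1] edges is equally often the steepest one. Since [G] need not be
    stable under exchanging an edge with the last one, it only enters after this step. *)
Lemma simplex_le_last_steepest n (G : set (n.-tuple pt)) : measurable G ->
  mu n [set e : n.-tuple pt | simplex e] <=
  (n.+1)%:R%:E * (mu n ([set e : n.-tuple pt | simplex e] `&` @last_steepest n `&` G) +
    mu n ([set e : n.-tuple pt | simplex e] `\` G)).
Proof.
move=> mG.
have mS := @measurable_simplex R n.
have mL : measurable (@last_steepest n) by exact: measurable_last_steepest.
apply: (@le_trans _ _ (\sum_(o : option 'I_n) mu n (steepest o))).
  apply: measure_le_sum => //; first by move=> o; exact: measurable_steepest.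
  by move=> e; exact: simplex_steepest.
rewrite (eq_bigr (fun=> mu n (steepest None))); last by move=> o _; exact: powm_steepest.
rewrite sumr_const card_option card_ord -[leLHS]mule_natl.
apply: lee_wpmul2l; first by rewrite lee_fin.
pose A (x : bool + 'I_n) := match x with
  | inl true => [set e : n.-tuple pt | simplex e] `&` @last_steepest n `&` G
  | inl false => [set e : n.-tuple pt | simplex e] `\` G
  | inr i => tie_last i
  end.
have := @measure_le_sum _ _ _ (mu n) _ (@steepest n None) A (measurable_steepest None).
rewrite big_sumType/= [X in _ + X]big1 ?adde0; last by move=> i _; exact: tie_last_null.
rewrite big_bool/=; apply=> [[[]|i] /=|e /andP[se /= /andP[_ /all_tnthP H]]].
- by apply: measurableI => //; exact: measurableI.
- exact: measurableD.
- exact: measurable_tie_last.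
have [eG|eG] := pselect (G e); last by exists (inl false).
have [el|] := boolP (all (steeper^~ (last_edge e)) e).
  by exists (inl true).
move=> /allPn[x /tnthP[i ->{x}] ei]; exists (inr i); split=> //=.
by apply: contraNT ei; exact: gentler_steeper.
Qed.

End symmetrization.

Lemma integralZ_EFin d (T : measurableType d) (R : realType)
    (mu : {measure set T -> \bar R}) (k : R) (F : T -> R) :
  (0 <= k)%R -> (forall x, (0 <= F x)%R) -> measurable_fun setT F ->
  (\int[mu]_x (k%:E * (F x)%:E) = k%:E * \int[mu]_x (F x)%:E)%E.
Proof.
move=> k0 F0 mF; apply: ge0_integralZl_EFin => //.
  by move=> x _; rewrite lee_fin.
exact/measurable_EFinP.
Qed.

(** * Exponential weights *)

Section exponential_integrals.
Local Open Scope ereal_scope.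
Context (R : realType).
Notation pt := (R * R)%type.
Notation plane := (@plane R).
Notation leb := (@leb R).

Lemma integral_leb (F : R -> \bar R) :
  measurable_fun setT F -> (forall x, 0 <= F x) ->
  \int[leb]_x F x = \int[lebesgue_measure]_x F x.
Proof.
move=> mF F0.
have mid : measurable_fun setT (idfun : measurableTypeR R -> R).
  exact: measurable_id.
have E := ge0_integral_pushforward mid (@lebesgue_measure R) measurableT
  mF (fun x _ => F0 x).
by rewrite preimage_setT in E.
Qed.

Lemma measurable_addr (c : R) : measurable_fun setT (fun x : R => (c + x)%R).
Proof. exact: measurable_funD. Qed.

Lemma integral_leb_translate (c : R) (F : R -> \bar R) :
  measurable_fun setT F -> (forall x, 0 <= F x) ->
  \int[leb]_x F x = \int[leb]_x F (c + x)%R.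
Proof.
move=> mF F0.
pose nu := measure_function_pushforward__canonical__measure_function_Measure
  leb (measurable_addr c).
transitivity (\int[nu]_x F x).
  apply: (@eq_measure_integral _ _ _ setT nu leb F) => A mA _.
  rewrite [LHS](@leb_affine _ c 1)%R ?oner_eq0// normr1 mul1e.
  by congr (leb _); apply/funext => x; rewrite /= mul1r.
have E := ge0_integral_pushforward (measurable_addr c) leb measurableT
  mF (fun x _ => F0 x).
by rewrite preimage_setT in E.
Qed.

Definition tail (b : bool) (p t x : R) : R :=
  (if (if b then t <= x else t < x) then expR (- p * x) else 0)%R.

Lemma tail_ge0 b p t x : (0 <= tail b p t x)%R.
Proof. by rewrite /tail; case: ifP => // _; exact: expR_ge0. Qed.

Lemma measurable_tail b p t : measurable_fun setT (tail b p t).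
Proof.
apply: measurable_fun_ifT => //.
  by case: b; [exact: measurable_fun_ler|exact: measurable_fun_ltr].
by apply: measurableT_comp => //; exact: measurable_funM.
Qed.

Lemma integral_tail b (p t : R) : (0 < p)%R ->
  \int[leb]_x (tail b p t x)%:E = (expR (- p * t) / p)%:E.
Proof.
move=> p0.
have mt u : measurable_fun setT (EFin \o tail b p u).
  by apply/measurable_EFinP; exact: measurable_tail.
rewrite (integral_leb_translate t (mt t)); last by move=> x; rewrite lee_fin tail_ge0.
transitivity (\int[leb]_x ((expR (- p * t))%:E * (tail b p 0 x)%:E)).
  apply: eq_integral => x _; rewrite -EFinM /tail /= lerDl ltrDl.
  case: ifP => _; last by rewrite mulr0.
  by rewrite mulrDr expRD.
rewrite integralZ_EFin ?expR_ge0//; [|exact: tail_ge0|exact: measurable_tail].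
rewrite EFinM; congr (_ * _).
rewrite (integral_leb (mt 0%R)); last by move=> x; rewrite lee_fin tail_ge0.
transitivity (\int[lebesgue_measure]_x ((p^-1)%:E * (exponential_pdf p x)%:E)); last first.
  rewrite integralZ_EFin ?invr_ge0 ?ltW//;
    [|by move=> x; rewrite exponential_pdf_ge0// ltW|exact: measurable_exponential_pdf].
  by rewrite integral_exponential_pdf// mule1.
have mpdf : measurable_fun setT (fun x : R => (p^-1)%:E * (exponential_pdf p x)%:E).
  apply: measurable_funeM; apply/measurable_EFinP; exact: measurable_exponential_pdf.
have md : measurable ([set: R] `\ 0%R) by exact: measurableD.
rewrite -[LHS](integral_setD1 md (measurable_funTS (mt 0%R))).
rewrite -[RHS](integral_setD1 md (measurable_funTS mpdf)).
apply: eq_integral => x; rewrite inE => -[_ /= /eqP x0].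
rewrite -EFinM; congr EFin; rewrite /tail.
have [x_gt0|x_lt0|x00] := ltgtP 0%R x; last by rewrite x00 eqxx in x0.
  rewrite exponential_pdfE ?ltW// mulrA mulVf ?gt_eqF// mul1r.
  by case: (b).
by rewrite lt0_exponential_pdf// mulr0; case: (b).
Qed.

Definition under (r : R) (x : pt) : bool := (x.2 <= r * x.1)%R.

Definition expw (p q : R) (x : pt) : R := expR (- p * x.1 - q * x.2).

Lemma measurable_under r : measurable_fun setT (under r).
Proof. by apply: measurable_fun_ler => //; exact: measurable_funM. Qed.

Lemma measurable_fun_ptpos : measurable_fun setT (@ptpos R).
Proof. by apply: measurable_and; exact: measurable_fun_ltr. Qed.

Lemma measurable_expw p q : measurable_fun setT (expw p q).
Proof.
by apply: measurableT_comp => //; apply: measurable_funB; exact: measurable_funM.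
Qed.

Lemma integral_under (r p q : R) : (0 < r)%R -> (0 < p)%R -> (0 < q)%R ->
  \int[plane]_x (if ptpos x && under r x then expw p q x else 0%R)%:E =
  (r / (p * (p + q * r)))%:E.
Proof.
move=> r0 p0 q0.
pose f (x : pt) := (if ptpos x && under r x then expw p q x else 0%R)%:E.
have mf : measurable_fun setT f.
  apply/measurable_EFinP; apply: measurable_fun_ifT => //.
    by apply: measurable_and; [exact: measurable_fun_ptpos|exact: measurable_under].
  exact: measurable_expw.
have f0 x : 0 <= f x by rewrite lee_fin; case: ifP => // _; exact: expR_ge0.
rewrite -[LHS]/(\int[leb \x leb]_x f x) (fubini_tonelli2 (m1 := leb) (m2 := leb) f mf f0).
rewrite /fubini_G.
pose w := (q + p / r)%R.
have w0 : (0 < w)%R by rewrite addr_gt0// divr_gt0.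
transitivity (\int[leb]_y ((p^-1)%:E * (tail false w 0 y)%:E)).
  apply: eq_integral => y _; rewrite /f /ptpos /under /=.
  have [y0|y0] := ltP 0%R y; last first.
    rewrite integral0_eq; last by move=> x _; rewrite andbF.
    by rewrite /tail ltNge y0 mule0.
  transitivity (\int[leb]_x ((expR (- q * y))%:E * (tail true p (y / r) x)%:E)).
    apply: eq_integral => x _; rewrite -EFinM /tail andbT ler_pdivrMr// mulrC.
    have [yx|yx] := leP y (x * r)%R; last by rewrite andbF mulr0.
    have x0 : (0 < x)%R by rewrite -(pmulr_lgt0 _ r0) (lt_le_trans y0).
    by rewrite x0 /expw /= -expRD; congr (expR _)%:E; ring.
  rewrite integralZ_EFin ?expR_ge0//; [|exact: tail_ge0|exact: measurable_tail].
  rewrite integral_tail// /tail y0 -!EFinM; congr EFin.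
  rewrite mulrA [RHS]mulrC -expRD; congr (expR _ / p)%R; rewrite /w; field.
  by rewrite gt_eqF.
rewrite integralZ_EFin ?invr_ge0 ?ltW//; [|exact: tail_ge0|exact: measurable_tail].
rewrite integral_tail// mulr0 expR0 -EFinM; congr EFin; rewrite /w; field.
by rewrite !gt_eqF// addr_gt0// mulr_gt0.
Qed.

Lemma integral_above (r p q : R) : (0 < r)%R -> (0 < p)%R -> (0 < q)%R ->
  \int[plane]_x (if ptpos x && ~~ under r x then expw p q x else 0%R)%:E =
  (q * (p + q * r))^-1%:E.
Proof.
move=> r0 p0 q0.
pose f (x : pt) := (if ptpos x && ~~ under r x then expw p q x else 0%R)%:E.
have mf : measurable_fun setT f.
  apply/measurable_EFinP; apply: measurable_fun_ifT => //.
    apply: measurable_and; first exact: measurable_fun_ptpos.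
    by apply: measurable_neg; exact: measurable_under.
  exact: measurable_expw.
have f0 x : 0 <= f x by rewrite lee_fin; case: ifP => // _; exact: expR_ge0.
rewrite -[LHS]/(\int[leb \x leb]_x f x) (fubini_tonelli1 (m1 := leb) (m2 := leb) f mf f0).
rewrite /fubini_F.
pose w := (p + q * r)%R.
have w0 : (0 < w)%R by rewrite addr_gt0// mulr_gt0.
transitivity (\int[leb]_x ((q^-1)%:E * (tail false w 0 x)%:E)).
  apply: eq_integral => x _; rewrite /f /ptpos /under /=.
  have [x0|x0] := ltP 0%R x; last first.
    rewrite integral0_eq; last by [].
    by rewrite /tail ltNge x0 mule0.
  transitivity (\int[leb]_y ((expR (- p * x))%:E * (tail false q (r * x) y)%:E)).
    apply: eq_integral => y _; rewrite -EFinM /tail -ltNge /=.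
    have [yx|yx] := ltP (r * x)%R y; last by rewrite andbF mulr0.
    have y0 : (0 < y)%R by rewrite (lt_trans _ yx)// mulr_gt0.
    by rewrite y0 /expw /= -expRD; congr (expR _)%:E; ring.
  rewrite integralZ_EFin ?expR_ge0//; [|exact: tail_ge0|exact: measurable_tail].
  rewrite integral_tail// /tail x0 -!EFinM; congr EFin.
  by rewrite mulrA [RHS]mulrC -expRD; congr (expR _ / q)%R; rewrite /w; ring.
rewrite integralZ_EFin ?invr_ge0 ?ltW//; [|exact: tail_ge0|exact: measurable_tail].
by rewrite integral_tail// mulr0 expR0 -EFinM div1r -invfM.
Qed.

Definition weight2 r A p q B p' q' (x : pt) : R :=
  (if ptpos x then if under r x then A * expw p q x else B * expw p' q' x else 0)%R.

Lemma weight2_ge0 r A p q B p' q' x : (0 <= A)%R -> (0 <= B)%R ->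
  (0 <= weight2 r A p q B p' q' x)%R.
Proof.
by move=> A0 B0; rewrite /weight2; do 2 case: ifP => // _; rewrite mulr_ge0// expR_ge0.
Qed.

Lemma measurable_weight2 r A p q B p' q' :
  measurable_fun setT (weight2 r A p q B p' q').
Proof.
apply: measurable_fun_ifT => //; first exact: measurable_fun_ptpos.
by apply: measurable_fun_ifT => //; [exact: measurable_under|
  apply: measurable_funM => //; exact: measurable_expw..].
Qed.

Lemma integral_weight2 (r A p q B p' q' : R) : (0 < r)%R -> (0 <= A)%R -> (0 <= B)%R ->
  (0 < p)%R -> (0 < q)%R -> (0 < p')%R -> (0 < q')%R ->
  \int[plane]_x (weight2 r A p q B p' q' x)%:E =
  (A * (r / (p * (p + q * r))) + B * (q' * (p' + q' * r))^-1)%:E.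
Proof.
move=> r0 A0 B0 p0 q0 p'0 q'0.
pose f1 (x : pt) : R := (if ptpos x && under r x then expw p q x else 0)%R.
pose f2 (x : pt) : R := (if ptpos x && ~~ under r x then expw p' q' x else 0)%R.
have f10 x : (0 <= f1 x)%R by rewrite /f1; case: ifP => // _; exact: expR_ge0.
have f20 x : (0 <= f2 x)%R by rewrite /f2; case: ifP => // _; exact: expR_ge0.
have mf1 : measurable_fun setT (EFin \o f1).
  apply/measurable_EFinP; apply: measurable_fun_ifT => //.
    by apply: measurable_and; [exact: measurable_fun_ptpos|exact: measurable_under].
  exact: measurable_expw.
have mf2 : measurable_fun setT (EFin \o f2).
  apply/measurable_EFinP; apply: measurable_fun_ifT => //.
    apply: measurable_and; first exact: measurable_fun_ptpos.
    by apply: measurable_neg; exact: measurable_under.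
  exact: measurable_expw.
rewrite [LHS](_ : _ = \int[plane]_x (A%:E * (f1 x)%:E + B%:E * (f2 x)%:E)); last first.
  apply: eq_integral => x _; rewrite -!EFinM -EFinD /weight2 /f1 /f2.
  by case: (ptpos x); case: (under r x); rewrite /= ?mulr0 ?addr0 ?add0r.
rewrite ge0_integralD//; first last.
- by apply: measurable_funeM; exact: mf2.
- by move=> x _; rewrite mule_ge0 ?lee_fin.
- by apply: measurable_funeM; exact: mf1.
- by move=> x _; rewrite mule_ge0 ?lee_fin.
rewrite (ge0_integralZl_EFin _ _ _ mf1)//; last by move=> x _; rewrite lee_fin.
rewrite (ge0_integralZl_EFin _ _ _ mf2)//; last by move=> x _; rewrite lee_fin.
by rewrite integral_under// integral_above// EFinD !EFinM.
Qed.

(** The exponential Markov inequality for a product weight. *)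
Lemma powm_le_weight n (S : set (n.-tuple pt)) (phi : pt -> R) (v : R) :
  measurable S -> measurable_fun setT phi -> (forall x, (0 <= phi x)%R) ->
  \int[plane]_x (phi x)%:E = v%:E ->
  (forall e, S e -> (1 <= \prod_(i < n) phi (tnth e i))%R) ->
  powm plane n S <= (v ^+ n)%:E.
Proof.
move=> mS mphi phi0 phiv S1.
rewrite EFin_expe -phiv -powm_prod_integral// -[S in leLHS]setIT.
rewrite -integral_indic//; apply: ge0_le_integral => //.
- by apply/measurable_EFinP; exact: measurable_indic.
- apply/measurable_EFinP/measurable_prod => i _.
  exact: (measurableT_comp mphi (measurable_tnth i)).
move=> e _; rewrite lee_fin indicE; case: (boolP (e \in S)) => [|_].
  by rewrite in_setE => /S1.
by rewrite prodr_ge0.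
Qed.

End exponential_integrals.

Lemma integralD_EFin d (T : measurableType d) (R : realType)
    (mu : {measure set T -> \bar R}) (F G : T -> R) :
  (forall x, 0 <= F x) -> (forall x, 0 <= G x) ->
  measurable_fun setT F -> measurable_fun setT G ->
  (\int[mu]_x (F x + G x)%:E = \int[mu]_x (F x)%:E + \int[mu]_x (G x)%:E)%E.
Proof.
move=> F0 G0 mF mG; rewrite -ge0_integralD//.
- by move=> x _; rewrite lee_fin.
- exact/measurable_EFinP.
- by move=> x _; rewrite lee_fin.
- exact/measurable_EFinP.
Qed.

(** * Large deviations for the edges of a chain *)

Section chernoff.
Context (R : realType).
Notation pt := (R * R)%type.
Notation plane := (@plane R).

Lemma expR_le_inv (x : R) : x < 1 -> expR x <= (1 - x)^-1.
Proof.
move=> x1; rewrite -[expR x]invrK -expRN lef_pV2 ?posrE ?expR_gt0 ?subr_gt0//.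
by have := expR_ge1Dx (- x).
Qed.

Lemma cubic_bound (t k a g : R) : 0 <= t -> t <= 20^-1 ->
  `|k| <= 1 -> `|a| <= 1 -> `|g| <= 1 ->
  1 <= (1 - t * k) * (1 - t * a) * (1 - t * g) * (1 + t * (k + a + g) + 40 * t ^+ 2).
Proof.
move=> t0 t1 k1 a1 g1.
pose s := k + a + g; pose e2 := k * a + k * g + a * g; pose e3 := k * a * g.
have s3 : `|s| <= 3.
  by rewrite (le_trans (ler_normD _ _))// (le_trans (lerD (ler_normD _ _) g1))//; lra.
have nm (x y : R) : `|x| <= 1 -> `|y| <= 1 -> `|x * y| <= 1.
  by move=> x1 y1; rewrite normrM mulr_ile1.
have e23 : `|e2| <= 3.
  have := nm _ _ k1 a1; have := nm _ _ k1 g1; have := nm _ _ a1 g1.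
  by rewrite /e2 !ler_norml; move=> /andP[? ?] /andP[? ?] /andP[? ?]; apply/andP; split; lra.
have e31 : `|e3| <= 1 by exact: (nm _ _ (nm _ _ k1 a1) g1).
have E : (1 - t * k) * (1 - t * a) * (1 - t * g) = 1 - t * s + t ^+ 2 * e2 - t ^+ 3 * e3.
  by rewrite /s /e2 /e3; ring.
have t2 : 0 <= t ^+ 2 by exact: sqr_ge0.
have t3 : 0 <= t ^+ 3 by exact: exprn_ge0.
have t32 : t ^+ 3 <= t ^+ 2 by rewrite exprS ler_piMl//; lra.
move: s3 e23 e31; rewrite !ler_norml => /andP[sl sr] /andP[e2l e2r] /andP[e3l e3r].
have B1 : 1 - t * s - 4 * t ^+ 2 <= 1 - t * s + t ^+ 2 * e2 - t ^+ 3 * e3.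
  have : - 3 * t ^+ 2 <= t ^+ 2 * e2 by rewrite mulrC ler_wpM2l.
  have : t ^+ 3 * e3 <= t ^+ 3 by rewrite ler_piMr.
  lra.
have ts : `|t * s| <= 3 * 20^-1.
  rewrite normrM (ger0_norm t0) mulrC; apply: ler_pM => //.
  by rewrite ler_norml sl.
move: ts; rewrite ler_norml => /andP[tsl tsr].
have P2 : 0 <= 1 + t * s + 40 * t ^+ 2 by lra.
rewrite E -/s (le_trans _ (ler_wpM2r P2 B1))//.
rewrite [leRHS](_ : _ = 1 + t ^+ 2 * (36 - s ^+ 2 - 44 * (t * s) - 160 * t ^+ 2)); last by ring.
rewrite lerDl mulr_ge0//.
have s9 : s ^+ 2 <= 9.
  rewrite -subr_ge0 (_ : 9 - s ^+ 2 = (3 - s) * (3 + s)); last by ring.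
  by apply: mulr_ge0; lra.
have t400 : t ^+ 2 <= 20^-1 * 20^-1 by rewrite expr2; apply: ler_pM.
lra.
Qed.

(** The statistics whose sums over the increments locate, once divided by the number of increments, the vertex of the chain
    where the slope crosses [r]: its index for [(1, 0, 0)], its coordinates for
    [(0, 1, 0)] and [(0, 0, 1)]. *)
Definition stat (n : nat) (r k al be : R) (x : pt) : R :=
  if under r x then k + n%:R * (al * x.1 + be * x.2) else 0.

Definition stat_mean (r k al be : R) : R :=
  let s := r / (1 + r) in s * (k + al + (al + be * r) / (1 + r)).

Lemma measurable_stat n r k al be : measurable_fun setT (stat n r k al be).
Proof.
apply: measurable_fun_ifT => //; first exact: measurable_under.
apply: measurable_funD => //; apply: measurable_funM => //.
by apply: measurable_funD; exact: measurable_funM.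
Qed.

Lemma measurable_sum_stat m (f : pt -> R) : measurable_fun setT f ->
  measurable_fun setT (fun e : m.-tuple pt => \sum_(x <- e) f x).
Proof.
move=> mf; rewrite (_ : (fun _ => _) = fun e : m.-tuple pt => \sum_(i < m) f (tnth e i)).
  by apply: measurable_sum => i; exact: (measurableT_comp mf (measurable_tnth i)).
by apply/funext => e; rewrite big_tuple.
Qed.

Definition deviation n (r k al be eps : R) : set (n.-tuple pt) :=
  [set e : n.-tuple pt | simplex e] `&`
  [set e : n.-tuple pt | n%:R * (stat_mean r k al be + eps) <= \sum_(x <- e) stat n r k al be x].

Lemma measurable_deviation n r k al be eps : measurable (@deviation n r k al be eps).
Proof.
apply: measurableI; first exact: measurable_simplex.
apply: measurable_set_le => //.
exact: (measurable_sum_stat (measurable_stat _ _ _ _ _)).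
Qed.

(** Weight each edge by [exp (2 - n (a + b) + t (stat - mean - eps))]. The product of the
    weights is at least [1] on the event, and each weight has integral [e^2 / n^2] times a
    Laplace transform which is smaller than [1] for small [t], the event being [eps] away
    from the mean. *)
Lemma chernoff (r k al be eps : R) : 0 < r -> 0 < eps ->
  `|k| <= 1 -> `|al| <= 1 -> `|be| <= 1 ->
  exists2 rho, 0 < rho < 1 & forall n, (0 < n)%N ->
  (powm plane n (@deviation n r k al be eps) <=
   ((expR 2 / n%:R ^+ 2 * rho) ^+ n)%:E)%E.
Proof.
move=> r0 eps0 k1 al1 be1.
(* The expansion of the Laplace transform has an error of at most [40 t^2], which the
   gain [t eps] has to beat. *)
pose t := Num.min 20^-1 (eps / 80).
have t0 : 0 < t by rewrite lt_min invr_gt0 ltr0n/= divr_gt0.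
have t1 : t <= 20^-1 by rewrite ge_min lexx.
have t2 : 80 * t <= eps by rewrite -ler_pdivlMl// mulrC ge_min lexx orbT.
have r1 : 0 < 1 + r by rewrite addr_gt0.
pose s := r / (1 + r); pose g := (al + be * r) / (1 + r).
have s01 : 0 < s < 1.
  by rewrite divr_gt0//= ltr_pdivrMr// mul1r ltrDr.
have g1 : `|g| <= 1.
  rewrite /g normrM normfV (gtr0_norm r1) ler_pdivrMr// mul1r.
  by rewrite (le_trans (ler_normD _ _))// lerD// normrM (gtr0_norm r0) ler_piMl// ltW.
pose m := stat_mean r k al be.
have mE : m = s * (k + al + g) by [].
have tx (x : R) : `|x| <= 1 -> - 20^-1 <= t * x <= 20^-1.
  move=> x1; rewrite -ler_norml normrM (gtr0_norm t0) -[leRHS]mulr1.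
  by apply: ler_pM => //; exact: ltW.
have [/andP[tk1 tk2] /andP[ta1 ta2] /andP[tb1 tb2] /andP[tg1 tg2]] :
  [/\ - 20^-1 <= t * k <= 20^-1, - 20^-1 <= t * al <= 20^-1, - 20^-1 <= t * be <= 20^-1 & - 20^-1 <= t * g <= 20^-1].
  by split; exact: tx.
pose c := expR (- (t * (m + eps))).
pose rho := c * (expR (t * k) * (r / ((1 - t * al) * ((1 - t * al) + (1 - t * be) * r))) +
   (1 + r)^-1).
have da : 0 < 1 - t * al by lra.
have db : 0 < 1 - t * be by lra.
have dg : 0 < 1 - t * g by lra.
have dk : 0 < 1 - t * k by lra.
have dab : 0 < (1 - t * al) + (1 - t * be) * r by rewrite addr_gt0// mulr_gt0.
exists rho.
  apply/andP; split.
    by rewrite mulr_gt0 ?expR_gt0// addr_gt0 ?invr_gt0// mulr_gt0 ?expR_gt0// divr_gt0// mulr_gt0.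
  have E1 : (1 - t * al) + (1 - t * be) * r = (1 + r) * (1 - t * g).
    by rewrite /g; field; rewrite gt_eqF.
  have D0 : 0 < (1 - t * k) * (1 - t * al) * (1 - t * g) by rewrite !mulr_gt0.
  have bnd : expR (t * k) * (r / ((1 - t * al) * ((1 - t * al) + (1 - t * be) * r))) + (1 + r)^-1 <=
      1 + t * m + 40 * t ^+ 2.
    have -> : (1 + r)^-1 = 1 - s by rewrite /s; field; rewrite gt_eqF.
    have -> : 1 + t * m + 40 * t ^+ 2 = s * (1 + t * (k + al + g) + 40 * t ^+ 2) + (1 - s) + 40 * t ^+ 2 * (1 - s).
      by rewrite mE; ring.
    have s1 : 0 <= 40 * t ^+ 2 * (1 - s) by apply: mulr_ge0; [rewrite mulr_ge0 ?sqr_ge0|lra].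
    rewrite -[leLHS]addr0 lerD// lerD//.
    apply: (@le_trans _ _ ((1 - t * k)^-1 * (r / ((1 - t * al) * ((1 - t * al) + (1 - t * be) * r))))).
      rewrite ler_pM2r; last by rewrite divr_gt0// mulr_gt0.
      by apply: expR_le_inv; lra.
    have -> : (1 - t * k)^-1 * (r / ((1 - t * al) * ((1 - t * al) + (1 - t * be) * r))) =
        s * ((1 - t * k) * (1 - t * al) * (1 - t * g))^-1.
      by rewrite E1 /s; field; rewrite !gt_eqF.
    rewrite ler_pM2l; last by lra.
    rewrite -[leLHS]mul1r ler_pdivrMr// mulrC.
    exact: cubic_bound (ltW t0) t1 k1 al1 g1.
  have m3 : - 3 <= m <= 3.
    have sg : - 3 <= k + al + g <= 3.
      by move: k1 al1 g1; rewrite !ler_norml => /andP[? ?] /andP[? ?] /andP[? ?]; lra.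
    rewrite -ler_norml mE normrM -[leRHS]mul1r ler_pM//.
      by rewrite gtr0_norm; lra.
    by rewrite ler_norml.
  have tm : - (3 / 20) <= t * m.
    rewrite (@le_trans _ _ (t * (- 3)))//; last by rewrite ler_pM2l//; lra.
    by lra.
  have te : 0 < t * eps by rewrite mulr_gt0.
  have cle : c <= (1 + t * (m + eps))^-1.
    rewrite /c expRN lef_pV2 ?posrE ?expR_gt0 ?expR_ge1Dx//.
    by rewrite mulrDr; lra.
  have P0 : 0 < 1 + t * (m + eps) by rewrite mulrDr; lra.
  rewrite /rho (@le_lt_trans _ _ ((1 + t * (m + eps))^-1 * (1 + t * m + 40 * t ^+ 2)))//.
    apply: ler_pM => //; first exact: expR_ge0.
    by rewrite addr_ge0// ?invr_ge0 ?(ltW r1)// mulr_ge0 ?expR_ge0// divr_ge0 ?(ltW r0)// mulr_ge0 ?(ltW da) ?(ltW dab).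
  rewrite mulrC ltr_pdivrMr// mul1r mulrDr -addrA ltrD2l ltrD2l.
  by rewrite expr2 mulrCA ltr_pM2l//; lra.
move=> n n0; have n0' : 0 < n%:R :> R by rewrite ltr0n.
pose phi := weight2 r (expR (2 + t * k - t * (m + eps))) (n%:R * (1 - t * al)) (n%:R * (1 - t * be))
  (expR (2 - t * (m + eps))) n%:R n%:R.
apply: (@powm_le_weight _ _ _ phi).
- exact: measurable_deviation.
- exact: measurable_weight2.
- by move=> x; apply: weight2_ge0; exact: expR_ge0.
- rewrite integral_weight2 ?expR_ge0// ?mulr_gt0//; congr EFin.
  rewrite /rho /c -addrA !expRD; field.
  have N1 : n%:R + n%:R * r != 0 :> R by rewrite gt_eqF// addr_gt0// mulr_gt0.
  have N2 : n%:R * (1 - t * al) + n%:R * (1 - t * be) * r != 0 :> R.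
    by rewrite gt_eqF// addr_gt0// mulr_gt0// mulr_gt0.
  by rewrite N1 N2 !gt_eqF.
move=> e [/= /andP[/all_tnthP epos /andP[l1 l2]] He].
have -> : \prod_(i < n) phi (tnth e i) =
    expR (\sum_(i < n) (2 - t * (m + eps) - n%:R * ((tnth e i).1 + (tnth e i).2) + t * stat n r k al be (tnth e i))).
  rewrite (big_morph _ (@expRD R) (@expR0 R)); apply: eq_bigr => i _.
  rewrite /phi /weight2 epos /stat; case: ifP => _; rewrite /expw -expRD; congr expR; ring.
rewrite -[leLHS]expR0 ler_expR.
have L1 : \sum_(i < n) (tnth e i).1 < 1.
  by rewrite -(big_tuple _ _ e xpredT (fun x => x.1)) -edge_sum1E -subr_gt0.
have L2 : \sum_(i < n) (tnth e i).2 < 1.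
  by rewrite -(big_tuple _ _ e xpredT (fun x => x.2)) -edge_sum2E -subr_gt0.
rewrite (big_tuple _ _ e xpredT) -/m in He.
rewrite big_split/= big_split/= sumr_const card_ord sumrN -!mulr_sumr big_split/=.
have G1 : t * (n%:R * (m + eps)) <= t * \sum_(i < n) stat n r k al be (tnth e i).
  by rewrite ler_pM2l.
have G2 : n%:R * (\sum_(i < n) (tnth e i).1 + \sum_(i < n) (tnth e i).2) <= n%:R * 2.
  by rewrite ler_pM2l//; lra.
rewrite -mulr_natl; lra.
Qed.

Lemma geometric_small (z c : R) : 0 <= z -> z < 1 -> 0 < c ->
  exists n0, forall n, (n0 <= n)%N -> z ^+ n <= c.
Proof.
move=> z0 z1 c0.
have /cvgrPdist_le /(_ c c0) [n0 _ H] : (fun n => z ^+ n) @ \oo --> (0 : R).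
  by apply: cvg_expr; rewrite ger0_norm.
exists n0 => n nn0; have := H n nn0.
by rewrite sub0r normrN ger0_norm// exprn_ge0.
Qed.

Definition qweight c p q : pt -> R := weight2 1 c p q c p q.

Lemma integral_qweight (c p q : R) : 0 <= c -> 0 < p -> 0 < q ->
  (\int[plane]_x (qweight c p q x)%:E = (c / (p * q))%:E)%E.
Proof.
move=> c0 p0 q0; rewrite integral_weight2//; congr EFin; field.
by rewrite !gt_eqF ?addr_gt0.
Qed.

Lemma qweightE c p q x : qweight c p q x = if ptpos x then c * expw p q x else 0.
Proof. by rewrite /qweight /weight2; case: (ptpos x) => //; case: ifP. Qed.

Lemma prod_qweight n c p q (e : n.-tuple pt) :
  \prod_(i < n) qweight c p q (tnth e i) =
  if all ptpos e then c ^+ n * expR (- p * (edge_sum e).1 - q * (edge_sum e).2) else 0.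
Proof.
case: ifP => [/all_tnthP e0|/negbT/allPn[x /tnthP[i ->] ei]]; last first.
  by rewrite (bigD1 i)//= qweightE (negPf ei) mul0r.
rewrite (eq_bigr (fun i => c * expw p q (tnth e i))); last first.
  by move=> i _; rewrite qweightE e0.
rewrite big_split/= prodr_const card_ord; congr (_ * _).
rewrite /expw -(big_morph _ (@expRD R) (@expR0 R)) edge_sum1E edge_sum2E.
by rewrite big_split/= sumrN -!mulr_sumr !(big_tuple _ _ e xpredT).
Qed.

(** Give each edge the exponential density with rate [n ka], [ka] slightly above
    [1]. The edges then sum to about [(1 / ka, 1 / ka)], so the simplex carries most
    of the mass; on that part the density is bounded above, which turns the mass into
    a lower bound for the volume. *)
Lemma simplex_lower (eta : R) : 0 < eta -> eta < 1 ->
  exists n0, forall n, (n0 <= n)%N -> (0 < n)%N ->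
  (((expR 2 / n%:R ^+ 2 * eta) ^+ n)%:E <= powm plane n [set e : n.-tuple pt | simplex e])%E.
Proof.
move=> eta0 eta1.
pose dl := (1 - eta) / 8; pose ka := 1 + dl; pose th := dl / 2; pose ta := ka ^- 2.
have dl0 : 0 < dl by rewrite /dl; lra.
have dl1 : dl < 8^-1 by rewrite /dl; lra.
have ka0 : 0 < ka by rewrite /ka; lra.
have ta0 : 0 < ta by rewrite invr_gt0 exprn_gt0.
have kat : ka * ta = ka^-1 by rewrite /ta; field; rewrite gt_eqF.
pose rho1 := expR (- th) * (ka / (ka - th)).
pose rho2 := expR (th * ta) * (ka / (ka + th)).
have d1 : 0 < ka - th by rewrite /ka /th; lra.
have d2 : 0 < ka + th by rewrite /ka /th; lra.
have rho1_ge0 : 0 <= rho1 by rewrite mulr_ge0 ?expR_ge0// divr_ge0// ltW.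
have rho2_ge0 : 0 <= rho2 by rewrite mulr_ge0 ?expR_ge0// divr_ge0// ltW.
have th0 : 0 < th by rewrite divr_gt0.
have rho1_lt1 : rho1 < 1.
  rewrite (@le_lt_trans _ _ ((1 + th)^-1 * (ka / (ka - th))))//.
    rewrite ler_pM2r ?divr_gt0// (le_trans (expR_le_inv _)) ?opprK//.
    by rewrite ltrNl; lra.
  rewrite mulrA ltr_pdivrMr// mul1r mulrC ltr_pdivrMr; last by lra.
  have : 0 < th * (ka - 1 - th) by rewrite mulr_gt0// /ka /th; lra.
  lra.
have ta1 : ta < 1.
  by rewrite invf_lt1 ?exprn_gt0// exprn_egt1// /ka; lra.
have tt1 : th * ta < 1.
  by have := ler_wpM2l (ltW th0) (ltW ta1); rewrite mulr1 /th; lra.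
have rho2_lt1 : rho2 < 1.
  rewrite (@le_lt_trans _ _ ((1 - th * ta)^-1 * (ka / (ka + th))))//.
    by rewrite ler_pM2r ?divr_gt0//; exact: expR_le_inv.
  rewrite mulrA ltr_pdivrMr// mul1r mulrC ltr_pdivrMr ?subr_gt0//.
  have : th * ta < 1 - ka^-1.
    rewrite -(ltr_pM2r (exprn_gt0 2 ka0)) -mulrA mulVf ?gt_eqF ?exprn_gt0// mulr1.
    rewrite mulrBl mul1r (_ : ka^-1 * _ = ka); last by field; rewrite gt_eqF.
    rewrite -subr_gt0 (_ : _ - _ = dl / 2 + dl ^+ 2); last by rewrite /ka /th; field.
    by apply: addr_gt0; [exact: divr_gt0|exact: exprn_gt0].
  move=> H; have : 0 < th * (1 - ka^-1 - th * ta) by rewrite mulr_gt0// subr_gt0.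
  have -> : th * (1 - ka^-1 - th * ta) = (ka + th) * (1 - th * ta) - ka - (th * ka^-1 - th * (ka * ta)) by ring.
  by rewrite kat subrr subr0 subr_gt0.
pose eta' := (1 + eta) / 2.
have eta'0 : 0 < eta' by rewrite /eta'; lra.
have ee' : eta / eta' < 1 by rewrite ltr_pdivrMr// /eta'; lra.
have ee0 : 0 <= eta / eta' by rewrite divr_ge0// ltW.
have c8 : 0 < 8^-1 :> R by [].
have [n1 H1] := geometric_small rho1_ge0 rho1_lt1 c8.
have [n2 H2] := geometric_small rho2_ge0 rho2_lt1 c8.
have [n3 H3] := geometric_small ee0 ee' c8.
exists (maxn n1 (maxn n2 n3)) => n; rewrite !geq_max => /andP[nn1 /andP[nn2 nn3]] n0.
have n0' : 0 < n%:R :> R by rewrite ltr0n.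
pose v : R := (n%:R * ka) ^- 2.
have v0 : 0 < v by rewrite invr_gt0 exprn_gt0// mulr_gt0.
pose w := qweight 1 (n%:R * ka) (n%:R * ka).
  (* [w] is the density itself, up to its normalisation; [w1] and [w2] account for sums
     above [1], [w3] and [w4] sums below [ta]. *)
pose w1 := qweight (expR (- th)) (n%:R * (ka - th)) (n%:R * ka).
pose w2 := qweight (expR (- th)) (n%:R * ka) (n%:R * (ka - th)).
pose w3 := qweight (expR (th * ta)) (n%:R * (ka + th)) (n%:R * ka).
pose w4 := qweight (expR (th * ta)) (n%:R * ka) (n%:R * (ka + th)).
pose C := expR (- (2 * ka^-1)) ^+ n.
have iw : (\int[plane]_x (w x)%:E = v%:E)%E.
  rewrite integral_qweight ?mulr_gt0//; congr EFin; rewrite /v; field.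
  by rewrite !gt_eqF.
have iw1 : (\int[plane]_x (w1 x)%:E = (v * rho1)%:E)%E.
  rewrite integral_qweight ?mulr_gt0 ?expR_ge0//; congr EFin; rewrite /v /rho1; field.
  by rewrite !gt_eqF.
have iw2 : (\int[plane]_x (w2 x)%:E = (v * rho1)%:E)%E.
  rewrite integral_qweight ?mulr_gt0 ?expR_ge0//; congr EFin; rewrite /v /rho1; field.
  by rewrite !gt_eqF.
have iw3 : (\int[plane]_x (w3 x)%:E = (v * rho2)%:E)%E.
  rewrite integral_qweight ?mulr_gt0 ?expR_ge0//; congr EFin; rewrite /v /rho2; field.
  by rewrite !gt_eqF.
have iw4 : (\int[plane]_x (w4 x)%:E = (v * rho2)%:E)%E.
  rewrite integral_qweight ?mulr_gt0 ?expR_ge0//; congr EFin; rewrite /v /rho2; field.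
  by rewrite !gt_eqF.
have mS := @measurable_simplex R n.
have ineq : ((v ^+ n)%:E <= C%:E * powm plane n [set e : n.-tuple pt | simplex e] +
   ((v * rho1) ^+ n + (v * rho1) ^+ n + (v * rho2) ^+ n + (v * rho2) ^+ n)%:E)%E.
  pose W (f : pt -> R) (e : n.-tuple pt) := \prod_(i < n) f (tnth e i).
  have mW f : measurable_fun setT f -> measurable_fun setT (W f).
    move=> mf; apply: measurable_prod => i _.
    exact: (measurableT_comp mf (measurable_tnth i)).
  have W0 f : (forall x, 0 <= f x) -> forall e, 0 <= W f e.
    by move=> f0 e; rewrite prodr_ge0.
  have q0 c p q : 0 <= c -> forall x, 0 <= qweight c p q x.
    by move=> c0 x; exact: weight2_ge0.
  have mq c p q : measurable_fun setT (qweight c p q) by exact: measurable_weight2.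
  have iW (f : pt -> R) (u : R) : measurable_fun setT f -> (forall x, 0 <= f x) -> (\int[plane]_x (f x)%:E = u%:E)%E ->
      (\int[powm plane n]_e (W f e)%:E = (u ^+ n)%:E)%E.
    by move=> mf f0 fu; rewrite powm_prod_integral// fu EFin_expe.
  have e0 := @expR_ge0 R.
  have I0 := iW w v (mq _ _ _) (q0 _ _ _ ler01) iw.
  have I1 := iW w1 _ (mq _ _ _) (q0 _ _ _ (e0 _)) iw1.
  have I2 := iW w2 _ (mq _ _ _) (q0 _ _ _ (e0 _)) iw2.
  have I3 := iW w3 _ (mq _ _ _) (q0 _ _ _ (e0 _)) iw3.
  have I4 := iW w4 _ (mq _ _ _) (q0 _ _ _ (e0 _)) iw4.
  have C0 : 0 <= C by rewrite exprn_ge0 ?expR_ge0.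
  pose F0 (e : n.-tuple pt) : R := C * \1_[set e : n.-tuple pt | simplex e] e.
  have mI : measurable_fun setT (fun e : n.-tuple pt => \1_[set e : n.-tuple pt | simplex e] e : R).
    exact: measurable_indic.
  have mF0 : measurable_fun setT F0 by exact: measurable_funM.
  have F00 e : 0 <= F0 e by rewrite mulr_ge0.
  have IF0 : (\int[powm plane n]_e (F0 e)%:E = C%:E * powm plane n [set e : n.-tuple pt | simplex e])%E.
    rewrite integralZ_EFin//; congr (_ * _)%E.
    by rewrite integral_indic// setIT.
  have [m1 m2 m3 m4] : [/\ measurable_fun setT (W w1), measurable_fun setT (W w2),
    measurable_fun setT (W w3) & measurable_fun setT (W w4)] by split; apply: mW; exact: mq.
  have [p1 p2 p3 p4] : [/\ forall e, 0 <= W w1 e, forall e, 0 <= W w2 e,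
    forall e, 0 <= W w3 e & forall e, 0 <= W w4 e].
    by split; apply: W0; apply: q0; exact: e0.
  have IR : (\int[powm plane n]_e (F0 e + (W w1 e + W w2 e + W w3 e + W w4 e))%:E =
      C%:E * powm plane n [set e : n.-tuple pt | simplex e] +
   ((v * rho1) ^+ n + (v * rho1) ^+ n + (v * rho2) ^+ n + (v * rho2) ^+ n)%:E)%E.
    have m12 := measurable_funD m1 m2; have m123 := measurable_funD m12 m3.
    have m1234 := measurable_funD m123 m4.
    have p12 e : 0 <= W w1 e + W w2 e by rewrite addr_ge0.
    have p123 e : 0 <= W w1 e + W w2 e + W w3 e by rewrite addr_ge0.
    have p1234 e : 0 <= W w1 e + W w2 e + W w3 e + W w4 e by rewrite addr_ge0.
    rewrite (integralD_EFin _ F00 p1234 mF0 m1234) IF0.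
    rewrite (integralD_EFin _ p123 p4 m123 m4) (integralD_EFin _ p12 p3 m12 m3).
    by rewrite (integralD_EFin _ p1 p2 m1 m2) I1 I2 I3 I4 -!EFinD.
  rewrite -I0 -IR; apply: ge0_le_integral => //.
  - by move=> e _; rewrite lee_fin; apply: W0; apply: q0.
  - by apply/measurable_EFinP; apply: mW; exact: mq.
  - apply/measurable_EFinP; apply: measurable_funD => //.
    by do 3 (apply: measurable_funD => //).
  move=> e _; rewrite lee_fin.
  have [epos|epos] := boolP (all ptpos e); last first.
    rewrite {1}/W /w prod_qweight (negPf epos) addr_ge0// !addr_ge0//.
  rewrite /F0 indicE.
  have WE c p q : W (qweight c p q) e = c ^+ n * expR (- p * (edge_sum e).1 - q * (edge_sum e).2).
    by rewrite /W prod_qweight epos.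
  rewrite /w /w1 /w2 /w3 /w4 !WE expr1n mul1r -!expRM_natl -!expRD.
  set A := (edge_sum e).1; set B := (edge_sum e).2.
  have big x y : x <= y -> expR x <= expR y by rewrite ler_expR.
  set y1 := (X in _ <= _ + (X + _ + _ + _)); set y2 := (X in _ <= _ + (_ + X + _ + _)).
  set y3 := (X in _ <= _ + (_ + _ + X + _)); set y4 := (X in _ <= _ + (_ + _ + _ + X)).
  set y0 := (X in X <= _); set yF := (X in _ <= X + _).
  have [z1 z2 z3 z4] : [/\ 0 <= y1, 0 <= y2, 0 <= y3 & 0 <= y4] by split; exact: expR_ge0.
  have zF : 0 <= yF by rewrite mulr_ge0.
  have nth0 : 0 < n%:R * th by rewrite mulr_gt0.
  have [A1|A1] := leP 1 A.
    have le : y0 <= y1 by apply: big; clear -A1 nth0; nra.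
    by clear -le z1 z2 z3 z4 zF; lra.
  have [B1|B1] := leP 1 B.
    have le : y0 <= y2 by apply: big; clear -B1 nth0; nra.
    by clear -le z1 z2 z3 z4 zF; lra.
  have [A2|A2] := leP A ta.
    have le : y0 <= y3 by apply: big; clear -A2 nth0; nra.
    by clear -le z1 z2 z3 z4 zF; lra.
  have [B2|B2] := leP B ta.
    have le : y0 <= y4 by apply: big; clear -B2 nth0; nra.
    by clear -le z1 z2 z3 z4 zF; lra.
  have se : simplex e.
    move: A1 B1; rewrite -subr_gt0 -[B < 1]subr_gt0 => A1 B1.
    by rewrite /simplex epos andTb; apply/andP; split; [exact: A1|exact: B1].
  have le : y0 <= yF.
    rewrite /yF mem_set// mulr1 /C -expRM_natl; apply: big.
    have nka : 0 < n%:R * ka by rewrite mulr_gt0.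
    by rewrite -kat; clear -A2 B2 nka; nra.
  by clear -le z1 z2 z3 z4 zF; lra.
have R1 : (v * rho1) ^+ n <= v ^+ n * 8^-1.
  by rewrite exprMn ler_pM2l ?exprn_gt0//; exact: H1.
have R2 : (v * rho2) ^+ n <= v ^+ n * 8^-1.
  by rewrite exprMn ler_pM2l ?exprn_gt0//; exact: H2.
have C0 : 0 < C by rewrite exprn_gt0 ?expR_gt0.
have ineq2 : ((v ^+ n * 2^-1)%:E <= C%:E * powm plane n [set e : n.-tuple pt | simplex e])%E.
  move: ineq; case: (powm _ _ _) (measure_ge0 (powm plane n) [set e : n.-tuple pt | simplex e]) => [u||]//.
    by move=> _; rewrite -!EFinM -EFinD !lee_fin; lra.
    by move=> _ _; rewrite mulry gtr0_sg// mul1e leey.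
  by move=> _; rewrite mulrNy gtr0_sg// mul1e addNye leeNy_eq.
have CE : (0 < C%:E)%E by rewrite lte_fin.
rewrite -(lee_pmul2l _ CE)//; apply: le_trans ineq2.
rewrite -EFinM lee_fin.
have key : expR (- (2 * ka^-1)) * (expR 2 / n%:R ^+ 2 * eta') <= v.
  have -> : v = n%:R ^- 2 * ka ^- 2 by rewrite /v exprMn invfM.
  rewrite [expR 2 / _]mulrC -!mulrA mulrCA ler_pM2l ?invr_gt0 ?exprn_gt0//.
  rewrite mulrA -expRD -ler_pdivlMl ?expR_gt0// -expRN.
  have : 1 + (- (- (2 * ka^-1) + 2)) <= expR (- (- (2 * ka^-1) + 2)) by exact: expR_ge1Dx.
  move=> H; rewrite (le_trans _ (ler_wpM2r _ H))//; last by rewrite invr_ge0 exprn_ge0// ltW.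
  have -> : (1 - (- (2 * ka^-1) + 2)) / ka ^+ 2 = (2 - ka) / ka ^+ 3 by field; rewrite gt_eqF.
  rewrite ler_pdivlMr ?exprn_gt0//.
  have -> : eta' = 1 - 4 * dl by rewrite /eta' /dl; field.
  rewrite /ka -subr_ge0 (_ : _ - _ = 9 * dl ^+ 2 + 11 * dl ^+ 3 + 4 * dl ^+ 4); last by ring.
  by rewrite !addr_ge0// mulr_ge0// exprn_ge0// ltW.
have -> : eta = eta' * (eta / eta') by field; rewrite gt_eqF.
pose a0 := expR 2 / n%:R ^+ 2 * eta'.
have a00 : 0 <= a0.
  by apply: mulr_ge0 (ltW eta'0); rewrite divr_ge0 ?expR_ge0 ?exprn_ge0.
rewrite mulrA -/a0 exprMn mulrA /C -exprMn.
have b00 : 0 <= expR (- (2 * ka^-1)) * a0 by rewrite mulr_ge0 ?expR_ge0.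
apply: ler_pM; [exact: exprn_ge0|exact: exprn_ge0| |].
  by apply: lerXn2r; rewrite ?nnegrE// ltW.
by rewrite (le_trans (H3 _ nn3))//; lra.
Qed.

End chernoff.

(** * The law of the edges of selected points *)

Section increments_of_points.
Context (R : realType).
Notation pt := (R * R)%type.

Definition Phi_inv (p : pt) : pt := ((2 - p.1 + p.2) / 2, (2 - p.1 - p.2) / 2).

Lemma PhiK : cancel (@Phi R) Phi_inv.
Proof. by move=> [a b]; rewrite /Phi_inv /Phi /=; congr pair; field. Qed.

Lemma Phi_invK : cancel Phi_inv (@Phi R).
Proof. by move=> [x y]; rewrite /Phi_inv /Phi /=; congr pair; field. Qed.

(** The edges of the polygonal line from the origin through the points. *)
Definition increments n (v : n.-tuple pt) : n.-tuple pt :=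
  [tuple of pairmap (fun p q => q - p) 0 (map Phi_inv v)].

Lemma chain_ptsK n : cancel (chain_pts 0) (@increments n).
Proof.
move=> e; apply: val_inj => /=; rewrite mapK; last exact: PhiK.
by rewrite scanlK// => p q; rewrite addrC addKr.
Qed.

Lemma measurable_Phi_inv : measurable_fun setT Phi_inv.
Proof.
apply: measurable_fun_pair; apply: measurable_funM => //.
  by apply: measurable_funD => //; exact: measurable_funB.
by apply: measurable_funB => //; exact: measurable_funB.
Qed.

Lemma measurable_increments n : measurable_fun setT (@increments n).
Proof.
case: n => [|n]; first by apply/measurable_fun_tnthP => -[].
apply/measurable_fun_tnthP => i.
have mP (j : 'I_n.+1) : measurable_fun setT (fun v : n.+1.-tuple pt => Phi_inv (tnth v j)).
  exact: (measurableT_comp measurable_Phi_inv (measurable_tnth j)).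
have E (v : n.+1.-tuple pt) : tnth (increments v) i =
    Phi_inv (tnth v i) - (if i == ord0 then 0 else Phi_inv (tnth v (inord i.-1))).
  rewrite (tnth_nth 0) /= (nth_pairmap 0) ?size_map ?size_tuple//.
  rewrite (nth_map 0) ?size_tuple// -tnth_nth; congr (_ - _).
  case: eqP => [->//|i0]; have i_gt0 : (0 < i)%N.
    by rewrite lt0n; apply/eqP => /= ii; apply: i0; exact: val_inj.
  have i1n : (i.-1 < n.+1)%N by rewrite (leq_ltn_trans (leq_pred i)).
  have -> : nth 0 (0 :: map Phi_inv v) i = nth 0 (map Phi_inv v) i.-1.
    by move: i_gt0; case: (nat_of_ord i).
  by rewrite (nth_map 0) ?size_tuple// (tnth_nth 0) inordK.
rewrite (_ : _ \o _ = fun v : n.+1.-tuple pt => Phi_inv (tnth v i) -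
  (if i == ord0 then 0 else Phi_inv (tnth v (inord i.-1)))); last first.
  by apply/funext => v /=; exact: E.
have [i0|i0] := eqVneq i ord0.
  by rewrite (_ : (fun _ => _) = (fun v : n.+1.-tuple pt => Phi_inv (tnth v i)))//;
    apply/funext => v; rewrite subr0.
have m1 := mP i; have m2 := mP (inord i.-1).
rewrite (_ : (fun _ => _) = fun v : n.+1.-tuple pt =>
  ((Phi_inv (tnth v i)).1 - (Phi_inv (tnth v (inord i.-1))).1,
   (Phi_inv (tnth v i)).2 - (Phi_inv (tnth v (inord i.-1))).2))//.
by apply: measurable_fun_pair; apply: measurable_funB; exact: measurableT_comp.
Qed.

End increments_of_points.

Section law.
Local Open Scope ereal_scope.
Context (R : realType) d (T : measurableType d) (P : probability T R) (N : nat).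
Notation pt := (R * R)%type.
Notation plane := (@plane R).
Variables (U : 'I_N -> {RV P >-> pt}) (D0 : set pt).
Hypothesis mD0 : measurable D0.
Hypothesis D0_gt0 : 0 < plane D0.
Hypothesis D0_lty : plane D0 < +oo.
Hypothesis indU : mutually_independent U.
Hypothesis unifU : forall i, uniform_on D0 (U i).

Definition share (A : set pt) : R := (fine (plane (A `&` D0)) / fine (plane D0))%R.

Lemma plane_sub_fin A : measurable A -> plane (A `&` D0) \is a fin_num.
Proof.
move=> mA; rewrite ge0_fin_numE// (le_lt_trans _ D0_lty)//.
by apply: le_measure; rewrite ?inE//; exact: measurableI.
Qed.

Lemma fine_D0_gt0 : (0 < fine (plane D0))%R.
Proof. by apply: fine_gt0; rewrite D0_gt0 D0_lty. Qed.

Lemma share_ge0 A : (0 <= share A)%R.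
Proof. by rewrite divr_ge0// fine_ge0. Qed.

Lemma prob_share i A : measurable A -> P (U i @^-1` A) = (share A)%:E.
Proof.
move=> mA; have := unifU i mA; rewrite /distribution /pushforward => ->.
rewrite !area_plane//; last exact: measurableI.
rewrite /share EFinM fineK ?plane_sub_fin//; congr (_ * _).
have D0fin : plane D0 \is a fin_num by rewrite ge0_fin_numE.
by rewrite -[in LHS](fineK D0fin) inver gt_eqF// fine_D0_gt0.
Qed.

Section selection.
Variables (n : nat) (s : 'I_n -> 'I_N).
Hypothesis s_inj : injective s.

Definition selected (w : T) : n.-tuple pt := [tuple U (s i) w | i < n].

Lemma measurable_selected : measurable_fun setT selected.
Proof.
apply/measurable_fun_tnthP => i; rewrite (_ : _ \o _ = U (s i)) ?measurable_funPT//.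
by apply/funext => w; rewrite /= tnth_mktuple.
Qed.

Definition others_in (D : set pt) : set T :=
  [set w | forall j, [set w | j \notin codom s -> D (U j w)] w].

Lemma measurable_others_in D : measurable D -> measurable (others_in D).
Proof.
move=> mD; apply: measurable_forall => j; apply: measurable_imply => _.
exact: (measurable_funPTI (U j)).
Qed.

(** Both sides factor over the sample: a point that is selected contributes its density on
    the triangle, every other point the probability of falling in [D]. *)
Lemma law_selected D (S : set (n.-tuple pt)) : measurable D -> measurable S ->
  P (selected @^-1` S `&` others_in D) =
  (fine (plane D0) ^- n * share D ^+ (N - n))%:E *
    powm plane n (S `&` box (fun=> D0)).
Proof.
move=> mD mS.
have mO := measurable_others_in mD.
have mBox : measurable (box (fun=> D0) : set (n.-tuple pt)) by exact: measurable_box.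
have c0 : (0 <= fine (plane D0) ^- n * share D ^+ (N - n))%R.
  by rewrite mulr_ge0 ?exprn_ge0 ?share_ge0// invr_ge0 exprn_ge0 ?fine_ge0.
pose nu1 := measure_function_pushforward__canonical__measure_function_Measure
  (mrestr P mO) measurable_selected.
pose nu2 := mscale (NngNum c0) (mrestr (powm plane n) mBox).
transitivity (nu1 S); first by [].
transitivity (nu2 S); last by [].
apply: (@box_unique _ _ _ n nu1 nu2 (fun=> setT)) => //.
- by apply/seteqP; split=> // x _; exists 0%N.
- move=> _; rewrite -[ltLHS]/(P (selected @^-1` _ `&` others_in D)).
  rewrite (le_lt_trans (probability_le1 _ _)) ?ltry//.
  apply: measurableI => //; rewrite -[X in measurable X]setTI.
  by apply: measurable_selected => //; exact: measurable_box.
move=> A mA; rewrite -[LHS]/(P (selected @^-1` box A `&` others_in D)).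
rewrite -[RHS]/((fine (plane D0) ^- n * share D ^+ (N - n))%:E *
  powm plane n (box A `&` box (fun=> D0))).
pose B j := if [pick i | s i == j] is Some i then A i else D.
have Bs i : B (s i) = A i.
  by rewrite /B; case: pickP => [k /eqP/s_inj ->//|/(_ i)]; rewrite eqxx.
have Bn j : j \notin codom s -> B j = D.
  rewrite /B; case: pickP => // k /eqP <-.
  by rewrite codom_f.
have mBj j : measurable (B j) by rewrite /B; case: pickP.
have := indU [set: 'I_N]%SET mBj.
rewrite (_ : \bigcap_(i in _) _ = selected @^-1` box A `&` others_in D); last first.
  apply/seteqP; split=> w.
    move=> H; split=> [i|j /= js].
      by rewrite /= tnth_mktuple -Bs; apply: H; rewrite /= inE.
    by rewrite -(Bn _ js); apply: H; rewrite /= inE.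
  move=> [H1 H2] j _ /=; have [/codomP[i ->]|js] := boolP (j \in codom s).
    by rewrite Bs; have := H1 i; rewrite /= tnth_mktuple.
  by rewrite Bn//; exact: H2.
move=> ->.
rewrite (eq_bigr (fun j => (share (B j))%:E)); last by move=> j _; exact: prob_share.
rewrite -(big_morph _ EFinM (erefl 1%:E)).
have -> : box A `&` box (fun=> D0) = box (fun i => A i `&` D0).
  by apply/seteqP; split=> [t [t1 t2] i|t t1]; [split|split=> i; have [] := t1 i].
rewrite powm_box; last by move=> i; exact: measurableI.
rewrite (eq_bigr (fun i => (fine (plane (A i `&` D0)))%:E)); last first.
  by move=> i _; rewrite fineK// plane_sub_fin.
rewrite -(big_morph _ EFinM (erefl 1%:E)) -EFinM; congr EFin.
rewrite (bigID (mem (codom s)))/=.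
rewrite [X in (X * _)%R](_ : _ = (\prod_(i < n) share (A i))%R); last first.
  rewrite (eq_bigl (mem (codom s))); last by move=> j; rewrite inE.
  have us : uniq (codom s) by rewrite map_inj_uniq ?enum_uniq.
  rewrite -(big_uniq _ us)/= big_image/=.
  by apply: eq_bigr => i _; rewrite Bs.
rewrite [X in (_ * X)%R](_ : _ = (share D ^+ (N - n))%R); last first.
  rewrite (eq_bigr (fun=> share D)); last by move=> j /andP[_ js]; rewrite Bn.
  rewrite prodr_const; congr (_ ^+ _)%R.
  have := cardC (mem (codom s)); rewrite card_codom// !card_ord => /(canRL (addKn _)) <-.
  by apply: eq_card => j; rewrite !inE unfold_in /= inE.
rewrite /share big_split/= prodr_const card_ord exprVn; ring.
Qed.

(** [increments] inverts [chain_pts], so [powm_chain_pts] transports the law to the edges. *)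
Lemma law_increments D (E : set (n.-tuple pt)) : measurable D -> measurable E ->
  (forall e, E e -> forall i, D0 (tnth (chain_pts 0%R e) i)) ->
  P ([set w | E (increments (selected w))] `&` others_in D) =
  ((2 / fine (plane D0)) ^+ n * share D ^+ (N - n))%:E * powm plane n E.
Proof.
move=> mD mE ED0.
have mS : measurable (@increments R n @^-1` E).
  by rewrite -[X in measurable X]setTI; exact: measurable_increments.
rewrite (law_selected mD mS).
have mBox : measurable (box (fun=> D0) : set (n.-tuple pt)) by exact: measurable_box.
rewrite (@powm_chain_pts R n 0%R)//; last exact: measurableI.
rewrite (_ : chain_pts 0%R @^-1` _ = E); last first.
  apply/seteqP; split=> e /=; first by move=> []; rewrite chain_ptsK.
  by move=> Ee; split; [rewrite chain_ptsK|exact: ED0].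
rewrite muleA -EFinM; congr (_%:E * _).
by move: (share D ^+ _)%R => q; rewrite exprMn exprVn; ring.
Qed.

End selection.

Lemma prob_null i A : measurable A -> plane A = 0 -> P (U i @^-1` A) = 0.
Proof.
move=> mA A0; rewrite prob_share// /share (_ : plane _ = 0) ?mul0r//.
by apply/eqP; rewrite -measure_le0 -A0; apply: le_measure; rewrite ?inE//; exact: measurableI.
Qed.

Lemma prob_same_abscissa i j : i != j -> P [set w | (U i w).1 == (U j w).1] = 0.
Proof.
move=> ij; pose s (k : 'I_2) := if k == ord0 then i else j.
have s_inj : injective s.
  move=> k l; rewrite /s; case: eqP => k0; case: eqP => l0 E.
  - by rewrite k0 l0.
  - by rewrite E eqxx in ij.
  - by rewrite E eqxx in ij.
  have ord2 (o : 'I_2) : o <> ord0 -> val o = 1%N.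
    by case: o => [[|[|]]] //= ? o0; case: o0; exact: val_inj.
  by apply: val_inj; rewrite /= (ord2 _ k0) (ord2 _ l0).
pose S := [set v : 2.-tuple pt | (tnth v ord0).1 == (tnth v (lift ord0 ord0)).1].
have mS : measurable S.
  by apply: measurable_set_eq; apply: measurableT_comp => //; exact: measurable_tnth.
have := law_selected s_inj measurableT mS.
rewrite (_ : _ `&` _ = [set w | (U i w).1 == (U j w).1]); last first.
  apply/seteqP; split=> w; rewrite /S /= !tnth_mktuple /s/=; first by case.
  by move=> H; split.
move=> ->; apply/eqP; rewrite mule_eq0; apply/orP; right.
have S0 : powm plane 2 S = 0.
  apply: powm_head0 => // v.
  rewrite -(@plane_swap _ [set x | _]); last exact: measurable_section_head.
  apply: etrans (@plane_line0 R 0%R 1%R (tnth v ord0).1 (oner_neq0 R)); congr (plane _).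
  by apply/funext => p; rewrite /S /= tnthS mul0r mul1r add0r.
rewrite -measure_le0 -S0; apply: le_measure; rewrite ?inE//; exact: measurableI mS (measurable_box _).
Qed.

End law.

(** * Hulls and their vertices *)

Section hulls.
Context (R : realType).
Notation pt := (R * R)%type.
Implicit Types (S K : set pt) (p q : pt).

Definition convex_closed K := forall p q (t : R), K p -> K q -> 0 <= t -> t <= 1 ->
  K (t *: p + (1 - t) *: q).

Lemma convE p q (t : R) :
  t *: p + (1 - t) *: q = (t * p.1 + (1 - t) * q.1, t * p.2 + (1 - t) * q.2).
Proof. by []. Qed.

Lemma convex_setP K : @convex_set R _ K <-> convex_closed K.
Proof.
split=> [cK p q t Kp Kq t0 t1|cK p q l Kp Kq].
  have := cK p q (Itv01 t0 t1) (mem_set Kp) (mem_set Kq).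
  by rewrite inE.
rewrite inE; apply: cK; [by rewrite -in_setE|by rewrite -in_setE|exact: ge0|exact: le1].
Qed.

Lemma hull_least S K : convex_closed K -> S `<=` K -> hull S `<=` K.
Proof. by move=> /convex_setP cK SK; exact: smallest_sub. Qed.

Lemma sub_hull S : S `<=` hull S.
Proof. by move=> p Sp K [_]; exact. Qed.

Lemma hull_convex S : convex_closed (hull S).
Proof.
move=> p q t Sp Sq t0 t1 K [cK SK].
by move/convex_setP: (cK); apply => //; [exact: Sp|exact: Sq].
Qed.

Lemma hull_mono S S' : S `<=` S' -> hull S `<=` hull S'.
Proof. by move=> SS'; apply: hull_least; [exact: hull_convex|move=> p /SS'; exact: sub_hull]. Qed.

Lemma convex_combination K n (w : 'I_n -> pt) (l : 'I_n -> R) :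
  convex_closed K -> (forall i, K (w i)) -> (forall i, 0 <= l i) ->
  \sum_(i < n) l i = 1 -> K (\sum_(i < n) l i *: w i).
Proof.
move=> cK; elim: n w l => [|n IHn] w l Kw l0.
  by rewrite big_ord0 => /esym/eqP; rewrite oner_eq0.
rewrite !big_ord_recr/=; set t := l ord_max => lt.
have [t1|t1] := eqVneq t 1.
  have s0 : \sum_(i < n) l (widen_ord (leqnSn n) i) = 0 by lra.
  rewrite big1 ?add0r ?t1 ?scale1r// => i _.
  have /psumr_eq0P := s0 => /(_ (fun i _ => l0 _))/(_ i isT) ->.
  by rewrite scale0r.
have t01 : 0 < 1 - t.
  rewrite subr_gt0 lt_neqAle t1/= -lt lerDr sumr_ge0//.
have t0' : 1 - t != 0 by rewrite gt_eqF.
rewrite addrC -[X in K (_ + X)](scalerKV t0').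
apply: cK => //; first last.
- by rewrite -lt lerDr sumr_ge0.
- exact: l0.
rewrite scaler_sumr (eq_bigr (fun i => ((1 - t)^-1 * l (widen_ord (leqnSn n) i)) *: w (widen_ord (leqnSn n) i))).
  apply: IHn => [i|i|]; first exact: Kw.
    by rewrite mulr_ge0// invr_ge0 ltW.
  rewrite -mulr_sumr (_ : \sum_(i < n) _ = 1 - t); last by rewrite -lt addrK.
  by rewrite mulVf// gt_eqF.
by move=> i _; rewrite scalerA.
Qed.

Lemma hull_rangeP n (w : 'I_n -> pt) p : hull (range w) p <->
  exists l : 'I_n -> R, [/\ forall i, 0 <= l i, \sum_(i < n) l i = 1 &
    p = \sum_(i < n) l i *: w i].
Proof.
split=> [|[l [l0 l1 ->]]]; last first.
  apply: convex_combination => //; first exact: hull_convex.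
  by move=> i; apply: sub_hull; exists i.
pose K : set pt := [set p | exists l : 'I_n -> R, [/\ forall i, 0 <= l i,
    \sum_(i < n) l i = 1 & p = \sum_(i < n) l i *: w i]].
apply: (@hull_least (range w) K) => [{}p q t [l [l0 l1 ->]] [m [m0 m1 ->]] t0 t1|_ [i _ <-]].
  exists (fun i => t * l i + (1 - t) * m i); split=> [i||].
  - by rewrite addr_ge0// mulr_ge0// subr_ge0.
  - by rewrite big_split/= -!mulr_sumr l1 m1 !mulr1 addrC subrK.
  - rewrite !scaler_sumr -big_split/=; apply: eq_bigr => i _.
    by rewrite [RHS]scalerDl !scalerA.
exists (fun j => (j == i)%:R); split=> [j||].
- exact: ler0n.
- by rewrite (bigD1 i)//= eqxx big1 ?addr0// => j /negPf ->.
- rewrite (bigD1 i)//= eqxx scale1r big1 ?addr0// => j /negPf ->.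
  by rewrite scale0r.
Qed.

Lemma convex_closed3 K a b c (x y z : R) : convex_closed K -> K a -> K b -> K c ->
  0 <= x -> 0 <= y -> 0 <= z -> x + y + z = 1 -> K (x *: a + y *: b + z *: c).
Proof.
move=> cK Ka Kb Kc x0 y0 z0 xyz.
pose w (i : 'I_3) := if i == 0 :> nat then a else if i == 1%N :> nat then b else c.
pose l (i : 'I_3) := if i == 0 :> nat then x else if i == 1%N :> nat then y else z.
have := @convex_combination K 3 w l cK.
rewrite !big_ord_recl !big_ord0 /w /l /= !addr0 !addrA; apply=> //.
- by move=> i; do 2 case: ifP => // _.
- by move=> i; do 2 case: ifP => // _.
Qed.

Lemma triangleP p : triangle p <-> [/\ 0 <= p.2, p.2 <= p.1 & p.1 + p.2 <= 2].
Proof.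
split.
  pose K : set pt := [set p | [/\ 0 <= p.2, p.2 <= p.1 & p.1 + p.2 <= 2]].
  apply: (@hull_least _ K).
    move=> [p1 p2] [q1 q2] t [a1 a2 a3] [b1 b2 b3] t0 t1.
    rewrite /= in a1 a2 a3 b1 b2 b3.
    have t1' : 0 <= 1 - t by rewrite subr_ge0.
    rewrite /K /mkset convE /=; split.
    - by rewrite addr_ge0// mulr_ge0.
    - by rewrite lerD// ler_wpM2l.
    - by have h1 := ler_wpM2l t0 a3; have h2 := ler_wpM2l t1' b3; lra.
  by move=> _ [[->|->]|->]; rewrite /K /mkset /ptA /ptB /ptC /=; split; lra.
move=> [y0 yx xy2].
have -> : p = (1 - p.2 - (p.1 - p.2) / 2) *: ptA + ((p.1 - p.2) / 2) *: ptB + p.2 *: ptC.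
  case: p {y0 yx xy2} => x y.
  rewrite -[RHS]/((1 - y - (x - y) / 2) * 0 + ((x - y) / 2) * 2 + y * 1,
    (1 - y - (x - y) / 2) * 0 + ((x - y) / 2) * 0 + y * 1).
  by congr pair; field.
apply: convex_closed3; rewrite ?divr_ge0 ?subr_ge0//; first exact: hull_convex.
- by apply: sub_hull; left; left.
- by apply: sub_hull; left; right.
- by apply: sub_hull; right.
- by lra.
- by ring.
Qed.

Definition affine_function (f : pt -> R) := forall p q (t : R),
  f (t *: p + (1 - t) *: q) = t * f p + (1 - t) * f q.

(** A convex combination of points where [f] is smaller than at [p] cannot reach
    the level [f p], so the hull meets this level only at [p]. *)
Lemma exposed_vertex S p f : affine_function f -> S p ->
  (forall q, S q -> q <> p -> f q < f p) -> vertex (hull S) p.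
Proof.
move=> af Sp fp.
have Kp q : hull S q -> q = p \/ f q < f p.
  pose K : set pt := [set q | q = p \/ f q < f p].
  apply: (@hull_least _ K) => [{}q r t|{}q Sq]; last first.
    by have [->|/eqP qp] := eqVneq q p; [left|right; exact: fp].
  move=> [->|fq] [->|fr] t0 t1.
  - by left; rewrite -scalerDl addrC subrK scale1r.
  - have [->|t1'] := eqVneq t 1; first by left; rewrite subrr scale1r scale0r addr0.
    right; rewrite af; have : t < 1 by rewrite lt_neqAle t1'.
    nra.
  - have [->|t0'] := eqVneq t 0; first by left; rewrite subr0 scale1r scale0r add0r.
    right; rewrite af; have : 0 < t by rewrite lt_neqAle eq_sym t0'.
    nra.
  - right; rewrite af; have [->|t1'] := eqVneq t 1; first by rewrite subrr mul0r addr0 mul1r.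
    have t1'' : 0 < 1 - t by rewrite subr_gt0 lt_neqAle t1'.
    have h1 : t * f q <= t * f p by rewrite ler_wpM2l// ltW.
    have h2 : (1 - t) * f r < (1 - t) * f p by rewrite ltr_pM2l.
    lra.
split; first exact: sub_hull.
move=> q1 q2 t /Kp q1p /Kp q2p /andP[t0 t1] pE.
have := congr1 f pE; rewrite af.
have t1' : 0 < 1 - t by rewrite subr_gt0.
case: q1p q2p => [->|f1] [->|f2] // H; exfalso.
- by move: f2; rewrite -(ltr_pM2l t1'); lra.
- by move: f1; rewrite -(ltr_pM2l t0); lra.
- by move: f1 f2; rewrite -(ltr_pM2l t0) -(ltr_pM2l t1' (f q2)); lra.
Qed.

Lemma not_vertex_between K p y1 y2 : K (p.1, y1) -> K (p.1, y2) ->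
  y1 < p.2 -> p.2 < y2 -> ~ vertex K p.
Proof.
move=> K1 K2 py1 py2 [_ vp].
have y12 : 0 < y2 - y1 by lra.
have : (p.1, y2) = (p.1, y1).
  apply: (vp _ _ ((p.2 - y1) / (y2 - y1))) => //.
    apply/andP; split; last by rewrite ltr_pdivrMr// mul1r ltrD2r.
    by apply: divr_gt0 => //; rewrite subr_gt0.
  case: p {K1 K2 vp py1 py2} => x y; rewrite convE /=; congr pair; field; by rewrite (gt_eqF y12).
by move=> [] y21; rewrite y21 subrr ltxx in y12.
Qed.

Lemma base_point K (x : R) : convex_closed K -> K ptA -> K ptB -> 0 <= x -> x <= 2 ->
  K (x, 0).
Proof.
move=> cK KA KB x0 x2.
have -> : (x, 0) = (1 - x / 2) *: ptA + (1 - (1 - x / 2)) *: ptB.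
  by rewrite convE /ptA /ptB /=; congr pair; field.
by apply: cK => //; lra.
Qed.

Lemma steeper_Phi_inv (p q r : pt) :
  steeper (Phi_inv q - Phi_inv p) (Phi_inv r - Phi_inv q) =
  ((q.1 - r.1) * p.2 + (p.1 - q.1) * r.2 < (p.1 - r.1) * q.2).
Proof.
rewrite /steeper -subr_gt0 -[RHS]subr_gt0.
rewrite -(@pmulr_rgt0 _ 2) //; congr (0 < _).
by case: p q r => [p1 p2] [q1 q2] [r1 r2] /=; field.
Qed.

(** A vertex lies above the segment joining a vertex to its right and one to its left,
    because it cannot lie between this segment and the base. *)
Lemma vertex_turn K p q r : convex_closed K -> K ptA -> K ptB ->
  (forall z, K z -> 0 <= z.2) -> K p -> K r -> vertex K q ->
  r.1 < q.1 -> q.1 < p.1 -> 0 < q.1 -> q.1 < 2 ->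
  steeper (Phi_inv q - Phi_inv p) (Phi_inv r - Phi_inv q).
Proof.
move=> cK KA KB Kpos Kp Kr vq rq qp q0 q2.
rewrite steeper_Phi_inv ltNge; apply/negP => H.
have Kq : K q by case: vq.
have pr : 0 < p.1 - r.1 by lra.
pose t := (q.1 - r.1) / (p.1 - r.1).
have t0 : 0 < t by rewrite divr_gt0// subr_gt0.
have t1 : t < 1 by rewrite ltr_pdivrMr// mul1r; lra.
pose z : pt := t *: p + (1 - t) *: r.
have Kz : K z by apply: cK => //; exact: ltW.
have z1 : z.1 = q.1.
  by rewrite /z convE /= /t; field; rewrite gt_eqF.
have z2 : q.2 <= z.2.
  have -> : z.2 = ((q.1 - r.1) * p.2 + (p.1 - q.1) * r.2) / (p.1 - r.1).
    by rewrite /z convE /= /t; field; rewrite gt_eqF.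
  by rewrite ler_pdivlMr// mulrC.
have w0 : K (q.1, 0) by apply: base_point => //; exact: ltW.
have [qz|qz] := eqVneq q.2 z.2.
  have : p = r.
    case: vq => _ /(_ p r t Kp Kr); rewrite t0 t1 => /(_ isT); apply.
    by rewrite -/z [q]surjective_pairing [z]surjective_pairing z1 qz.
  by move=> pE; rewrite pE subrr ltxx in pr.
have qz' : q.2 < z.2 by rewrite lt_neqAle qz.
have [q2z|q2z] := eqVneq q.2 0.
  case: vq => _ /(_ ptA ptB (1 - q.1 / 2) KA KB).
  have -> : 0 < 1 - q.1 / 2 < 1 by apply/andP; split; lra.
  have qE : q = (1 - q.1 / 2) *: ptA + (1 - (1 - q.1 / 2)) *: ptB.
    by rewrite [q]surjective_pairing q2z convE /ptA /ptB /=; congr pair; field.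
  by move=> /(_ isT qE) [] /eqP; rewrite eq_sym pnatr_eq0.
apply: (not_vertex_between w0 _ _ qz' vq).
  by rewrite -z1 -surjective_pairing.
by rewrite lt_neqAle eq_sym q2z Kpos.
Qed.

End hulls.

(** * The vertices of a configuration form a convex chain *)

Section chains.
Context (R : realType).
Notation pt := (R * R)%type.
Implicit Types (v : seq pt) (p q : pt).

(** The vertices from [ptB] to [ptA], in the coordinates in which every edge of
    the chain has positive coordinates; [ptA] sits at the end as default value. *)
Definition corner v k : pt := Phi_inv (nth ptA (ptB :: v) k).
Definition edge_of v k : pt := corner v k.+1 - corner v k.

Lemma corner0 v : corner v 0 = 0.
Proof. by rewrite /corner /Phi_inv /ptB /=; congr pair; field. Qed.

Lemma corner_last v k : (size v < k)%N -> corner v k = (1, 1).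
Proof.
move=> vk; rewrite /corner nth_default// /Phi_inv /ptA /=.
by congr pair; field.
Qed.

Lemma corner_sum v k : corner v k = \sum_(i < k) edge_of v i.
Proof.
by rewrite -(big_mkord xpredT (edge_of v)) telescope_sumr// corner0 subr0.
Qed.

Lemma nth_increments n (v : n.-tuple pt) k : (k < n)%N ->
  nth 0 (increments v) k = edge_of v k.
Proof.
move=> kn; rewrite /increments /=.
have sv : size (map (@Phi_inv R) v) = n by rewrite size_map size_tuple.
rewrite (nth_pairmap 0) ?sv// /edge_of /corner /= (nth_map ptA) ?size_tuple//.
congr (_ - _); case: k kn => [|k] kn /=; last by rewrite (nth_map ptA)// size_tuple ltnW.
by rewrite /Phi_inv /ptB /=; congr pair; field.
Qed.

Lemma edge_sum_take n (v : n.-tuple pt) k : (k <= n)%N ->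
  edge_sum (take k (increments v)) = corner v k.
Proof.
move=> kn; rewrite corner_sum /edge_sum (big_nth 0) size_take_min size_tuple (minn_idPl kn).
rewrite big_mkord; apply: eq_bigr => i _.
by rewrite nth_take// nth_increments// (leq_trans (ltn_ord i)).
Qed.

Lemma last_edge_increments n (v : n.-tuple pt) : last_edge (increments v) = edge_of v n.
Proof.
rewrite /last_edge /edge_of -(edge_sum_take v (leqnn n)) take_oversize ?size_tuple//.
by rewrite corner_last// size_tuple.
Qed.

Definition chain_edges v n :=
  (forall k, (k <= n)%N -> ptpos (edge_of v k)) /\
  (forall i j, (i < j)%N -> (j <= n)%N -> steeper (edge_of v i) (edge_of v j)).

Lemma convex_chainP n (v : n.-tuple pt) : convex_chain (increments v) <-> chain_edges v n.
Proof.
rewrite /convex_chain /simplex last_edge_increments; split.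
  move=> /and3P[/andP[/(all_nthP 0) p0 pn] /(pairwiseP 0) st /(all_nthP 0) sl].
  split=> [k|i j ij]; rewrite leq_eqVlt => /predU1P[jE|kn]; rewrite ?jE//.
  - by have := p0 k; rewrite size_tuple nth_increments// => /(_ kn).
  - have iN : (i < n)%N by rewrite -jE.
    by have := sl i; rewrite size_tuple nth_increments// => /(_ iN).
  - have iN := ltn_trans ij kn.
    have := st i j; rewrite !inE !size_tuple !nth_increments// => /(_ iN kn ij).
    by [].
move=> [pe se]; apply/and3P; split.
- apply/andP; split; last exact: pe.
  by apply/(all_nthP 0) => k; rewrite size_tuple => kn; rewrite nth_increments//; exact/pe/ltnW.
- apply/(pairwiseP 0) => i j; rewrite !inE !size_tuple => iN jN ij.
  by rewrite !nth_increments//; apply: se => //; exact: ltnW.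
- by apply/(all_nthP 0) => k; rewrite size_tuple => kn; rewrite nth_increments//; exact: se.
Qed.

Lemma chain_edges_consecutive v n : (forall k, (k <= n)%N -> ptpos (edge_of v k)) ->
  (forall k, (k < n)%N -> steeper (edge_of v k) (edge_of v k.+1)) -> chain_edges v n.
Proof.
move=> pe se; split=> // i j; elim: j => // j IHj; rewrite ltnS leq_eqVlt.
move=> /predU1P[->|ij] jn; first exact: se.
apply: (@steeper_trans R (edge_of v j)); first exact: pe (ltnW _).
- by apply: pe; exact: ltnW (ltn_trans ij jn).
- exact: pe.
- by apply: IHj => //; exact: ltnW.
- exact: se.
Qed.

Lemma edge_abscissa v k : (nth ptA (ptB :: v) k).1 - (nth ptA (ptB :: v) k.+1).1 =
  (edge_of v k).1 + (edge_of v k).2.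
Proof.
rewrite /edge_of /corner; move: (nth _ _ k) (nth _ _ k.+1) => p q.
by rewrite /Phi_inv /=; field.
Qed.

Lemma edges_decreasing v n : (forall k, (k <= n)%N -> ptpos (edge_of v k)) ->
  forall i j, (i < j)%N -> (j <= n.+1)%N ->
  (nth ptA (ptB :: v) j).1 < (nth ptA (ptB :: v) i).1.
Proof.
move=> pe i j; elim: j => // j IHj; rewrite ltnS leq_eqVlt => /predU1P[->|ij] jn.
  rewrite -subr_gt0 edge_abscissa; have /andP[a b] := pe j jn.
  exact: addr_gt0.
apply: lt_trans (IHj ij (ltnW jn)).
rewrite -subr_gt0 edge_abscissa; have /andP[a b] := pe j jn.
exact: addr_gt0.
Qed.

Definition inner p := [/\ 0 <= p.2, p.2 < p.1 & p.1 + p.2 < 2].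

Definition generic N (u : 'I_N -> pt) :=
  (forall i, inner (u i)) /\ (forall i j, (u i).1 = (u j).1 -> i = j).

Lemma hullAB_A N (u : 'I_N -> pt) : hullAB u ptA.
Proof. by apply: sub_hull; left; left. Qed.

Lemma hullAB_B N (u : 'I_N -> pt) : hullAB u ptB.
Proof. by apply: sub_hull; left; right. Qed.

Lemma hullAB_u N (u : 'I_N -> pt) i : hullAB u (u i).
Proof. by apply: sub_hull; right; exists i. Qed.

Lemma hullAB_ge0 N (u : 'I_N -> pt) : (forall i, 0 <= (u i).2) ->
  forall z, hullAB u z -> 0 <= z.2.
Proof.
move=> u0; apply: (@hull_least R _ [set z : pt | 0 <= z.2]).
  move=> p q t /= p0 q0 t0 t1.
  rewrite -[X in _ <= X]/(t * p.2 + (1 - t) * q.2).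
  by rewrite addr_ge0// mulr_ge0// subr_ge0.
by move=> _ [[->|->]|[i _ <-]] /=.
Qed.

Lemma inner_abscissa p : inner p -> 0 < p.1 /\ p.1 < 2.
Proof. by move=> [? ? ?]; lra. Qed.

Lemma vertex_A N (u : 'I_N -> pt) : (forall i, inner (u i)) -> vertex (hullAB u) ptA.
Proof.
move=> iu; apply: (@exposed_vertex R _ _ (fun p => - p.1)).
- by move=> p q t; rewrite convE /=; ring.
- by left; left.
- move=> _ [[->|->]|[i _ <-]] => [//|_|_]; first by rewrite /ptA /ptB /=; lra.
  by have [] := inner_abscissa (iu i); rewrite /ptA /=; lra.
Qed.

Lemma vertex_B N (u : 'I_N -> pt) : (forall i, inner (u i)) -> vertex (hullAB u) ptB.
Proof.
move=> iu; apply: (@exposed_vertex R _ _ (fun p => p.1)).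
- by move=> p q t.
- by left; right.
- move=> _ [[->|->]|[i _ <-]] => [_|//|_]; first by rewrite /ptA /ptB /=; lra.
  by have [] := inner_abscissa (iu i).
Qed.

Lemma ptpos_from_B p : inner p \/ p = ptA -> ptpos (Phi_inv p - Phi_inv ptB).
Proof.
rewrite /ptpos /Phi_inv /ptB /=.
by case=> [[? ? ?]|->]; rewrite /ptA /=; apply/andP; split; lra.
Qed.

Lemma ptpos_to_A p : inner p \/ p = ptB -> ptpos (Phi_inv ptA - Phi_inv p).
Proof.
rewrite /ptpos /Phi_inv /ptA /=.
by case=> [[? ? ?]|->]; rewrite /ptB /=; apply/andP; split; lra.
Qed.

Lemma ptpos_between p e q : ptpos p -> ptpos q -> steeper p e -> steeper e q ->
  0 < e.1 + e.2 -> ptpos e.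
Proof.
rewrite /ptpos /steeper => /andP[p1 p2] /andP[q1 q2] pe eq e12.
apply/andP; split; rewrite ltNge; apply/negP => e0.
  have e2 : 0 < e.2 by lra.
  have h1 : e.1 * q.2 <= 0 by rewrite mulr_le0_ge0// ltW.
  have h2 : 0 < e.2 * q.1 by rewrite mulr_gt0.
  lra.
have e1 : 0 < e.1 by lra.
have h1 : p.1 * e.2 <= 0 by rewrite mulr_ge0_le0// ltW.
have h2 : 0 < p.2 * e.1 by rewrite mulr_gt0.
lra.
Qed.

Section vertex_chain.
Variables (N n : nat) (u : 'I_N -> pt) (s : 'I_n -> 'I_N).
Let v := [tuple u (s i) | i < n].

Lemma nth_selected (k : 'I_n) : nth ptA v k = u (s k).
Proof. by rewrite -tnth_nth tnth_mktuple. Qed.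

(** Consecutive vertices turn left by [vertex_turn]. The edges at the ends of the chain have
    positive coordinates because the points are inside the triangle; a middle edge has
    because its slope lies between the slopes of its links to the two base corners. *)
Lemma decreasing_vertices_chain : (forall i, inner (u i)) ->
  (forall i, vertex (hullAB u) (u (s i))) ->
  (forall i j : 'I_n, (i < j)%N -> (u (s j)).1 < (u (s i)).1) ->
  chain_edges v n.
Proof.
move=> iu vu su.
pose P k := nth ptA (ptB :: v) k.
have cK : convex_closed (hullAB u) := hull_convex (S := _).
have KP k : hullAB u (P k).
  rewrite /P; case: k => [|k]; first exact: hullAB_B.
  rewrite -[nth _ _ _]/(nth ptA v k).
  have [kn|kn] := ltnP k n; last by rewrite nth_default ?size_tuple//; exact: hullAB_A.
  by rewrite (nth_selected (Ordinal kn)); exact: hullAB_u.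
have K0 : forall z, hullAB u z -> 0 <= z.2.
  by apply: hullAB_ge0 => i; have [] := iu i.
have Plast k : (n < k)%N -> P k = ptA by move=> nk; rewrite /P nth_default// -[size _]/((size v).+1) size_tuple.
have Pmid k : (k < n)%N -> exists2 i : 'I_n, i = k :> nat & P k.+1 = u (s i).
  by move=> kn; exists (Ordinal kn) => //; exact: (nth_selected (Ordinal kn)).
have dP k : (k <= n)%N -> (P k.+1).1 < (P k).1.
  case: k => [_|k kn].
    have [n0|n0] := posnP n; first by rewrite Plast ?n0// /P /ptA /ptB /=.
    by have [i _ ->] := Pmid 0 n0; have [] := inner_abscissa (iu (s i)).
  have [i ik ->] := Pmid _ kn.
  move: kn; rewrite leq_eqVlt => /predU1P[kn|kn].
    by rewrite Plast ?kn//; have [] := inner_abscissa (iu (s i)).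
  by have [j jk ->] := Pmid _ kn; apply: su; rewrite ik jk.
have turn a b c : hullAB u a -> hullAB u c -> vertex (hullAB u) b -> inner b ->
    c.1 < b.1 -> b.1 < a.1 -> steeper (Phi_inv b - Phi_inv a) (Phi_inv c - Phi_inv b).
  move=> Ka Kc vb /inner_abscissa[b0 b2] cb ba.
  by apply: (vertex_turn cK) => //; [exact: hullAB_A|exact: hullAB_B].
apply: chain_edges_consecutive => k kn; last first.
  have [i _ Pi] := Pmid _ kn.
  rewrite /edge_of /corner -!/(P _); apply: turn; rewrite ?Pi//; first by rewrite -Pi dP.
  by rewrite -Pi; apply: dP; exact: ltnW.
rewrite /edge_of /corner -!/(P _).
case: k kn => [_|k kn].
  have -> : P 0 = ptB by [].
  apply: ptpos_from_B; have [n0|n0] := posnP n; first by right; rewrite Plast ?n0.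
  by left; have [i _ ->] := Pmid 0 n0.
have [i ik Pi] := Pmid _ kn.
have [kn'|kn'] := leqP n k.+1.
  by rewrite (Plast k.+2)//; apply: ptpos_to_A; left; rewrite Pi.
have [j jk Pj] := Pmid _ kn'.
apply: (@ptpos_between (Phi_inv (P k.+1) - Phi_inv ptB) _ (Phi_inv ptA - Phi_inv (P k.+2))).
- by apply: ptpos_from_B; left; rewrite Pi.
- by apply: ptpos_to_A; left; rewrite Pj.
- apply: turn; rewrite ?Pi//; [exact: hullAB_B|by rewrite -Pi dP|].
  by have [] := inner_abscissa (iu (s i)).
- apply: turn; rewrite ?Pj//; [exact: hullAB_A| |by rewrite -Pj dP// ltnW].
  by have [] := inner_abscissa (iu (s j)).
- have := dP k.+1 kn; rewrite -subr_gt0; congr (0 < _).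
  by move: (P k.+1) (P k.+2) => p q; rewrite /Phi_inv /=; field.
Qed.

End vertex_chain.

(** Sort the indices of the vertices by decreasing abscissa. Abscissas being distinct, the
    sorted list of vertices is the only candidate for [vertex_seq u]. *)
Lemma vertex_chain N n (u : 'I_N -> pt) : generic u -> vertex_count u = n ->
  exists s : 'I_n -> 'I_N, [/\ injective s,
    convex_chain (increments [tuple u (s i) | i < n]) &
    vertex_seq u = ptB :: rcons [tuple u (s i) | i < n] ptA].
Proof.
move=> [iu uI] cu.
pose V := [pred i | `[< vertex (hullAB u) (u i) >]].
pose L i j := (u j).1 <= (u i).1.
have Ltot : total L by move=> i j; exact: le_total.
have Ltr : transitive L by move=> i j k ij jk; exact: le_trans jk ij.
pose si := sort L (enum V).
have ssi : size si == n by rewrite size_sort -cardE -cu.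
pose s := tnth (Tuple ssi).
have usi : uniq si by rewrite sort_uniq enum_uniq.
have Vsi i : (i \in si) = V i by rewrite mem_sort mem_enum.
have sinj : injective s by apply/tuple_uniqP.
have sV i : vertex (hullAB u) (u (s i)).
  by have := mem_tnth i (Tuple ssi); rewrite -/(s i) Vsi => /asboolP.
have Lsi : sorted L si := sort_sorted Ltot _.
have sdec (i j : 'I_n) : (i < j)%N -> (u (s j)).1 < (u (s i)).1.
  move=> ij; rewrite lt_neqAle; apply/andP; split.
    apply/eqP => /uI /sinj jiE; by rewrite jiE ltnn in ij.
  have := sorted_ltn_nth Ltr (s i) Lsi i j; rewrite !inE (eqP ssi) => /(_ (ltn_ord i) (ltn_ord j) ij).
  by rewrite -!(tnth_nth (s i) (Tuple ssi)).
exists s; split => //.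
  by apply/convex_chainP; apply: decreasing_vertices_chain.
have vE : val [tuple u (s i) | i < n] = map u si.
  by rewrite -[LHS]/(map (u \o s) (enum 'I_n)) map_comp; congr map; exact: (map_tnth_enum (Tuple ssi)).
rewrite vE.
pose G p q := q.1 <= p.1 :> R.
have Gtr : transitive G by move=> p q r pq qr; exact: le_trans qr pq.
rewrite /vertex_seq -/G; set l1 := undup _.
have l1P p : p \in l1 -> [\/ p = ptB, p = ptA | exists i, p = u i].
  rewrite mem_undup mem_filter !inE => /andP[_ /or3P[/eqP->|/eqP->|/codomP[i ->]]].
  - by constructor 1.
  - by constructor 2.
  - by constructor 3; exists i.
have uin i : 0 < (u i).1 /\ (u i).1 < 2 by exact: inner_abscissa.
have G0 i : (u i).1 <> 0 by have [] := uin i; lra.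
have G2 i : (u i).1 <> 2 by have [] := uin i; lra.
have n20 : (2 : R) <> 0 by lra.
have abs p q : p \in l1 -> q \in l1 -> p.1 = q.1 -> p = q.
  move=> /l1P[->|->|[i ->]] /l1P[->|->|[j ->]] //=.
  - by move/esym/G2.
  - by move/esym.
  - by move/esym/G0.
  - by move/G2.
  - by move/G0.
  - by move/uI ->.
pose l2 := ptB :: rcons (map u si) ptA.
have l12 : perm_eq l1 l2.
  apply: uniq_perm; first exact: undup_uniq.
    rewrite /l2 /= mem_rcons rcons_uniq inE negb_or -andbA; apply/and4P; split.
    - by apply/eqP => -[].
    - by apply/mapP => -[i _ iE]; apply: (G2 i); rewrite -iE.
    - by apply/mapP => -[i _ iE]; apply: (G0 i); rewrite -iE.
    - by rewrite map_inj_uniq// => i j /(congr1 fst)/uI.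
  move=> p; rewrite mem_undup mem_filter !inE mem_rcons inE.
  apply/idP/idP => [/andP[/asboolP vp /or3P[->|->|]]|/or3P[/eqP->|/eqP->|]]; rewrite ?orbT//.
  - move=> /codomP[i pE]; apply/orP; right; apply/orP; right; apply/mapP; exists i => //.
    by rewrite Vsi; apply/asboolP; rewrite -pE.
  - by rewrite eqxx andbT; apply/asboolP/vertex_B.
  - by rewrite eqxx orbT andbT; apply/asboolP/vertex_A.
  - move=> /mapP[i]; rewrite Vsi => vi ->; rewrite codom_f !orbT andbT; exact: vi.
have -> : sort G l1 = sort G l2.
  apply/(perm_sort_inP) => //.
  - by move=> p q _ _; exact: le_total.
  - by move=> p q r _ _ _; exact: Gtr.
  - by move=> p q pl ql /andP[pq qp]; apply: abs => //; apply/le_anti/andP; split; [exact: qp|exact: pq].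
apply: sorted_sort => //; rewrite /l2 sorted_pairwise// pairwise_cons pairwise_rcons.
apply/and3P; split.
- rewrite all_rcons; apply/andP; split; first by rewrite /G /ptA /ptB /=.
  by apply/allP => _ /mapP[i _ ->]; rewrite /G; have [_ /ltW] := uin i.
- by apply/allP => _ /mapP[i _ ->]; rewrite /G; have [/ltW] := uin i.
- by rewrite -sorted_pairwise// sorted_map.
Qed.

(** Strictly between the base and a roof over [ptA], [ptB] and one member of [v]: a
    point of the configuration in this position is neither a vertex nor an
    obstacle to a member of [v] being one. *)
Definition below_chain v q := [/\ 0 < q.2, 0 <= q.1 <= 2 &
  exists V y, [/\ V \in v, q.2 < y & hull [set ptA; ptB; V] (q.1, y)]].

Lemma increasing_between (g : nat -> R) a b :
  (forall j, (a <= j)%N -> (j < b)%N -> g j < g j.+1) ->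
  forall i j, (a <= i)%N -> (i < j)%N -> (j <= b)%N -> g i < g j.
Proof.
move=> gS i j ai; elim: j => // j IHj; rewrite ltnS leq_eqVlt => /predU1P[<-|ij] jb.
  exact: gS.
apply: lt_trans (IHj ij (ltnW jb)) (gS _ _ jb).
exact: leq_trans ai (ltnW ij).
Qed.

(** The corners of a convex chain are exposed by the normals that lie between
    the normals of their two edges. *)
Lemma chain_vertices N n (u : 'I_N -> pt) (s : 'I_n -> 'I_N) :
  convex_chain (increments [tuple u (s i) | i < n]) ->
  (forall j, j \notin codom s -> below_chain [tuple u (s i) | i < n] (u j)) ->
  forall i, vertex (hullAB u) (u i) <-> i \in codom s.
Proof.
set v := [tuple u (s i) | i < n] => /convex_chainP[pe se] below i.
have cK : convex_closed (hullAB u) := hull_convex (S := _).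
split=> [vi|/codomP[k ->]].
  apply/negPn/negP => /below[u0 /andP[u1 u2] [V [y [Vv uy Vy]]]].
  apply: (@not_vertex_between R (hullAB u) (u i) 0 y) => //.
    by apply: base_point => //; [exact: hullAB_A|exact: hullAB_B].
  apply: hull_mono Vy => _ [[->|->]|->]; [by left; left|by left; right|right].
  by move/tnthP: Vv => [j ->]; rewrite tnth_mktuple; exists (s j).
pose w := edge_of v k + edge_of v k.+1.
pose f (z : pt) := w.2 * (Phi_inv z).1 - w.1 * (Phi_inv z).2.
have af : affine_function f.
  by move=> p q t; rewrite /f convE /Phi_inv /=; field.
pose P j := nth ptA (ptB :: v) j.
have kn := ltn_ord k.
have w1 : 0 < w.1.
  by apply: addr_gt0; [have /andP[] := pe k (ltnW kn)|have /andP[] := pe _ kn].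
have w2 : 0 < w.2.
  by apply: addr_gt0; [have /andP[] := pe k (ltnW kn)|have /andP[] := pe _ kn].
have df j : f (P j.+1) - f (P j) = w.2 * (edge_of v j).1 - w.1 * (edge_of v j).2.
  rewrite /f /edge_of /corner -!/(P _) /=; ring.
have wE1 : w.1 = (edge_of v k).1 + (edge_of v k.+1).1 by [].
have wE2 : w.2 = (edge_of v k).2 + (edge_of v k.+1).2 by [].
have sk := se k k.+1 (leqnn _) kn.
have up j : (0 <= j)%N -> (j < k.+1)%N -> f (P j) < f (P j.+1).
  move=> _; rewrite ltnS -subr_gt0 df wE1 wE2 leq_eqVlt => /predU1P[->|jk].
    by move: sk; rewrite /steeper; lra.
  have := se j k jk (ltnW kn); have := se j k.+1 (ltnW jk) kn.
  by rewrite /steeper; lra.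
have down j : (k.+1 <= j)%N -> (j < n.+1)%N -> - f (P j) < - f (P j.+1).
  rewrite ltrN2 ltnS -subr_lt0 df wE1 wE2 leq_eqVlt => /predU1P[<-|jk] jn.
    by move: sk; rewrite /steeper; lra.
  have := se k.+1 j jk jn; have := se k j (ltnW jk) jn.
  by rewrite /steeper; lra.
have fP j : (j <= n.+1)%N -> j != k.+1 -> f (P j) < f (P k.+1).
  move=> jn; rewrite neq_ltn => /orP[jk|jk].
    exact: (increasing_between up).
  by have := increasing_between down (leqnn _) jk jn; rewrite ltrN2.
have PA : P n.+1 = ptA by rewrite /P nth_default// -[size _]/((size v).+1) size_tuple.
have fP' j : (j <= n.+1)%N -> f (P j) <= f (P k.+1).
  by move=> jn; have [->//|/(fP _ jn)/ltW] := eqVneq j k.+1.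
have PkE : P k.+1 = u (s k) by exact: nth_selected.
have fA : f ptA < f (u (s k)) by rewrite -PkE -PA fP// eqSS gtn_eqF.
have fB : f ptB < f (u (s k)) by rewrite -PkE -[ptB]/(P 0) fP.
apply: (@exposed_vertex R _ _ f af); first by right; exists (s k).
move=> _ [[->//|->//]|[j _ <-]] jk.
have [/codomP[l jE]|/below[u0 _ [V [y [Vv uy Vy]]]]] := boolP (j \in codom s).
  have Pl : P l.+1 = u j by rewrite jE; exact: nth_selected.
  rewrite -Pl -PkE; apply: fP; first by rewrite ltnS ltnW.
  by apply/eqP => lk; apply: jk; rewrite -Pl lk PkE.
apply: (@lt_le_trans _ _ (f ((u j).1, y))).
  rewrite -subr_gt0 (_ : _ - _ = (w.1 + w.2) / 2 * (y - (u j).2)).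
    by rewrite mulr_gt0 ?subr_gt0// divr_gt0// addr_gt0.
  by rewrite /f /Phi_inv /=; field.
apply: (@hull_least R _ [set z | f z <= f (u (s k))]) Vy => [p q t /= fp fq t0 t1|].
  rewrite af; have t1' : 0 <= 1 - t by rewrite subr_ge0.
  by have h1 := ler_wpM2l t0 fp; have h2 := ler_wpM2l t1' fq; lra.
move=> _ [[->|->]|->] /=; [exact: ltW|exact: ltW|].
move/tnthP: Vv => [l ->]; rewrite tnth_mktuple -PkE.
have <- : P l.+1 = u (s l) by exact: nth_selected.
by apply: fP'; rewrite ltnS ltnW.
Qed.

Lemma chain_vertex_count N n (u : 'I_N -> pt) (s : 'I_n -> 'I_N) : injective s ->
  convex_chain (increments [tuple u (s i) | i < n]) ->
  (forall j, j \notin codom s -> below_chain [tuple u (s i) | i < n] (u j)) ->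
  vertex_count u = n.
Proof.
move=> sI cv bv; rewrite /vertex_count -[RHS](card_ord n) -(card_codom sI).
by apply: eq_card => i; rewrite inE; apply/asboolP/idP => /(chain_vertices cv bv).
Qed.

Lemma chain_selection_uniq N n (u : 'I_N -> pt) (s t : 'I_n -> 'I_N) :
  convex_chain (increments [tuple u (s i) | i < n]) ->
  (forall j, j \notin codom s -> below_chain [tuple u (s i) | i < n] (u j)) ->
  convex_chain (increments [tuple u (t i) | i < n]) ->
  (forall j, j \notin codom t -> below_chain [tuple u (t i) | i < n] (u j)) ->
  s =1 t.
Proof.
move=> cs bs ct bt.
pose r i j := (u j).1 < (u i).1.
have sorted_r (q : 'I_n -> 'I_N) : convex_chain (increments [tuple u (q i) | i < n]) -> sorted r (codom q).
  move=> /convex_chainP[pe _].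
  rewrite sorted_pairwise; last by move=> a b c ab bc; exact: lt_trans bc ab.
  rewrite codomE -[map _ _]/(val [tuple q i | i < n]); apply/pairwise_tnthP => i j ij.
  rewrite !tnth_mktuple /r -!(nth_selected u q).
  have jn : (j.+1 <= n.+1)%N by rewrite ltnW// ltnS.
  by have := @edges_decreasing _ n pe i.+1 j.+1 ij jn.
have E : codom s = codom t.
  apply: (@irr_sorted_eq _ r); rewrite ?sorted_r//.
  - by move=> a b c ab bc; exact: lt_trans bc ab.
  - by move=> a; rewrite /r ltxx.
  - move=> i; apply/idP/idP.
      by move/(chain_vertices cs bs)/(chain_vertices ct bt).
    by move/(chain_vertices ct bt)/(chain_vertices cs bs).
move=> i; have := congr1 (nth (s i) ^~ i) E.
rewrite !codomE -[map s _]/(val [tuple s i | i < n]) -[map t _]/(val [tuple t i | i < n]).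
by rewrite -!tnth_nth !tnth_mktuple.
Qed.

End chains.

(** * Distances, and convex combinations with rational weights *)

Section distances.
Context (R : realType).
Notation pt := (R * R)%type.
Implicit Types (p q : pt).

Lemma eucl_ge0 p q : 0 <= eucl_dist p q. Proof. exact: sqrtr_ge0. Qed.

Lemma eucl_sym p q : eucl_dist p q = eucl_dist q p.
Proof. by rewrite /eucl_dist; congr Num.sqrt; ring. Qed.

Lemma eucl_sqr p q : eucl_dist p q ^+ 2 = (p.1 - q.1) ^+ 2 + (p.2 - q.2) ^+ 2.
Proof. by rewrite sqr_sqrtr// addr_ge0// sqr_ge0. Qed.

Lemma eucl_le p q (c : R) : 0 <= c -> (eucl_dist p q <= c) =
  ((p.1 - q.1) ^+ 2 + (p.2 - q.2) ^+ 2 <= c ^+ 2).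
Proof. by move=> c0; rewrite -eucl_sqr ler_sqr ?nnegrE// eucl_ge0. Qed.

Lemma eucl_triangle p q (r : pt) : eucl_dist p r <= eucl_dist p q + eucl_dist q r.
Proof.
rewrite eucl_le ?addr_ge0 ?eucl_ge0// (sqrrD (eucl_dist p q)) !eucl_sqr.
set x := eucl_dist p q; set y := eucl_dist q r.
pose a := p.1 - q.1; pose b := p.2 - q.2; pose c := q.1 - r.1; pose d := q.2 - r.2.
have H : a * c + b * d <= x * y.
  have xy0 : 0 <= x * y by rewrite mulr_ge0// eucl_ge0.
  have [s0|s0] := lerP 0 (a * c + b * d); last exact: le_trans (ltW s0) xy0.
  rewrite -ler_sqr ?nnegrE// exprMn !eucl_sqr -/a -/b -/c -/d -subr_ge0.
  by rewrite (_ : _ - _ = (a * d - b * c) ^+ 2) ?sqr_ge0//; ring.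
rewrite -/a -/b -/c -/d (_ : p.1 - r.1 = a + c); last by rewrite /a /c; ring.
rewrite (_ : p.2 - r.2 = b + d); last by rewrite /b /d; ring.
move: H; rewrite -[x * y *+ 2]mulr_natr; lra.
Qed.

Lemma eucl_le_sum p q : eucl_dist p q <= `|p.1 - q.1| + `|p.2 - q.2|.
Proof.
rewrite eucl_le ?addr_ge0// (sqrrD `|p.1 - q.1|) !real_normK ?num_real// -subr_ge0.
rewrite (_ : _ - _ = `|p.1 - q.1| * `|p.2 - q.2| *+ 2); last by ring.
by rewrite mulrn_wge0// mulr_ge0.
Qed.

Lemma eucl_ge1 p q : `|p.1 - q.1| <= eucl_dist p q.
Proof.
by rewrite -ler_sqr ?nnegrE ?eucl_ge0// eucl_sqr real_normK ?num_real// lerDl sqr_ge0.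
Qed.

Lemma eucl_ge2 p q : `|p.2 - q.2| <= eucl_dist p q.
Proof.
by rewrite -ler_sqr ?nnegrE ?eucl_ge0// eucl_sqr real_normK ?num_real// lerDr sqr_ge0.
Qed.

Lemma fst_sum (I : Type) (s : seq I) (P : pred I) (f : I -> pt) :
  (\sum_(i <- s | P i) f i).1 = \sum_(i <- s | P i) (f i).1.
Proof. by elim/big_ind2: _ => // x y p q <- <-. Qed.

Lemma snd_sum (I : Type) (s : seq I) (P : pred I) (f : I -> pt) :
  (\sum_(i <- s | P i) f i).2 = \sum_(i <- s | P i) (f i).2.
Proof. by elim/big_ind2: _ => // x y p q <- <-. Qed.

Definition weights n (l : 'I_n -> R) := (forall i, 0 <= l i) /\ \sum_i l i = 1.

(** A family of weights close to [l], vanishing where [l] does, that depends on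
    rational parameters only: normalise rationals slightly above the [l i]. *)
Definition rweight n (r : {ffun 'I_n -> rat}) (i : 'I_n) : R :=
  ratr (r i) / \sum_j ratr (r j).

Definition admissible n (r : {ffun 'I_n -> rat}) :=
  [forall i, 0 <= r i] && [exists i, 0 < r i].

Lemma admissible_sum n (r : {ffun 'I_n -> rat}) : admissible r ->
  0 < \sum_j (ratr (r j) : R).
Proof.
move=> /andP[/forallP r0 /existsP[i ri]].
by rewrite (bigD1 i)//= ltr_pwDl ?ltr0q// sumr_ge0// => j _; rewrite ler0q.
Qed.

Lemma weights_rweight n (r : {ffun 'I_n -> rat}) : admissible r -> weights (rweight r).
Proof.
move=> ar; have s0 := admissible_sum ar; split=> [i|].
  by apply: divr_ge0; [rewrite ler0q; have /andP[/forallP] := ar|exact: ltW].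
by rewrite -mulr_suml divff// gt_eqF.
Qed.

Definition comb n (l : 'I_n -> R) (w : 'I_n -> pt) : pt := \sum_i l i *: w i.

Lemma comb1 n (l : 'I_n -> R) w : (comb l w).1 = \sum_i l i * (w i).1.
Proof. by rewrite /comb fst_sum. Qed.

Lemma comb2 n (l : 'I_n -> R) w : (comb l w).2 = \sum_i l i * (w i).2.
Proof. by rewrite /comb snd_sum. Qed.

Lemma hull_comb n (w : 'I_n -> pt) p : hull (range w) p <-> exists2 l, weights l & p = comb l w.
Proof.
split=> [/hull_rangeP[l [l0 l1 pE]]|[l [l0 l1] pE]]; first by exists l.
by apply/hull_rangeP; exists l.
Qed.

Lemma approx_weights n (l : 'I_n -> R) (w : 'I_n -> pt) (eps : R) : weights l -> 0 < eps ->
  exists r, [/\ admissible r, forall i, l i = 0 -> r i = 0 &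
    eucl_dist (comb l w) (comb (rweight r) w) < eps].
Proof.
move=> [l0 l1] e0.
pose M := \sum_i (`|(w i).1| + `|(w i).2|).
have M0 : 0 <= M by rewrite sumr_ge0// => i _; rewrite addr_ge0.
have M1 : 0 < M + 1 by rewrite ltr_wpDl.
pose de := eps / (n.+1%:R * (M + 1)).
have n0 : 0 < n.+1%:R :> R by rewrite ltr0n.
have de0 : 0 < de by rewrite divr_gt0// mulr_gt0.
have rE i : exists q : rat, l i < ratr q < l i + de.
  have [|q] := @rat_in_itvoo R (l i) (l i + de); first by rewrite ltrDl.
  by rewrite in_itv /= => ?; exists q.
pose r := [ffun i => if l i == 0 then 0 else xchoose (rE i)].
have r_in i : l i <= ratr (r i) <= l i + de.
  rewrite ffunE; case: eqP => [->|_]; first by rewrite rmorph0 lexx add0r ltW.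
  by have /andP[/ltW-> /ltW->] := xchooseP (rE i).
have ar : admissible r.
  have r0 i : 0 <= r i.
    by rewrite -(ler0q R); have /andP[+ _] := r_in i; exact: le_trans.
  apply/andP; split; first exact/forallP.
  apply: contraT => /existsPn H; exfalso.
  move: l1; rewrite big1 => [/esym/eqP|i _]; first by rewrite oner_eq0.
  have ri : r i = 0 by apply/eqP; rewrite eq_le r0 andbT leNgt.
  have /andP[+ _] := r_in i; rewrite ri rmorph0 => li.
  by apply/eqP; rewrite eq_le li l0.
exists r; split=> // [i li|]; first by rewrite ffunE; case: eqP => // /(_ li).
set S := \sum_j (ratr (r j) : R).
have S1 : 1 <= S by rewrite -l1; apply: ler_sum => i _; have /andP[] := r_in i.
have S2 : S <= 1 + n%:R * de.
  have -> : 1 + n%:R * de = \sum_(i < n) (l i + de).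
    by rewrite big_split /= l1 sumr_const card_ord mulr_natl.
  by apply: ler_sum => i _; have /andP[] := r_in i.
have S0 : 0 < S by lra.
have dw i : `|l i - rweight r i| <= n.+1%:R * de.
  have /andP[r1 r2] := r_in i; have li1 : l i <= 1.
    by rewrite -l1 (bigD1 i)//= lerDl sumr_ge0.
  have nE : n.+1%:R * de = n%:R * de + de by rewrite -natr1 mulrDl mul1r.
  have nd0 : 0 <= n%:R * de by rewrite mulr_ge0// ltW.
  rewrite /rweight -/S ler_norml; apply/andP; split.
    have : ratr (r i) / S <= ratr (r i).
      by rewrite ler_pdivrMr// ler_peMr//; exact: le_trans r1.
    lra.
  suff : l i - n.+1%:R * de <= ratr (r i) / S by lra.
  rewrite ler_pdivlMr//.
  have [neg|pos] := lerP (l i - n.+1%:R * de) 0.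
    have : 0 <= ratr (r i) :> R by exact: le_trans r1.
    by have := mulr_le0_ge0 neg (ltW S0); lra.
  have h1 : (l i - n.+1%:R * de) * S <= (l i - n.+1%:R * de) * (1 + n%:R * de).
    by rewrite ler_pM2l.
  have h2 : l i * (n%:R * de) <= 1 * (n%:R * de) by rewrite ler_wpM2r.
  have h3 : 0 <= n.+1%:R * de * (n%:R * de) by rewrite mulr_ge0// mulr_ge0// ltW.
  lra.
apply: (@le_lt_trans _ _ (n.+1%:R * de * M)).
  apply: le_trans (eucl_le_sum _ _) _.
  have ME : M = \sum_i `|(w i).1| + \sum_i `|(w i).2| by rewrite -big_split.
  rewrite !comb1 !comb2 -!sumrB ME mulrDr !mulr_sumr; apply: lerD.
    apply: le_trans (ler_norm_sum _ _ _) _; apply: ler_sum => i _.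
    by rewrite -mulrBl normrM ler_wpM2r.
  apply: le_trans (ler_norm_sum _ _ _) _; apply: ler_sum => i _.
  by rewrite -mulrBl normrM ler_wpM2r.
have -> : n.+1%:R * de * M = eps * (M / (M + 1)) by rewrite /de; field; rewrite !gt_eqF.
by rewrite -[ltRHS]mulr1 ltr_pM2l// ltr_pdivrMr// mul1r ltrDl.
Qed.

Lemma linear_rV_continuous n (a : 'I_n -> R) :
  continuous (fun v : 'rV[R]_n => \sum_i v ord0 i * a i).
Proof.
apply: (@continuous_big R _ +%R 0 xpredT add_continuous _ _ (fun i (v : 'rV[R]_n) => v ord0 i * a i)) => i _ v.
have h : {for v, continuous (fun v : 'rV[R]_n => v ord0 i)} := @coord_continuous R 1 n ord0 i v.
by apply: (continuousM h); exact: cst_continuous.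
Qed.

Lemma const_sub_continuous n (f : 'rV[R]_n -> R) c (v : 'rV[R]_n) :
  {for v, continuous f} -> {for v, continuous (fun v : 'rV[R]_n => c - f v)}.
Proof.
move=> h; have := @cvgB R _ _ _ _ (fun=> c) f c (f v) (cvg_cst _) h; exact.
Qed.

(** Hulls of finite families are closed, by compactness of the cube of all
    coefficients; the constraints on the weights are put into the minimised function. *)
Lemma limit_weights n (w : 'I_n -> pt) (J : pred 'I_n) p :
  (forall eps : R, 0 < eps -> exists l, [/\ weights l, forall i, ~~ J i -> l i = 0 &
    eucl_dist p (comb l w) < eps]) ->
  exists l, [/\ weights l, forall i, ~~ J i -> l i = 0 & p = comb l w].
Proof.
move=> H.
pose g (a : 'I_n -> R) (c : R) (v : 'rV[R]_n) : R := `|c - \sum_i v ord0 i * a i|.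
have cg a c : continuous (g a c).
  move=> v; apply: (@continuous_comp _ _ _ (fun v : 'rV[R]_n => c - \sum_i v ord0 i * a i) (fun x : R => `|x|)); last exact: norm_continuous.
  exact: (@const_sub_continuous n (fun v : 'rV[R]_n => \sum_i v ord0 i * a i) c v (@linear_rV_continuous n a v)).
pose f v : R := g (fun i => (w i).1) p.1 v + g (fun i => (w i).2) p.2 v +
  (g (fun=> 1) 1 v + g (fun i => (~~ J i)%:R) 0 v).
have cf : continuous f.
  have cD (f1 f2 : 'rV[R]_n -> R) : continuous f1 -> continuous f2 -> continuous (fun v => f1 v + f2 v).
    by move=> c1 c2 v; have := continuousD (c1 v) (c2 v); exact.
  by apply: (cD); apply: (cD); exact: cg.
pose A : set 'rV[R]_n := [set v | forall i, `[0 : R, 1]%classic (v ord0 i)].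
have cA : compact A.
  exact: (@rV_compact R n (fun=> `[0 : R, 1]%classic) (fun=> @segment_compact R 0 1)).
have lin_of (l : 'I_n -> R) a : \sum_i (\row_i l i) ord0 i * a i = \sum_i l i * a i :> R.
  by apply: eq_bigr => i _; rewrite mxE.
have wA l : weights l -> A (\row_i l i).
  move=> [l0 l1] i; rewrite /= in_itv /= mxE l0 -l1 (bigD1 i)//= lerDl sumr_ge0//.
have fl l : weights l -> (forall i, ~~ J i -> l i = 0) ->
    f (\row_i l i) = `|p.1 - (comb l w).1| + `|p.2 - (comb l w).2|.
  move=> [l0 l1] lJ; rewrite /f /g !lin_of comb1 comb2.
  under [X in 1 - X]eq_bigr do rewrite mulr1.
  have z : \sum_i l i * (~~ J i)%:R = 0.
    by apply: big1 => i _; case: (boolP (J i)) => [|/lJ->]; rewrite ?mulr0 ?mul0r.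
  by rewrite z l1 !subrr normr0 !addr0.
have [l1 [wl1 _ _]] := H 1 ltr01.
have [c] := @EVT_min_rV R n f A (ex_intro _ _ (wA _ wl1)) cA (continuous_subspaceT cf).
rewrite inE => Ac minc.
have fc : f c = 0.
  apply/eqP; rewrite eq_le; apply/andP; split; last by rewrite /f /g !addr_ge0.
  apply/ler_addgt0Pl => e e0; rewrite addr0.
  have [l [wl lJ ple]] := H (e / 2) (divr_gt0 e0 (ltr0Sn R 1)).
  apply: le_trans (minc _ (mem_set (wA _ wl))) _; rewrite fl//.
  have := eucl_ge1 p (comb l w); have := eucl_ge2 p (comb l w); lra.
pose l i := c ord0 i.
have l0 i : 0 <= l i by have := Ac i; rewrite /= in_itv /= => /andP[].
have n0 (x y : R) : 0 <= `|x - y| by [].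
have /and4P[/eqP f1 /eqP f2 /eqP f3 /eqP f4] : [&& g (fun i => (w i).1) p.1 c == 0, g (fun i => (w i).2) p.2 c == 0,
    g (fun=> 1) 1 c == 0 & g (fun i => (~~ J i)%:R) 0 c == 0].
  move/eqP: fc; rewrite /f paddr_eq0 ?addr_ge0 ?normr_ge0// !paddr_eq0 ?normr_ge0//.
  by rewrite -andbA.
exists l; split.
- split=> //; move/eqP: f3; rewrite /g normr_eq0 subr_eq0 => /eqP ->.
  by apply: eq_bigr => i _; rewrite mulr1.
- move/eqP: f4; rewrite /g normr_eq0 sub0r oppr_eq0 => /eqP f4 i Ji.
  have := psumr_eq0P _ f4 (i := i) isT; rewrite Ji mulr1; apply => j _.
  by rewrite mulr_ge0.
- move/eqP: f1; rewrite /g normr_eq0 subr_eq0 => /eqP f1.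
  move/eqP: f2; rewrite /g normr_eq0 subr_eq0 => /eqP f2.
  by rewrite [p]surjective_pairing [comb l w]surjective_pairing comb1 comb2 f1 f2.
Qed.

(** [w i] is extreme when the hull minus [w i] is still convex. The points equal to
    [w i] have to be left out together, since the family may repeat points. *)
Lemma vertex_notin_others n (w : 'I_n -> pt) i : vertex (hull (range w)) (w i) <->
  ~ exists l, [/\ weights l, forall j, ~~ (w j != w i) -> l j = 0 & w i = comb l w].
Proof.
pose H : set pt := [set p | exists l, [/\ weights l, forall j, ~~ (w j != w i) -> l j = 0 & p = comb l w]].
have cH : convex_closed H.
  move=> p q t [l [[l0 l1] lJ ->]] [m [[m0 m1] mJ ->]] t0 t1.
  exists (fun j => t * l j + (1 - t) * m j); split.
  - split=> [j|]; first by rewrite addr_ge0// mulr_ge0// subr_ge0.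
    by rewrite big_split /= -!mulr_sumr l1 m1 !mulr1 addrC subrK.
  - by move=> j wj; rewrite lJ// mJ// !mulr0 addr0.
  - rewrite /comb !scaler_sumr -big_split/=; apply: eq_bigr => j _.
    by rewrite [RHS]scalerDl !scalerA.
pose K : set pt := [set z | hull (range w) z /\ z <> w i].
split=> [[_ vi] [l [[l0 l1] lJ wE]]|nH].
  have cK : convex_closed K.
    move=> p q t [hp pw] [hq qw] t0 t1; split; first exact: hull_convex.
    move=> zE; have [tE|t0'] := eqVneq t 0.
      by apply: qw; rewrite -zE tE subr0 scale1r scale0r add0r.
    have [tE|t1'] := eqVneq t 1; first by apply: pw; rewrite -zE tE subrr scale1r scale0r addr0.
    have pq : p = q by apply: (vi _ _ t) => //; rewrite !lt_neqAle t0 t1 t1' eq_sym t0'.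
    by apply: pw; rewrite -zE -pq -scalerDl addrC subrK scale1r.
  have [j0 lj0] : exists j, l j != 0.
    apply/existsP; apply: contraT => /existsPn l00; exfalso; move: l1; rewrite big1 => [/esym/eqP|j _].
      by rewrite oner_eq0.
    by apply/eqP; have := l00 j; rewrite negbK.
  have wj0 : w j0 != w i by apply: contraT => /lJ/eqP; rewrite (negPf lj0).
  pose w' j := if w j != w i then w j else w j0.
  have Kw j : w j != w i -> K (w j) by move=> /eqP ?; split=> //; apply: sub_hull; exists j.
  have Kw' j : K (w' j) by rewrite /w'; case: ifP => [/Kw//|_]; exact: Kw.
  have [_] := @convex_combination R K n w' l cK Kw' l0 l1.
  apply; rewrite wE /comb; apply: eq_bigr => j _; rewrite /w'.
  by case: ifPn => // /lJ ->; rewrite !scale0r.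
split; first by apply: sub_hull; exists i.
move=> q1 q2 t /hull_comb[l [l0 l1] ->] /hull_comb[m [m0 m1] ->] /andP[t0 t1] wE.
have t1' : 0 < 1 - t by rewrite subr_gt0.
pose k j := t * l j + (1 - t) * m j.
have k0 j : 0 <= k j by rewrite addr_ge0// mulr_ge0// ltW.
have k1 : \sum_j k j = 1.
  by rewrite big_split /= -!mulr_sumr l1 m1 !mulr1 addrC subrK.
have wk : w i = comb k w.
  rewrite [LHS]wE /comb !scaler_sumr -big_split/=; apply: eq_bigr => j _.
  by rewrite [RHS]scalerDl !scalerA.
pose si := \sum_(j | w j == w i) k j.
have siE : \sum_(j | w j != w i) k j = 1 - si.
  have : si + \sum_(j | w j != w i) k j = 1 by rewrite -k1 [RHS](bigID (fun j => w j == w i)).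
  by move=> <-; rewrite addrAC subrr add0r.
have si1 : 1 - si = 0.
  apply/eqP; apply: contraT => si1; exfalso; apply: nH.
  have s0 : 0 < 1 - si by rewrite lt_neqAle eq_sym si1 -siE sumr_ge0.
  exists (fun j => if w j != w i then k j / (1 - si) else 0); split.
  - split=> [j|]; first by case: ifP => // _; rewrite divr_ge0// ltW.
    by rewrite -big_mkcond /= -mulr_suml siE divff.
  - by move=> j /negbTE ->.
  - have E : \sum_(j | w j != w i) k j *: w j = (1 - si) *: w i.
      have E2 : \sum_(j | w j == w i) k j *: w j = si *: w i.
        by rewrite scaler_suml; apply: eq_bigr => j /eqP ->.
      apply/esym; rewrite scalerBl scale1r [X in X - _]wk /comb (bigID (fun j => w j == w i)) /=.
      by rewrite E2 addrAC subrr add0r.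
    rewrite /comb (eq_bigr (fun j => if w j != w i then (1 - si)^-1 *: (k j *: w j) else 0)).
      by rewrite -big_mkcond /= -scaler_sumr E scalerA mulVf// scale1r.
    by move=> j _; case: ifP => _; rewrite ?scale0r// scalerA mulrC.
have kJ j : w j != w i -> k j = 0.
  have k00 : \sum_(j | w j != w i) k j = 0 by rewrite siE.
  exact: (psumr_eq0P (fun j _ => k0 j) k00).
have combE (a : 'I_n -> R) : \sum_j a j = 1 -> (forall j, w j != w i -> a j = 0) -> comb a w = w i.
  move=> a1 aJ; rewrite -[RHS]scale1r -a1 scaler_suml; apply: eq_bigr => j _.
  by have [->//|/aJ->] := eqVneq (w j) (w i); rewrite !scale0r.
rewrite !combE// => j /kJ/eqP; rewrite paddr_eq0 ?mulr_ge0 ?(ltW t0) ?(ltW t1')// !mulf_eq0.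
  by rewrite (gt_eqF t1') => /andP[_ /eqP].
by rewrite (gt_eqF t0) => /andP[/eqP].
Qed.

End distances.

(** * Measurability of vertices, paths and Hausdorff distances *)

Section countable_operations.
Context d (Om : measurableType d) (R : realType).
Notation pt := (R * R)%type.

Lemma measurable_exists (I : countType) (A : I -> set Om) :
  (forall i, measurable (A i)) -> measurable [set x | exists i, A i x].
Proof.
move=> mA; rewrite (_ : mkset _ = \bigcup_i A i).
  by apply: countable_bigcupT_measurable => //; exact: countableP.
by apply/seteqP; split=> [x [i Ai]|x [i _ Ai]]; [exists i|exists i].
Qed.

Lemma measurable_not (A : set Om) : measurable A -> measurable [set x | ~ A x].
Proof. by move=> mA; exact: (measurableC mA). Qed.

Lemma measurable_all_countable (I : countType) (A : I -> set Om) :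
  (forall i, measurable (A i)) -> measurable [set x | forall i, A i x].
Proof.
move=> mA; rewrite (_ : mkset _ = ~` [set x | exists i, (~` A i) x]).
  by apply: measurableC; apply: measurable_exists => i; exact: measurableC.
by apply/seteqP; split=> [x Ax [i]|x nE i]; [apply; exact: Ax|apply: contrapT => nA; apply: nE; exists i].
Qed.

Lemma measurable_constant (Q : Prop) : measurable (fun _ : Om => Q).
Proof.
have [q|nq] := pselect Q.
  by rewrite (_ : (fun _ => _) = setT)//; apply/seteqP; split.
by rewrite (_ : (fun _ => _) = set0)//; apply/seteqP; split.
Qed.

Lemma measurable_pattern (I : finType) (b : I -> Om -> bool) (G : {ffun I -> bool} -> set Om) :
  (forall i, measurable [set x | b i x]) -> (forall f, measurable (G f)) ->
  measurable [set x | G [ffun i => b i x] x].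
Proof.
move=> mb mG.
rewrite (_ : mkset _ = [set x | exists f : {ffun I -> bool}, ([set x | forall i, [set x | b i x = f i] x] `&` G f) x]).
  apply: measurable_exists => f; apply: measurableI => //; apply: measurable_forall => i.
  case: (f i); first exact: mb.
  rewrite (_ : mkset _ = ~` [set x | b i x]); first exact: measurableC.
  by apply/seteqP; split=> x /= => [->//|/negP/negbTE].
apply/seteqP; split=> [x Gx|x [f [/= bf]]] /=.
  by exists [ffun i => b i x]; split=> //= i; rewrite ffunE.
by rewrite (_ : finfun _ = f)//; apply/ffunP => i; rewrite ffunE.
Qed.

Lemma measurable_eucl_lt (f g : Om -> pt) (c : R) :
  measurable_fun setT f -> measurable_fun setT g ->
  measurable [set x | eucl_dist (f x) (g x) < c].
Proof.
move=> mf mg; have [c0|c0] := lerP 0 c; last first.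
  rewrite (_ : mkset _ = set0)//; apply/seteqP; split=> // x /= H.
  by have := eucl_ge0 (f x) (g x); rewrite leNgt (lt_trans H).
rewrite (_ : mkset _ = [set x | ((f x).1 - (g x).1) ^+ 2 + ((f x).2 - (g x).2) ^+ 2 < c ^+ 2]).
  apply: measurable_set_lt => //; apply: measurable_funD; apply: measurable_funX;
    by apply: measurable_funB; exact: measurableT_comp.
by apply/seteqP; split=> x /=; rewrite -eucl_sqr ltr_sqr ?nnegrE// eucl_ge0.
Qed.

Lemma measurable_eucl_ge (f g : Om -> pt) (c : R) :
  measurable_fun setT f -> measurable_fun setT g ->
  measurable [set x | c <= eucl_dist (f x) (g x)].
Proof.
move=> mf mg; rewrite (_ : mkset _ = [set x | ~ eucl_dist (f x) (g x) < c]).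
  by apply: measurable_not; exact: measurable_eucl_lt.
by apply/seteqP; split=> x /=; [rewrite leNgt => /negP|move/negP; rewrite -leNgt].
Qed.

Lemma measurable_comb n (l : 'I_n -> R) (w : 'I_n -> Om -> pt) :
  (forall i, measurable_fun setT (w i)) -> measurable_fun setT (fun x => comb l (w^~ x)).
Proof.
move=> mw.
rewrite (_ : (fun x => _) = fun x => (\sum_(i < n) l i * (w i x).1, \sum_(i < n) l i * (w i x).2)).
  apply: measurable_fun_pair; apply: measurable_sum => i;
    by apply: measurable_funM => //; exact: measurableT_comp.
by apply/funext => x; rewrite [LHS]surjective_pairing comb1 comb2.
Qed.

Lemma measurable_neq (f g : Om -> pt) : measurable_fun setT f -> measurable_fun setT g ->
  measurable [set x | f x != g x].
Proof.
move=> mf mg; rewrite (_ : mkset _ = ~` ([set x | (f x).1 == (g x).1] `&` [set x | (f x).2 == (g x).2])).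
  by apply: measurableC; apply: measurableI; apply: measurable_set_eq; exact: measurableT_comp.
apply/seteqP; split=> x /=.
  by move=> /negP H [h1 h2]; apply: H; rewrite -pair_eqE /pair_eq /= h1 h2.
by move=> H; apply/negP => /eqP fg; apply: H; rewrite fg.
Qed.

Lemma small_inverse (eps : R) : 0 < eps -> exists k : nat, k.+1%:R^-1 < eps.
Proof.
move=> e0; exists (Num.bound eps^-1).
rewrite invf_plt ?posrE//; have := archi_boundP (ltW (_ : 0 < eps^-1)); rewrite invr_gt0 => /(_ e0) /lt_trans.
by apply; rewrite ltr_nat.
Qed.

Lemma vertex_approx n (w : 'I_n -> pt) i : vertex (hull (range w)) (w i) <->
  ~ forall k : nat, exists r : {ffun 'I_n -> rat},
    [/\ admissible r, forall j, 0 < r j -> w j != w i &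
        eucl_dist (w i) (comb (rweight R r) w) < k.+1%:R^-1].
Proof.
rewrite vertex_notin_others; apply: not_iff_compat; split.
  move=> [l [wl lJ wE]] k; have k0 : 0 < k.+1%:R^-1 :> R by rewrite invr_gt0.
  have [r [ar rl dl]] := approx_weights w wl k0.
  exists r; split => //; last by rewrite {1}wE.
  by move=> j rj; apply: contraT => /lJ/rl rj0; rewrite rj0 ltxx in rj.
move=> H; apply: limit_weights => eps e0.
have [k ke] := small_inverse e0; have [r [ar rJ dl]] := H k.
exists (rweight R r); split; [exact: weights_rweight| |exact: lt_trans ke].
move=> j nj; have rj : r j = 0.
  apply/eqP; rewrite eq_le; apply/andP; split; last by have /andP[/forallP] := ar.
  by rewrite leNgt; apply: contra nj; exact: rJ.
by rewrite /rweight rj rmorph0 mul0r.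
Qed.

(** By density of rational weights and closedness of hulls, not being a vertex is a
    countable combination of inequalities between the points. *)
Lemma measurable_vertex n (w : 'I_n -> Om -> pt) i :
  (forall i, measurable_fun setT (w i)) ->
  measurable [set x | vertex (hull (range (w^~ x))) (w i x)].
Proof.
move=> mw; rewrite (_ : mkset _ = [set x | ~ [set x | forall k : nat, [set x | exists r : {ffun 'I_n -> rat},
    [set x | admissible r /\ (forall j, [set x | 0 < r j -> w j x != w i x] x) /\
        eucl_dist (w i x) (comb (rweight R r) (w^~ x)) < k.+1%:R^-1] x] x] x]).
  apply: measurable_not; apply: measurable_all_countable => k; apply: measurable_exists => r.
  apply: measurableI.
    exact: measurable_constant.
  apply: measurableI.
    apply: measurable_forall => j; apply: measurable_imply => _; exact: measurable_neq.
  by apply: measurable_eucl_lt => //; exact: measurable_comb.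
apply/seteqP; split=> x /=; rewrite vertex_approx.
  by move=> H H'; apply: H => k; have [r [? [? ?]]] := H' k; exists r.
by move=> H H'; apply: H => k; have [r [? ? ?]] := H' k; exists r.
Qed.

End countable_operations.

Section uniform_distance.
Context (R : realType).
Implicit Types (x : nat -> R) (g h : R -> R).

Lemma ratr_le1 (q : rat) : (ratr q <= 1 :> R) = (q <= 1).
Proof. by rewrite -(rmorph1 (@ratr R)) ler_rat. Qed.

(** Local Lipschitz bounds to the right are enough to move to a rational time; the paths
    of interest are affine between consecutive indices. *)
Lemma rational_witness h (c : R) :
  (forall t, 0 <= t < 1 -> exists de L : R, [/\ 0 < de, 0 <= L &
     forall t', t <= t' -> t' < t + de -> `|h t' - h t| <= L * (t' - t)]) ->
  (exists t, 0 <= t <= 1 /\ c < h t) ->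
  exists q : rat, 0 <= q <= 1 /\ c < h (ratr q).
Proof.
move=> hh [t [/andP[t0 t1] ct]]; have [t1E|t1'] := eqVneq t 1.
  by exists 1; rewrite rmorph1 -t1E; split.
have t_lt1 : t < 1 by rewrite lt_neqAle t1'.
have [|de [L [de0 L0 hL]]] := hh t; first by rewrite t0.
have L1 : 0 < L + 1 by rewrite ltr_wpDl.
pose e := Num.min de (Num.min (1 - t) ((h t - c) / (L + 1))).
have e0 : 0 < e by rewrite !lt_min de0 subr_gt0 t_lt1 divr_gt0 ?subr_gt0.
have [|q] := @rat_in_itvoo R t (t + e); first by rewrite ltrDl.
rewrite in_itv /= => /andP[tq qt].
have e1 : e <= de by rewrite ge_min lexx.
have e2 : e <= 1 - t by rewrite !ge_min lexx orbT.
have e3 : e <= (h t - c) / (L + 1) by rewrite !ge_min lexx !orbT.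
exists q; split; first by rewrite -(ler0q R) -ratr_le1 (le_trans t0 (ltW tq))/=; lra.
have := hL _ (ltW tq) (lt_le_trans qt (lerD (lexx t) e1)).
have h1 : L * (ratr q - t) <= L * e by rewrite ler_wpM2l//; lra.
have h2 : L * e <= L * ((h t - c) / (L + 1)) by rewrite ler_wpM2l.
have h3 : L * ((h t - c) / (L + 1)) < h t - c.
  have -> : L * ((h t - c) / (L + 1)) = (h t - c) * (L / (L + 1)) by field; rewrite gt_eqF.
  by rewrite -[ltRHS]mulr1 ltr_pM2l ?subr_gt0// ltr_pdivrMr// mul1r ltrDl.
by rewrite ler_norml => /andP[h4 _]; lra.
Qed.

Definition tame_limit g := (forall t, 0 <= t <= 1 -> `|g t| <= 2) /\
  (forall t t', 0 <= t <= t' -> t' <= 1 -> `|g t' - g t| <= 2 * (t' - t)).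

Lemma tame_Xlim : tame_limit (@Xlim R).
Proof.
split=> [t /andP[t0 t1]|t t' /andP[t0 tt'] t1]; rewrite /Xlim ler_norml; apply/andP; split; lra.
Qed.

Lemma tame_Ylim : tame_limit (@Ylim R).
Proof.
split=> [t /andP[t0 t1]|t t' /andP[t0 tt'] t1]; rewrite /Ylim ler_norml.
  by apply/andP; split; nra.
have -> : 2 * t' * (1 - t') - 2 * t * (1 - t) = 2 * (t' - t) * (1 - t' - t) by ring.
by apply/andP; split; nra.
Qed.

Lemma truncn_le_last n (t : R) : 0 <= t <= 1 -> (Num.truncn (t * n.+1%:R) <= n.+1)%N.
Proof.
move=> /andP[t0 t1]; have s0 : 0 <= t * n.+1%:R by rewrite mulr_ge0.
have /andP[ks _] := truncn_itv s0.
by rewrite -(ler_nat R) (le_trans ks)// ler_piMl.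
Qed.

Lemma interp_bounded x n (t : R) : 0 <= t <= 1 ->
  `|interp x (t * n.+1%:R)| <= 3 * \sum_(j < n.+3) `|x j|.
Proof.
move=> t01; have kn := truncn_le_last n t01.
have /andP[t0 t1] := t01; have s0 : 0 <= t * n.+1%:R by rewrite mulr_ge0.
have /andP[ks sk] := truncn_itv s0.
rewrite /interp; set k := Num.truncn _ in kn ks sk *.
have xM j : (j < n.+3)%N -> `|x j| <= \sum_(j < n.+3) `|x j|.
  by move=> jn; rewrite (bigD1 (Ordinal jn))//= lerDl sumr_ge0.
have h1 := xM k (leq_trans kn (leqnSn _)); have h2 := xM k.+1 kn.
have h3 : `|(t * n.+1%:R - k%:R) * (x k.+1 - x k)| <= `|x k.+1 - x k|.
  rewrite normrM ler_piMl// ger0_norm ?subr_ge0//.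
  by move: sk; rewrite -natr1; lra.
have h4 := ler_normB (x k.+1) (x k).
by have := ler_normD (x k) ((t * n.+1%:R - k%:R) * (x k.+1 - x k)); lra.
Qed.

Lemma unif_dist_gt x n g (c : R) : tame_limit g ->
  c < unif_dist (fun t => interp x (t * n.+1%:R)) g <->
  exists q : rat, 0 <= q <= 1 /\ c < `|interp x (ratr q * n.+1%:R) - g (ratr q)|.
Proof.
move=> [g2 glip].
pose h t := `|interp x (t * n.+1%:R) - g t|.
have in01 (t : R) : `[0, 1]%classic t = (0 <= t <= 1) :> Prop by rewrite /= in_itv.
have n0 : 0 < n.+1%:R :> R by rewrite ltr0n.
have ubh : has_ubound [set h t | t in `[0, 1]].
  exists (3 * \sum_(j < n.+3) `|x j| + 2) => _ [t + <-]; rewrite in01 => t01.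
  apply: le_trans (ler_normB _ _) _; apply: lerD; first exact: interp_bounded.
  exact: g2.
split=> [cs|[q [/andP[q0 q1] cq]]]; last first.
  apply: lt_le_trans cq _; apply: (ub_le_sup ubh).
  by exists (ratr q) => //; rewrite in01 ler0q ratr_le1 q0.
apply: (@rational_witness h) => [t /andP[t0 t1]|].
  have s0 : 0 <= t * n.+1%:R by rewrite mulr_ge0.
  have /andP[ks sk] := truncn_itv s0; set k := Num.truncn _ in ks sk.
  exists (Num.min (1 - t) ((k.+1%:R - t * n.+1%:R) / n.+1%:R)), (n.+1%:R * `|x k.+1 - x k| + 2).
  split; first by rewrite lt_min subr_gt0 t1 divr_gt0// subr_gt0.
    by rewrite addr_ge0// mulr_ge0.
  move=> t' tt'; rewrite -ltrBlDl lt_min => /andP[t'1]; rewrite ltr_pdivlMr// => t'k.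
  have kE : Num.truncn (t' * n.+1%:R) = k.
    apply: truncn_def; rewrite (le_trans ks) ?ler_wpM2r//=.
    by move: t'k; rewrite mulrBl; lra.
  apply: le_trans (ler_dist_dist _ _) _.
  have -> : interp x (t' * n.+1%:R) - g t' - (interp x (t * n.+1%:R) - g t) =
      (t' - t) * n.+1%:R * (x k.+1 - x k) - (g t' - g t).
    by rewrite /interp kE -/k; ring.
  apply: le_trans (ler_normB _ _) _; rewrite [leRHS]mulrDl; apply: lerD.
    rewrite normrM ger0_norm ?mulr_ge0 ?subr_ge0//.
    by rewrite [leRHS]mulrC mulrA.
  by apply: glip; [rewrite t0|lra].
apply: contrapT => nH; move: cs; rewrite ltNge => /negP; apply.
apply: ge_sup; first by exists (h 0), 0 => //; rewrite in01 lexx ler01.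
move=> _ [t + <-]; rewrite in01 => t01; rewrite leNgt; apply/negP => ct.
by apply: nH; exists t.
Qed.

End uniform_distance.

Section hausdorff_distance.
Context (R : realType).
Notation pt := (R * R)%type.

Lemma dist_to_set_le (p q : pt) L : L q -> dist_to_set p L <= eucl_dist p q.
Proof.
move=> Lq; apply: ge_inf; last by exists q.
by exists 0 => _ [z _ <-]; exact: eucl_ge0.
Qed.

Lemma dist_to_set_gt (p q0 : pt) L (c : R) : L q0 ->
  c < dist_to_set p L <-> exists k : nat, forall q, L q -> c + k.+1%:R^-1 <= eucl_dist p q.
Proof.
move=> Lq0; split=> [cd|[k H]].
  have [|k kc] := @small_inverse R (dist_to_set p L - c); first by rewrite subr_gt0.
  exists k => q Lq; have := dist_to_set_le p Lq; move: kc; move: (k.+1%:R^-1) => a; lra.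
apply: (@lt_le_trans _ _ (c + k.+1%:R^-1)); first by rewrite ltrDl invr_gt0.
by apply: lb_le_inf; [exists (eucl_dist p q0), q0|move=> _ [q Lq <-]; exact: H].
Qed.

(** The margin [k.+1^-1] leaves room to move both points to rational combinations, so that
    exceeding [c] is a countable condition. *)
Lemma one_sided_gt n m (w : 'I_n -> pt) (w' : 'I_m -> pt) (c : R) : 'I_n -> 'I_m ->
  c < sup [set dist_to_set p (hull (range w')) | p in hull (range w)] <->
  exists (k : nat) (r : {ffun 'I_n -> rat}), admissible r /\
    forall r' : {ffun 'I_m -> rat}, admissible r' ->
    c + k.+1%:R^-1 <= eucl_dist (comb (rweight R r) w) (comb (rweight R r') w').
Proof.
move=> i0 j0; pose K := hull (range w); pose L := hull (range w').
have Lq : L (w' j0) by apply: sub_hull; exists j0.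
have ubd : has_ubound [set dist_to_set p L | p in K].
  exists (\sum_i `|(w i).1| + \sum_i `|(w i).2| + `|(w' j0).1| + `|(w' j0).2|).
  move=> _ [p /hull_comb[l [l0 l1] pE] <-].
  apply: le_trans (dist_to_set_le p Lq) _; apply: le_trans (eucl_le_sum _ _) _.
  have l_le1 i : l i <= 1 by rewrite -l1 (bigD1 i)//= lerDl sumr_ge0.
  have h1 : `|p.1| <= \sum_i `|(w i).1|.
    rewrite pE comb1; apply: le_trans (ler_norm_sum _ _ _) _; apply: ler_sum => i _.
    by rewrite normrM ger0_norm// ler_piMl.
  have h2 : `|p.2| <= \sum_i `|(w i).2|.
    rewrite pE comb2; apply: le_trans (ler_norm_sum _ _ _) _; apply: ler_sum => i _.
    by rewrite normrM ger0_norm// ler_piMl.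
  by have := ler_normB p.1 (w' j0).1; have := ler_normB p.2 (w' j0).2; lra.
have rK k (a : 'I_k -> pt) (r : {ffun 'I_k -> rat}) : admissible r ->
    hull (range a) (comb (rweight R r) a).
  by move=> ar; apply/hull_comb; exists (rweight R r) => //; exact: weights_rweight.
split=> [cs|[k [r [ar H]]]].
  have [p [Kp cp]] : exists p, K p /\ c < dist_to_set p L.
    apply: contrapT => nH; move: cs; rewrite ltNge => /negP; apply.
    apply: ge_sup; first by exists (dist_to_set (w i0) L), (w i0) => //; apply: sub_hull; exists i0.
    move=> _ [p Kp <-]; rewrite leNgt; apply/negP => ct.
    by apply: nH; exists p.
  have /(dist_to_set_gt p c Lq)[k H] := cp.
  have k0 : 0 < k.+1%:R^-1 / 2 :> R by rewrite divr_gt0// invr_gt0.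
  have [k' kk'] := small_inverse k0.
  have /hull_comb[l wl pE] := Kp; have [r [ar _ pr]] := approx_weights w wl k0.
  rewrite -pE in pr.
  exists k', r; split=> // r' ar'.
  have := H _ (rK _ w' _ ar').
  have := eucl_triangle p (comb (rweight R r) w) (comb (rweight R r') w').
  move: kk' pr; move: (k.+1%:R^-1) (k'.+1%:R^-1) => a b; lra.
apply: (@lt_le_trans _ _ (c + k.+1%:R^-1)); first by rewrite ltrDl invr_gt0.
apply: (@le_trans _ _ (dist_to_set (comb (rweight R r) w) L)); last first.
  by apply: (ub_le_sup ubd); exists (comb (rweight R r) w) => //; exact: rK.
apply: lb_le_inf; first by exists (eucl_dist (comb (rweight R r) w) (w' j0)), (w' j0).
move=> _ [q /hull_comb[l wl qE] <-]; apply/ler_addgt0Pr => e e0.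
have [r' [ar' _ qr]] := approx_weights w' wl e0; rewrite -qE in qr.
have := H _ ar'.
have := eucl_triangle (comb (rweight R r) w) q (comb (rweight R r') w').
by move: qr; move: (k.+1%:R^-1) => a; lra.
Qed.

Definition corners (i : 'I_3) : pt := tnth [tuple ptA; ptB; ptC] i.

Lemma triangle_corners : triangle = hull (range corners).
Proof.
rewrite /triangle; congr hull; apply/seteqP; split.
  move=> _ [[->|->]|->].
  - by exists (inord 0) => //; rewrite /corners (tnth_nth 0) inordK.
  - by exists (inord 1) => //; rewrite /corners (tnth_nth 0) inordK.
  - by exists (inord 2) => //; rewrite /corners (tnth_nth 0) inordK.
move=> _ [i _ <-]; have := mem_tnth i [tuple (ptA : pt); ptB; ptC].
by rewrite -/(corners i) !inE => /or3P[] /eqP ->; [left; left|left; right|right].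
Qed.

End hausdorff_distance.

Section configuration_events.
Context (R : realType) (N : nat).
Notation pt := (R * R)%type.
Implicit Type u : 'I_N -> pt.

Definition points u (i : 'I_N.+2) : pt :=
  if unlift ord0 i is Some j then (if unlift ord0 j is Some k then u k else ptA) else ptB.

Lemma map_points u : map (points u) (enum 'I_N.+2) = ptB :: ptA :: codom u.
Proof.
rewrite enum_ordSl /= {1}/points unlift_none; congr cons.
rewrite -map_comp enum_ordSl /= {1}/points liftK unlift_none; congr cons.
by rewrite -map_comp codomE; apply: eq_map => i; rewrite /points /= !liftK.
Qed.

Lemma points_u u i : points u (lift ord0 (lift ord0 i)) = u i.
Proof. by rewrite /points !liftK. Qed.

Lemma hullAB_points u : hullAB u = hull (range (points u)).
Proof.
rewrite /hullAB; congr hull; apply/seteqP; split.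
  move=> _ [[->|->]|[i _ <-]].
  - by exists (lift ord0 ord0) => //; rewrite /points liftK unlift_none.
  - by exists ord0 => //; rewrite /points unlift_none.
  - by exists (lift ord0 (lift ord0 i)) => //; rewrite points_u.
move=> _ [i _ <-]; rewrite /points; case: (unlift ord0 i) => [j|]; last by left; right.
by case: (unlift ord0 j) => [k|]; [right; exists k|left; left].
Qed.

Fixpoint undup_on (e : rel 'I_N.+2) (s : seq 'I_N.+2) :=
  if s is x :: s' then if has (e x) s' then undup_on e s' else x :: undup_on e s' else [::].

Lemma undup_map (f : 'I_N.+2 -> pt) s :
  undup (map f s) = map f (undup_on (fun i j => f i == f j) s).
Proof.
elim: s => //= x s ->; have -> : (f x \in map f s) = has (fun j => f x == f j) s.
  by apply/mapP/hasP => -[y ys /eqP fy]; exists y => //; apply/eqP.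
by case: ifP.
Qed.

Definition comparison := ('I_N.+2 + ('I_N.+2 * 'I_N.+2) + ('I_N.+2 * 'I_N.+2))%type.

Definition compared u (c : comparison) : bool := match c with
  | inl (inl i) => `[< vertex (hullAB u) (points u i) >]
  | inl (inr ij) => points u ij.1 == points u ij.2
  | inr ij => (points u ij.2).1 <= (points u ij.1).1
  end.

Definition vertex_order (f : {ffun comparison -> bool}) : seq 'I_N.+2 :=
  sort (fun i j => f (inr (i, j)))
    (undup_on (fun i j => f (inl (inr (i, j)))) [seq i <- enum 'I_N.+2 | f (inl (inl i))]).

(** The list of vertices is a relabelling of a list of indices that depends only on
    finitely many comparisons; hence each of its entries is measurable. *)
Lemma vertex_seq_order u :
  vertex_seq u = map (points u) (vertex_order [ffun c => compared u c]).
Proof.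
rewrite /vertex_seq -map_points filter_map undup_map sort_map /vertex_order.
congr map; congr (sort _ _); first by apply/funext => i; apply/funext => j; rewrite ffunE.
have -> : (fun i j => [ffun c => compared u c] (inl (inr (i, j)))) = (fun i j => points u i == points u j).
  by apply/funext => i; apply/funext => j; rewrite ffunE.
by congr undup_on; apply: eq_filter => i; rewrite ffunE.
Qed.

Section measurable_configuration.
Context d (Om : measurableType d) (u : 'I_N -> Om -> pt).
Hypothesis mu : forall i, measurable_fun setT (u i).

Lemma measurable_points i : measurable_fun setT (fun x => points (u^~ x) i).
Proof.
rewrite /points; case: (unlift ord0 i) => [j|]; last exact: measurable_cst.
by case: (unlift ord0 j) => [k|]; [exact: mu|exact: measurable_cst].
Qed.

Lemma measurable_vertex_points i :
  measurable [set x | vertex (hullAB (u^~ x)) (points (u^~ x) i)].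
Proof.
under eq_set do rewrite hullAB_points.
exact: (@measurable_vertex _ _ _ _ (fun i x => points (u^~ x) i) i measurable_points).
Qed.

Lemma measurable_compared c : measurable [set x | compared (u^~ x) c].
Proof.
case: c => [[i|[i j]]|[i j]] /=.
- rewrite (_ : mkset _ = [set x | vertex (hullAB (u^~ x)) (points (u^~ x) i)]).
    exact: measurable_vertex_points.
  by apply/seteqP; split=> x /= /asboolP.
- rewrite (_ : mkset _ = [set x | ~ points (u^~ x) i != points (u^~ x) j]).
    by apply: measurable_not; apply: measurable_neq; exact: measurable_points.
  by apply/seteqP; split=> x /= => [->//|/negP]; rewrite negbK.
- by apply: measurable_set_le; apply: measurableT_comp => //; exact: measurable_points.
Qed.

Lemma measurable_vertex_count n : measurable [set x | vertex_count (u^~ x) = n].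
Proof.
pose b i x := `[< vertex (hullAB (u^~ x)) (u i x) >].
rewrite (_ : mkset _ = [set x | (fun f : {ffun 'I_N -> bool} => [set _ : Om | #|[pred i | f i]| = n]) [ffun i => b i x] x]).
  apply: (measurable_pattern (b := b) (G := fun f : {ffun 'I_N -> bool} => [set _ : Om | #|[pred i | f i]| = n])) => [i|f].
    rewrite (_ : mkset _ = [set x | vertex (hullAB (u^~ x)) (points (u^~ x) (lift ord0 (lift ord0 i)))]).
      exact: measurable_vertex_points.
    by apply/seteqP; split=> x /=; rewrite points_u => /asboolP.
  exact: measurable_constant.
by apply/seteqP; split=> x /= <-; apply: eq_card => i; rewrite !inE ffunE.
Qed.

Lemma measurable_nth_vertex k : measurable_fun setT (fun x => nth (0, 0) (vertex_seq (u^~ x)) k).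
Proof.
move=> _ A mA; rewrite setTI.
rewrite (_ : _ @^-1` A = [set x | (fun f : {ffun comparison -> bool} =>
    [set x | A (nth (0, 0) (map (points (u^~ x)) (vertex_order f)) k)]) [ffun c => compared (u^~ x) c] x]).
  apply: (measurable_pattern (b := fun c x => compared (u^~ x) c) (G := fun f : {ffun comparison -> bool} =>
    [set x | A (nth (0, 0) (map (points (u^~ x)) (vertex_order f)) k)])); first exact: measurable_compared.
  move=> f; have [ks|ks] := ltnP k (size (vertex_order f)).
    under eq_set do rewrite (nth_map ord0)//.
    by have := measurable_points (nth ord0 (vertex_order f) k) measurableT mA; rewrite setTI.
  under eq_set do rewrite nth_default ?size_map//.
  exact: measurable_constant.
by apply/seteqP; split=> x /=; rewrite vertex_seq_order.
Qed.

Lemma measurable_interp_vertex n (t : R) (b : bool) : measurable_fun setT (fun x =>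
  interp (fun i => let p := nth (0, 0) (vertex_seq (u^~ x)) i in if b then p.1 else p.2) (t * n.+1%:R)).
Proof.
have mx k : measurable_fun setT (fun x =>
    let p := nth (0, 0) (vertex_seq (u^~ x)) k in if b then p.1 else p.2).
  by case: b; apply: measurableT_comp => //; exact: measurable_nth_vertex.
rewrite /interp; apply: measurable_funD; first exact: mx.
by apply: measurable_funM => //; apply: measurable_funB; exact: mx.
Qed.

Lemma measurable_unif_dist2 n (eps : R) :
  measurable [set x | eps < unif_dist2 (Xn n (u^~ x), Yn n (u^~ x)) (@Xlim R, @Ylim R)].
Proof.
pose f b x i := let p := nth (0, 0) (vertex_seq (u^~ x)) i in if b then p.1 else p.2.
have m1 b g : tame_limit g ->
    measurable [set x | eps < unif_dist (fun t => interp (f b x) (t * n.+1%:R)) g].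
  move=> tg; rewrite (_ : mkset _ = [set x | exists q : rat, ([set _ : Om | 0 <= q <= 1] `&`
      [set x | eps < `|interp (f b x) (ratr q * n.+1%:R) - g (ratr q)|]) x]).
    apply: measurable_exists => q; apply: measurableI; first exact: measurable_constant.
    apply: measurable_set_lt => //; apply: measurableT_comp => //.
    by apply: measurable_funB => //; exact: measurable_interp_vertex.
  by apply/seteqP; split=> x /=; rewrite unif_dist_gt.
rewrite (_ : mkset _ = [set x | eps < unif_dist (fun t => interp (f true x) (t * n.+1%:R)) (@Xlim R)] `|`
  [set x | eps < unif_dist (fun t => interp (f false x) (t * n.+1%:R)) (@Ylim R)]).
  by apply: measurableU; apply: m1; [exact: tame_Xlim|exact: tame_Ylim].
apply/seteqP; split=> x /=; rewrite /unif_dist2 lt_max /=; first by move=> /orP[]; [left|right].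
by move=> [H|H]; apply/orP; [left|right].
Qed.

Lemma measurable_one_sided n m (w : 'I_n -> Om -> pt) (w' : 'I_m -> Om -> pt) (c : R) : 'I_n -> 'I_m ->
  (forall i, measurable_fun setT (w i)) -> (forall i, measurable_fun setT (w' i)) ->
  measurable [set x | c < sup [set dist_to_set p (hull (range (w'^~ x))) | p in hull (range (w^~ x))]].
Proof.
move=> i0 j0 mw mw'.
rewrite (_ : mkset _ = [set x | exists k : nat, [set x | exists r : {ffun 'I_n -> rat},
  ([set _ : Om | admissible r] `&` [set x | forall r' : {ffun 'I_m -> rat}, [set x | admissible r' ->
    [set x | c + k.+1%:R^-1 <= eucl_dist (comb (rweight R r) (w^~ x)) (comb (rweight R r') (w'^~ x))] x] x]) x] x]).
  apply: measurable_exists => k; apply: measurable_exists => r.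
  apply: measurableI; first exact: measurable_constant.
  apply: measurable_all_countable => r'; apply: measurable_imply => _.
  by apply: measurable_eucl_ge; exact: measurable_comb.
by apply/seteqP; split=> x /=; rewrite (one_sided_gt _ _ _ i0 j0).
Qed.

Lemma measurable_hausdorff_dist (eps : R) : 'I_N ->
  measurable [set x | eps < hausdorff_dist (hull (range (u^~ x))) triangle].
Proof.
move=> i0; pose w' (i : 'I_3) (_ : Om) : pt := corners R i.
have mw' i : measurable_fun setT (w' i) by exact: measurable_cst.
rewrite (_ : mkset _ =
  [set x | eps < sup [set dist_to_set p (hull (range (w'^~ x))) | p in hull (range (u^~ x))]] `|`
  [set x | eps < sup [set dist_to_set p (hull (range (u^~ x))) | p in hull (range (w'^~ x))]]).
  by apply: measurableU; apply: measurable_one_sided => //; exact: ord0.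
apply/seteqP; split=> x /=; rewrite /hausdorff_dist triangle_corners lt_max.
  by move=> /orP[]; [left|right].
by move=> [H|H]; apply/orP; [left|right].
Qed.

End measurable_configuration.
End configuration_events.

Arguments corner : simpl never.

(** * From grid values to the parabola *)

Section interpolation.
Context (R : realType).
Implicit Types (a : nat -> R).

Lemma interp_ge a j (s : R) : (forall i, a i <= a i.+1) -> j%:R <= s -> a j <= interp a s.
Proof.
move=> aS js; have s0 : 0 <= s by exact: le_trans js.
have /andP[ks sk] := truncn_itv s0; rewrite /interp; set k := Num.truncn s in ks sk *.
have jk : (j <= k)%N by rewrite -ltnS -(ltr_nat R); exact: le_lt_trans sk.
have ajk : a j <= a k by apply: (@homo_leq _ a <=%R) => //; exact: le_trans.
apply: le_trans ajk _; rewrite lerDl mulr_ge0 ?subr_ge0//.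
Qed.

Lemma interp_le a j (s : R) : (forall i, a i <= a i.+1) -> 0 <= s -> s <= j%:R -> interp a s <= a j.
Proof.
move=> aS s0 sj; have /andP[ks sk] := truncn_itv s0; rewrite /interp.
set k := Num.truncn s in ks sk *.
have kj : (k <= j)%N by rewrite -(ler_nat R); exact: le_trans sj.
have hom : {homo a : x y / (x <= y)%N >-> x <= y}.
  by apply: (@homo_leq _ a <=%R) => //; exact: le_trans.
move: kj; rewrite leq_eqVlt => /predU1P[kj|kj].
  have -> : s - k%:R = 0 by apply/eqP; rewrite subr_eq0 eq_le ks kj sj.
  by rewrite mul0r addr0 hom ?kj.
apply: le_trans (hom _ _ kj).
rewrite -lerBrDl ler_piMl ?subr_ge0//.
by move: sk; rewrite -natr1; lra.
Qed.

(** Monotonicity squeezes the path between its values at the indices attached to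
    neighbouring grid points; these indices are only known up to [n / (2 K)], so
    one goes one grid point further on each side. *)
Lemma interp_grid a (f : R -> R) n K : (0 < K)%N -> (2 * K <= n)%N ->
  (forall i, a i <= a i.+1) ->
  (forall s t, 0 <= s <= t -> t <= 1 -> f s <= f t <= f s + 2 * (t - s)) ->
  a 0 = f 0 -> a n.+1 = f 1 ->
  (forall k, (0 < k < K)%N -> exists j : nat,
     `|j%:R - n%:R * (k%:R / K%:R) : R| <= n%:R / (2 * K%:R) /\
     `|a j - f (k%:R / K%:R)| <= (2 * K%:R)^-1) ->
  forall t, 0 <= t <= 1 -> `|interp a (t * n.+1%:R) - f t| <= 5 / K%:R.
Proof.
move=> K0 Kn aS fL a0 a1 grid t /andP[t0 t1].
have K0' : 0 < K%:R :> R by rewrite ltr0n.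
pose h : R := K%:R^-1; have h0 : 0 < h by rewrite invr_gt0.
have hK : h * K%:R = 1 by rewrite mulVf// gt_eqF.
have nh : 2 <= n%:R * h.
  rewrite -ler_pdivrMr// invrK; move: Kn; rewrite -(ler_nat R) natrM; lra.
have n0 : 0 <= n%:R :> R by [].
have {}grid k : (0 < k)%N -> (k < K)%N -> exists j : nat, [/\ j%:R <= n%:R * (k%:R * h) + n%:R * (h / 2),
    n%:R * (k%:R * h) - n%:R * (h / 2) <= j%:R & `|a j - f (k%:R * h)| <= h].
  move=> k0 kK; have [|j []] := grid k; first by rewrite k0.
  rewrite invfM -/h => H1 H2; exists j.
  move: H1; rewrite ler_norml => /andP[H1 H1'].
  have E : n%:R * (2^-1 * h) = n%:R * (h / 2) by rewrite [2^-1 * h]mulrC.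
  by split; [lra|lra|apply: le_trans H2 _; lra].
have f2 s s' : 0 <= s <= s' -> s' <= 1 -> f s <= f s' /\ f s' <= f s + 2 * (s' - s).
  by move=> h1 h2; have /andP[] := fL _ _ h1 h2.
have tK0 : 0 <= t * K%:R by rewrite mulr_ge0// ltW.
have /andP[kt tk] := truncn_itv tK0; set k := Num.truncn _ in kt tk.
have kK : (k <= K)%N by rewrite -(ler_nat R) (le_trans kt)// ler_piMl// ltW.
have kht : k%:R * h <= t by rewrite -ler_pdivlMr// invrK.
have thk : t < (k%:R + 1) * h by rewrite -ltr_pdivrMr// invrK natr1.
have nS : n.+1%:R = n%:R + 1 :> R by rewrite natr1.
have s0 : 0 <= t * n.+1%:R by rewrite mulr_ge0.
have nh0 : 0 <= n%:R * h by rewrite mulr_ge0// ltW.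
have lower : f t - 5 * h <= interp a (t * n.+1%:R).
  have [k1|k1] := leqP k 1.
    have := @interp_ge a 0%N _ aS s0; rewrite a0.
    have [|//|_] := f2 0 t; first by rewrite lexx.
    have : k%:R * h <= 1 * h by rewrite ler_wpM2r ?(ltW h0)// lern1.
    by move: thk; rewrite mulrDl; lra.
  have kE : k%:R = k.-1%:R + 1 :> R by rewrite natr1 prednK// ltnW.
  have [||j [jle _ aj]] := grid k.-1; [by rewrite -ltnS prednK// ltnW| |].
    by apply: leq_trans kK; rewrite prednK// ltnW.
  have kh : k.-1%:R * h + h <= t by apply: le_trans kht; rewrite kE mulrDl mul1r.
  have s2 : t <= k.-1%:R * h + 2 * h by move: thk; rewrite kE !mulrDl; lra.
  have sp : 0 <= k.-1%:R * h by rewrite mulr_ge0// ltW.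
  have jt : j%:R <= t * n.+1%:R.
    by have := ler_wpM2l n0 kh; rewrite nS; lra.
  have s1 : k.-1%:R * h <= t by lra.
  have := interp_ge aS jt; have [_] := f2 _ t (introT andP (conj sp s1)) t1.
  by move: aj; rewrite ler_norml => /andP[]; lra.
have upper : interp a (t * n.+1%:R) <= f t + 5 * h.
  have [kk|kk] := leqP K k.+2.
    have tn : t * n.+1%:R <= n.+1%:R by rewrite ler_piMl.
    have := interp_le aS s0 tn; rewrite a1.
    have [||_] := f2 t 1; [by rewrite t0|by []|].
    have : h * K%:R <= h * k.+2%:R by rewrite ler_wpM2l ?(ltW h0)// ler_nat.
    by rewrite hK -addn2 natrD; lra.
  have [//|//|j [_ jge aj]] := grid k.+2.
  have kE : k.+2%:R = k%:R + 2 :> R by rewrite -natrD addn2.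
  have tj : t * n.+1%:R <= j%:R.
    rewrite kE in jge; have := ler_wpM2l n0 (ltW thk); rewrite nS.
    by rewrite !mulrDl !mulrDr in jge *; lra.
  have s1 : k.+2%:R * h <= 1.
    by rewrite [leRHS](_ : 1 = K%:R * h); [rewrite ler_wpM2r ?(ltW h0)// ler_nat ltnW|rewrite mulrC hK].
  have ts : t <= k.+2%:R * h by rewrite kE mulrDl; move: thk; rewrite mulrDl; lra.
  have := interp_le aS s0 tj; have [|//|_] := f2 t (k.+2%:R * h); first by rewrite t0.
  have : k.+2%:R * h <= t + 2 * h by rewrite kE mulrDl; lra.
  by move: aj; rewrite ler_norml => /andP[]; lra.
by rewrite ler_norml -/h; apply/andP; split; lra.
Qed.

Notation pt := (R * R)%type.

Lemma filter_under (r : R) (e : seq pt) : pairwise (@steeper R) e -> all (@ptpos R) e ->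
  [seq x <- e | under r x] = take (count (under r) e) e.
Proof.
elim: e => //= x e IHe /andP[xe pe] /andP[/andP[x1 x2] ae].
have [ux|nx] := boolP (under r x); first by rewrite /= IHe.
have nu y : y \in e -> ~~ under r y.
  move=> ye; have /allP/(_ y ye) := xe; have /allP/(_ y ye)/andP[y1 y2] := ae.
  move: nx; rewrite /under /steeper -!ltNge => rx xy.
  have h1 : r * x.1 * y.1 < x.2 * y.1 by rewrite ltr_pM2r.
  rewrite -(ltr_pM2r x1); have -> : r * y.1 * x.1 = r * x.1 * y.1 by ring.
  by rewrite (lt_trans h1)// [y.2 * _]mulrC.
rewrite (_ : [seq x <- e | under r x] = [::]); last by apply/eqP; rewrite -size_eq0 size_filter -leqn0 leqNgt -has_count; apply/hasPn.
by rewrite (_ : count _ e = 0%N)//; apply/eqP; rewrite -leqn0 leqNgt -has_count; apply/hasPn.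
Qed.

(** The edges of slope at most [r] form a prefix of a convex chain, ending at a corner. *)
Lemma sum_stat_chain n (v : n.-tuple pt) (r k al be : R) :
  convex_chain (increments v) -> let j := count (under r) (increments v) in
  \sum_(x <- increments v) stat n r k al be x =
  k * j%:R + n%:R * (al * (corner v j).1 + be * (corner v j).2).
Proof.
move=> /and3P[/andP[pe _] st _] j.
have jn : (j <= n)%N by rewrite -[leqRHS](size_tuple (increments v)) count_size.
rewrite /stat -big_mkcond -big_filter filter_under// -/j -edge_sum_take// edge_sum1E edge_sum2E.
rewrite big_split /= big_const_seq iter_addr_0 count_predT size_takel ?size_tuple// mulr_natr; congr (_ + _).
by rewrite !mulr_sumr -big_split /= mulr_sumr.
Qed.

Definition ratio (L : nat) (i : 'I_L) : R := i.+1%:R / (L - i)%:R.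

(** Index, abscissa and ordinate of a corner, each deviating to one side or the other. *)
Definition direction (c : bool * 'I_3) : R * R * R :=
  ((-1) ^+ c.1 * (c.2 == 0 :> nat)%:R, (-1) ^+ c.1 * (c.2 == 1%N :> nat)%:R,
   (-1) ^+ c.1 * (c.2 == 2%N :> nat)%:R).

Definition bad_chain n L (q : 'I_L * (bool * 'I_3)) : set (n.-tuple pt) :=
  let c := direction q.2 in
  @deviation R n (ratio q.1) c.1.1 c.1.2 c.2 (2 * L.+1%:R)^-1.

Lemma unif_dist_le (f g : R -> R) (c : R) : (forall t, 0 <= t <= 1 -> `|f t - g t| <= c) ->
  unif_dist f g <= c.
Proof.
move=> H; apply: ge_sup; first by exists `|f 0 - g 0|, 0; rewrite //= in_itv /= lexx ler01.
by move=> _ [t + <-]; rewrite /= in_itv /= => /H.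
Qed.

(** The corner where the slope of the edges passes [s / (1 - s)] has index close to [n s] and
    coordinates close to [(2 s - s^2, s^2)], and [Phi] maps this curve to the parabola. *)
Lemma chain_near_parabola N n L (u : 'I_N -> pt) (v : n.-tuple pt) : (2 * L.+1 <= n)%N ->
  convex_chain (increments v) -> vertex_seq u = ptB :: rcons v ptA ->
  (forall q : 'I_L * (bool * 'I_3), ~ bad_chain q (increments v)) ->
  unif_dist2 (Xn n u, Yn n u) (@Xlim R, @Ylim R) <= 10 / L.+1%:R.
Proof.
move=> Ln cv vE nb; set K := L.+1 in Ln *.
have n0 : (0 < n)%N by apply: leq_trans Ln.
have n0' : 0 < n%:R :> R by rewrite ltr0n.
have /convex_chainP[pe _] := cv.
have mono i : (corner v i).1 <= (corner v i.+1).1 /\ (corner v i).2 <= (corner v i.+1).2.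
  have [ni|ni] := ltnP n i; first by rewrite !corner_last ?size_tuple// leqW.
  have /andP[h1 h2] := pe i ni; move: h1 h2; rewrite /edge_of /=; lra.
have c0 : corner v 0 = 0 by rewrite corner0.
have c1 : corner v n.+1 = (1, 1) by rewrite corner_last// size_tuple.
have sim : simplex (increments v) by case/and3P: cv.
have K0 : 0 < K%:R :> R by rewrite ltr0n.
have grid k : (0 < k < K)%N -> exists j : nat, let s : R := k%:R / K%:R in
    [/\ `|j%:R - n%:R * s : R| <= n%:R / (2 * K%:R),
     `|(corner v j).1 - (2 * s - s ^+ 2)| <= (2 * K%:R)^-1 &
     `|(corner v j).2 - s ^+ 2| <= (2 * K%:R)^-1].
  move=> /andP[k0 kK].
  have kL : (k.-1 < L)%N by rewrite prednK.
  pose i := Ordinal kL; pose r := ratio i.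
  have LK : (L - k.-1)%:R = K%:R - k%:R :> R.
    by rewrite -(natrB R (ltnW kK)) /K -[in RHS](prednK k0) subSS.
  have kK' : k%:R < K%:R :> R by rewrite ltr_nat.
  have rE : r = k%:R / (K%:R - k%:R) by rewrite /r /ratio /= prednK// LK.
  have sE : r / (1 + r) = k%:R / K%:R.
    by rewrite rE; field; rewrite !gt_eqF ?subr_gt0// addrCA subrr addr0.
  have s1E : 1 / (1 + r) = 1 - k%:R / K%:R.
    by rewrite rE; field; rewrite !gt_eqF ?subr_gt0// addrCA subrr addr0.
  set s := k%:R / K%:R in sE s1E *.
  set e := (2 * K%:R)^-1.
  pose j := count (under r) (increments v); exists j => /=.
  have meanE (a b c : R) : stat_mean r a b c = a * s + b * (2 * s - s ^+ 2) + c * s ^+ 2.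
    rewrite /stat_mean /= sE [_ / (1 + r)](_ : _ = b * (1 / (1 + r)) + c * (r / (1 + r))).
      by rewrite sE s1E; ring.
    by rewrite !mulrDl; ring.
  have bound c : let q := direction c in
      q.1.1 * j%:R + n%:R * (q.1.2 * (corner v j).1 + q.2 * (corner v j).2) <
      n%:R * (q.1.1 * s + q.1.2 * (2 * s - s ^+ 2) + q.2 * s ^+ 2 + e).
    move=> q; rewrite ltNge; apply/negP => H; apply: (nb (i, c)); split => //=.
    by rewrite -/r -/q -/K -/e sum_stat_chain// meanE.
  have cancel (x y : R) : n%:R * x < n%:R * (y + e) -> x - y <= e.
    by rewrite ltr_pM2l//; lra.
  have B (b : bool) (m : 'I_3) := bound (b, m).
  pose o2 : 'I_3 := inord 2; have o2E : o2 = 2%N :> nat by rewrite inordK.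
  pose o1 : 'I_3 := inord 1; have o1E : o1 = 1%N :> nat by rewrite inordK.
  split; rewrite ler_norml; apply/andP; split.
  - have := B true ord0; rewrite /direction /= expr1 !mulr1 !mulr0 !mul0r !addr0 mulr0 addr0 -/e.
    lra.
  - have := B false ord0; rewrite /direction /= expr0 !mulr1 !mulr0 !mul0r !addr0 mulr0 addr0 -/e !mul1r.
    lra.
  - have := B true o1; rewrite /direction /= o1E /= expr1 !mulr1 !mulr0 !mul0r !addr0 !add0r.
    by move=> /cancel; lra.
  - have := B false o1; rewrite /direction /= o1E /= expr0 !mulr1 !mulr0 !mul0r !addr0 !add0r.
    by move=> /cancel; lra.
  - have := B true o2; rewrite /direction /= o2E /= expr1 !mulr1 !mulr0 !mul0r !add0r.
    by move=> /cancel; lra.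
  - have := B false o2; rewrite /direction /= o2E /= expr0 !mulr1 !mulr0 !mul0r !add0r.
    by move=> /cancel; lra.
pose f1 (t : R) := 2 * t - t ^+ 2; pose f2 (t : R) := t ^+ 2.
have A1 := @interp_grid (fun i => (corner v i).1) f1 n K isT Ln.
have A2 := @interp_grid (fun i => (corner v i).2) f2 n K isT Ln.
have {}A1 t : 0 <= t <= 1 -> `|interp (fun i => (corner v i).1) (t * n.+1%:R) - f1 t| <= 5 / K%:R.
  apply: A1 => [i|a b /andP[a0 ab] b1| | |k /grid[j [? ? ?]]].
  - by have [] := mono i.
  - by rewrite /f1; apply/andP; split; nra.
  - by rewrite c0 /f1 /=; ring.
  - by rewrite c1 /f1 /=; ring.
  - by exists j.
have {}A2 t : 0 <= t <= 1 -> `|interp (fun i => (corner v i).2) (t * n.+1%:R) - f2 t| <= 5 / K%:R.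
  apply: A2 => [i|a b /andP[a0 ab] b1| | |k /grid[j [? ? ?]]].
  - by have [] := mono i.
  - by rewrite /f2; apply/andP; split; nra.
  - by rewrite c0 /f2 /= expr0n.
  - by rewrite c1 /f2 /= expr1n.
  - by exists j.
have vtx i : nth (0, 0) (vertex_seq u) i = Phi (corner v i).
  rewrite vE /corner Phi_invK; case: i => //= i.
  rewrite nth_rcons; case: ltnP => iv; first by apply: set_nth_default.
  by rewrite [RHS]nth_default//; case: eqP.
have K10 : 10 / K%:R = 5 / K%:R + 5 / K%:R :> R by field; rewrite gt_eqF.
rewrite /unif_dist2 ge_max; apply/andP; split; apply: unif_dist_le => t t01 /=.
  have -> : Xn n u t - Xlim t = - (interp (fun i => (corner v i).1) (t * n.+1%:R) - f1 t)
     - (interp (fun i => (corner v i).2) (t * n.+1%:R) - f2 t).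
    by rewrite /Xn /interp !vtx /Phi /= /Xlim /f1 /f2; ring.
  by apply: le_trans (ler_normB _ _) _; rewrite normrN K10 lerD ?A1 ?A2.
have -> : Yn n u t - Ylim t = (interp (fun i => (corner v i).1) (t * n.+1%:R) - f1 t)
     - (interp (fun i => (corner v i).2) (t * n.+1%:R) - f2 t).
  by rewrite /Yn /interp !vtx /Phi /= /Ylim /f1 /f2; ring.
by apply: le_trans (ler_normB _ _) _; rewrite K10 lerD ?A1 ?A2.
Qed.

End interpolation.

(** * The triangle: areas, corners, Hausdorff distance *)

Section triangle_measure.
Local Open Scope ereal_scope.
Context (R : realType).
Notation pt := (R * R)%type.
Notation plane := (@plane R).
Notation triangle := (@triangle R).

Let m1 : measurable_fun setT (fun p : pt => p.1).
Proof. exact: measurable_fst. Qed.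
Let m2 : measurable_fun setT (fun p : pt => p.2).
Proof. exact: measurable_snd. Qed.

(** The open triangle with the base of [triangle] and height [c]. *)
Definition tent (c : R) : set pt :=
  [set p | [/\ 0 < p.2, p.2 < c * p.1 & p.2 < c * (2 - p.1)]%R].

Lemma measurable_tent c : measurable (tent c).
Proof.
rewrite (_ : tent c = [set p : pt | 0 < p.2]%R `&` ([set p : pt | p.2 < c * p.1]%R `&` [set p : pt | p.2 < c * (2 - p.1)]%R)).
  apply: measurableI; first exact: measurable_set_lt.
  apply: measurableI; apply: measurable_set_lt => //; apply: measurable_funM => //.
  exact: measurable_funB.
by apply/seteqP; split=> p /=; [case=> ? ? ?|case=> ? []].
Qed.

Lemma measurable_triangle : measurable triangle.
Proof.
rewrite (_ : triangle = [set p : pt | 0 <= p.2]%R `&` ([set p : pt | p.2 <= p.1]%R `&` [set p : pt | p.1 + p.2 <= 2]%R)).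
  apply: measurableI; first exact: measurable_set_le.
  apply: measurableI; apply: measurable_set_le => //; exact: measurable_funD.
by apply/seteqP; split=> p /=; [move/triangleP => [? ? ?]|move=> [? [? ?]]; apply/triangleP].
Qed.

Lemma tent_sub_triangle c : (c <= 1)%R -> tent c `<=` triangle.
Proof.
move=> c1 p [p0 p1 p2]; apply/triangleP.
have [x0|x0] := lerP p.1 0.
  have : (c * p.1 <= 1 * p.1 \/ c <= 0)%R by have [c0|c0] := lerP c 0; [right|left; nra].
  split; nra.
have [x2|x2] := lerP (2 - p.1) 0; split; nra.
Qed.

Lemma rect_plane (a b c d : R) : (a <= b)%R -> (c <= d)%R ->
  plane (`[a, b] `*` `[c, d]) = ((b - a) * (d - c))%:E.
Proof.
have lebE (x y : R) : (x <= y)%R -> leb `[x, y]%classic = (y - x)%:E.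
  move=> xy; rewrite -[LHS]/(lebesgue_measure `[x, y]%classic) lebesgue_measure_itv /= lte_fin.
  move: xy; rewrite le_eqVlt => /predU1P[->|xy]; first by rewrite ltxx subrr.
  by rewrite xy EFinB.
by move=> ab cd; rewrite plane_rect// !lebE// EFinM.
Qed.

Lemma plane_triangle_gt0 : 0 < plane triangle.
Proof.
pose rect : set pt := (`[3/4, 5/4]%classic `*` `[0, 1/2]%classic)%R.
have mr : measurable rect by exact: measurableX.
suff H : plane rect <= plane triangle.
  by apply: lt_le_trans H; rewrite rect_plane ?lte_fin; lra.
apply: le_measure; rewrite ?inE//; first exact: measurable_triangle.
by move=> p [/=]; rewrite !in_itv /= => /andP[? ?] /andP[? ?]; apply/triangleP; split; lra.
Qed.

Lemma plane_triangle_lty : plane triangle < +oo.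
Proof.
pose rect : set pt := (`[0, 2]%classic `*` `[0, 1]%classic)%R.
have mr : measurable rect by exact: measurableX.
suff H : plane triangle <= plane rect by apply: le_lt_trans H _; rewrite rect_plane ?ltry.
apply: le_measure; rewrite ?inE//; first exact: measurable_triangle.
by move=> p /triangleP[? ? ?]; split; rewrite /= in_itv /=; apply/andP; split; lra.
Qed.

Definition side_lines : set pt := [set p : pt | 0 * p.1 + 1 * p.2 == 0]%R `|`
  ([set p : pt | -1 * p.1 + 1 * p.2 == 0]%R `|` [set p : pt | 1 * p.1 + 1 * p.2 == 2]%R).

Lemma measurable_line (a b c : R) : measurable [set p : pt | a * p.1 + b * p.2 == c]%R.
Proof. by apply: measurable_set_eq => //; apply: measurable_funD; exact: measurable_funM. Qed.

Lemma measurable_side_lines : measurable side_lines.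
Proof. by do 2 (apply: measurableU; first exact: measurable_line); exact: measurable_line. Qed.

Lemma plane_side_lines : plane side_lines = 0.
Proof.
apply/eqP; rewrite -measure_le0.
have mL (a b c : R) := measurable_line a b c.
apply: le_trans (measureU2 _ _ _) _ => //; first exact: measurableU.
have le0 (x : \bar R) : x = 0 -> x <= 0 by move=> ->.
rewrite -[leRHS]adde0; apply: leeD; first exact: (le0 _ (plane_line0 _ _ (oner_neq0 R))).
apply: le_trans (measureU2 _ _ _) _ => //.
rewrite -[leRHS]adde0; apply: leeD; exact: (le0 _ (plane_line0 _ _ (oner_neq0 R))).
Qed.

Lemma triangle_tent : triangle `<=` tent 1 `|` side_lines.
Proof.
move=> p /triangleP[h1 h2 h3].
have [e1|e1] := eqVneq p.2 0%R; first by right; left => /=; apply/eqP; lra.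
have [e2|e2] := eqVneq p.2 p.1; first by right; right; left => /=; apply/eqP; lra.
have [e3|e3] := eqVneq p.2 (2 - p.1)%R; first by right; right; right => /=; apply/eqP; lra.
by left; split; rewrite ?mul1r lt_neqAle ?e2 ?e3 1?eq_sym ?e1//=; lra.
Qed.

Lemma plane_tent1 : plane (tent 1) = plane triangle.
Proof.
apply/eqP; rewrite eq_le; apply/andP; split.
  by apply: le_measure; rewrite ?inE; [exact: measurable_tent|exact: measurable_triangle|exact: tent_sub_triangle].
apply: (@le_trans _ _ (plane (tent 1 `|` side_lines))).
  apply: le_measure; rewrite ?inE; [exact: measurable_triangle| |exact: triangle_tent].
  by apply: measurableU; [exact: measurable_tent|exact: measurable_side_lines].
apply: le_trans (measureU2 _ _ _) _; [exact: measurable_tent|exact: measurable_side_lines|].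
have le0 (x : \bar R) : x = 0 -> x <= 0 by move=> ->.
by rewrite -[leRHS]adde0; apply: leeD => //; exact: (le0 _ plane_side_lines).
Qed.

Lemma plane_tent c : (0 < c)%R -> plane (tent c) = c%:E * plane triangle.
Proof.
move=> c0; rewrite (@plane_diag R (0, 0)%R (1, c)%R (tent c)) ?oner_eq0 ?gt_eqF//=; last exact: measurable_tent.
rewrite mul1r gtr0_norm// -plane_tent1; congr (_ * plane _).
apply/seteqP; split=> -[x y]; rewrite /tent /= !add0r !mul1r pmulr_rgt0// !ltr_pM2l//.
Qed.

Notation share := (@share R triangle).

Lemma fine_triangle_gt0 : (0 < fine (plane triangle))%R.
Proof. by apply: fine_gt0; rewrite plane_triangle_gt0 plane_triangle_lty. Qed.

Lemma share_tent c : (0 < c)%R -> (c <= 1)%R -> share (tent c) = c.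
Proof.
move=> c0 c1; rewrite /share (setIidl (tent_sub_triangle c1)) plane_tent//.
rewrite fineM// ?ge0_fin_numE ?plane_triangle_lty//= mulfK// gt_eqF//; exact: fine_triangle_gt0.
Qed.

Definition far_from (q : 'I_3) (eps : R) : set pt := [set p | eps <= eucl_dist p (corners R q)]%R.

Lemma measurable_far q eps : measurable (far_from q eps).
Proof. exact: measurable_eucl_ge. Qed.

Lemma share_setC (A : set pt) : measurable A ->
  (fine (plane (A `&` triangle)) + fine (plane (~` A `&` triangle)) = fine (plane triangle))%R.
Proof.
move=> mA; have mT := measurable_triangle.
have fin B : measurable B -> plane (B `&` triangle) \is a fin_num.
  by move=> mB; exact: (plane_sub_fin mT plane_triangle_lty).
rewrite -fineD ?fin//; last exact: measurableC.
rewrite -measureU; last by rewrite setIACA setICr set0I.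
- by rewrite -setIUl setUCr setTI.
- exact: measurableI.
- by apply: measurableI => //; exact: measurableC.
Qed.

(** Near each corner the triangle contains a small rectangle. *)
Lemma share_far q eps : (0 < eps)%R -> (share (far_from q eps) < 1)%R.
Proof.
move=> e0; pose h : R := (Num.min 8^-1 (eps / 8))%R.
have h0 : (0 < h)%R by rewrite lt_min invr_gt0 ltr0n divr_gt0.
have h1 : (h <= 8^-1)%R by rewrite ge_min lexx.
have h2 : (h <= eps / 8)%R by rewrite ge_min lexx orbT.
have mF := measurable_far q eps.
rewrite /share ltr_pdivrMr ?fine_triangle_gt0// mul1r -(share_setC mF) ltrDl.
have near_corner (a b c d : R) : (a < b)%R -> (c < d)%R ->
    (forall p : pt, a <= p.1 <= b -> c <= p.2 <= d -> triangle p /\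
      `|p.1 - (corners R q).1| + `|p.2 - (corners R q).2| < eps)%R ->
    (0 < fine (plane (~` far_from q eps `&` triangle)))%R.
  move=> ab cd H; have mr : measurable (`[a, b]%classic `*` `[c, d]%classic : set pt)%R by exact: measurableX.
  have mC : measurable (~` far_from q eps `&` triangle).
    by apply: measurableI; [exact: measurableC|exact: measurable_triangle].
  apply: fine_gt0; apply/andP; split; last first.
    apply: le_lt_trans plane_triangle_lty.
    by apply: le_measure; rewrite ?inE//; exact: measurable_triangle.
  suff le1 : plane (`[a, b]%classic `*` `[c, d]%classic) <= plane (~` far_from q eps `&` triangle).
    by apply: lt_le_trans le1; rewrite rect_plane ?ltW// lte_fin mulr_gt0// subr_gt0.
  apply: le_measure; rewrite ?inE// => p [/=]; rewrite !in_itv /= => pa pc.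
  have [tp d1] := H p pa pc; split=> //; rewrite /far_from /=.
  by apply/negP; rewrite -ltNge; apply: le_lt_trans d1; exact: eucl_le_sum.
have bd (x y : R) : (`|x| <= y)%R = (- y <= x <= y)%R by rewrite ler_norml.
have fin (p c : pt) : (`|p.1 - c.1| <= 3 * h)%R -> (`|p.2 - c.2| <= 3 * h)%R ->
    (`|p.1 - c.1| + `|p.2 - c.2| < eps)%R by lra.
have : [|| q == 0%N :> nat, q == 1%N :> nat | q == 2%N :> nat].
  by move: (ltn_ord q); move: (nat_of_ord q) => -[|[|[]]].
case/or3P => /eqP qE.
- have cE : corners R q = ptA by rewrite /corners (tnth_nth 0%R) qE.
  apply: (near_corner (2 * h) (3 * h) 0 h)%R; [lra|lra|] => p /andP[? ?] /andP[? ?].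
  split; first by apply/triangleP; split; lra.
  by apply: fin; rewrite cE /ptA /= bd; apply/andP; split; lra.
- have cE : corners R q = ptB by rewrite /corners (tnth_nth 0%R) qE.
  apply: (near_corner (2 - 3 * h) (2 - 2 * h) 0 h)%R; [lra|lra|] => p /andP[? ?] /andP[? ?].
  split; first by apply/triangleP; split; lra.
  by apply: fin; rewrite cE /ptB /= bd; apply/andP; split; lra.
- have cE : corners R q = ptC by rewrite /corners (tnth_nth 0%R) qE.
  apply: (near_corner (1 - h) (1 + h) (1 - 3 * h) (1 - 2 * h))%R; [lra|lra|] => p /andP[? ?] /andP[? ?].
  split; first by apply/triangleP; split; lra.
  by apply: fin; rewrite cE /ptC /= bd; apply/andP; split; lra.
Qed.

Lemma not_inner_null (p : pt) : triangle p -> ~ inner p -> side_lines p.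
Proof.
move=> tp ni; have [[h1 h2 h3]|//] := triangle_tent tp.
by exfalso; apply: ni; split; lra.
Qed.

End triangle_measure.

Section hausdorff_bound.
Context (R : realType).
Notation pt := (R * R)%type.

Lemma eucl_convex (p q p' q' : pt) (t : R) : 0 <= t -> t <= 1 ->
  eucl_dist (t *: p + (1 - t) *: q) (t *: p' + (1 - t) *: q') <=
  t * eucl_dist p p' + (1 - t) * eucl_dist q q'.
Proof.
move=> t0 t1.
have scale (x y z : pt) (s : R) : 0 <= s -> eucl_dist (s *: x + z) (s *: y + z) <= s * eucl_dist x y.
  move=> s0; rewrite eucl_le ?mulr_ge0 ?eucl_ge0// exprMn eucl_sqr.
  by rewrite -[(s *: x + z).1]/(s * x.1 + z.1) -[(s *: y + z).1]/(s * y.1 + z.1)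
    -[(s *: x + z).2]/(s * x.2 + z.2) -[(s *: y + z).2]/(s * y.2 + z.2); nra.
apply: le_trans (eucl_triangle _ (t *: p' + (1 - t) *: q) _) _.
apply: lerD; first exact: scale.
by rewrite ![t *: p' + _]addrC; apply: scale; rewrite subr_ge0.
Qed.

(** The [eps]-neighbourhood of a convex set is convex, so it contains the triangle
    as soon as it contains the three corners. *)
Lemma hausdorff_le N (u : 'I_N -> pt) (eps : R) : 0 < eps -> (forall i, triangle (u i)) ->
  (forall q : 'I_3, exists j, eucl_dist (u j) (corners R q) < eps) ->
  hausdorff_dist (hull (range u)) triangle <= eps.
Proof.
move=> e0 tu near.
have [j0 _] := near ord0.
have sub : hull (range u) `<=` triangle.
  by apply: hull_least; [exact: hull_convex|move=> _ [i _ <-]].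
have eucl0 (p : pt) : eucl_dist p p = 0.
  by apply/eqP; rewrite eq_le eucl_ge0 andbT eucl_le// !subrr expr0n addr0.
have hu : hull (range u) (u j0) by apply: sub_hull; exists j0.
rewrite /hausdorff_dist ge_max; apply/andP; split; apply: ge_sup.
- by exists (dist_to_set (u j0) triangle), (u j0).
- move=> _ [p /sub tp <-]; apply: le_trans (dist_to_set_le p tp) _.
  by rewrite eucl0 ltW.
- by exists (dist_to_set (u j0) (hull (range u))), (u j0).
move=> _ [q tq <-].
pose K : set pt := [set q | exists p, hull (range u) p /\ eucl_dist q p <= eps].
have : K q.
  move: tq; rewrite triangle_corners; apply: hull_least.
    move=> a b t [a' [ha da]] [b' [hb db]] t0 t1.
    exists (t *: a' + (1 - t) *: b'); split; first exact: hull_convex.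
    apply: le_trans (eucl_convex _ _ _ _ t0 t1) _.
    have t1' : 0 <= 1 - t by rewrite subr_ge0.
    by have h1 := ler_wpM2l t0 da; have h2 := ler_wpM2l t1' db; lra.
  move=> _ [i _ <-]; have [j dj] := near i; exists (u j); split.
    by apply: sub_hull; exists j.
  by rewrite eucl_sym ltW.
by move=> [p [hp dp]]; apply: le_trans dp; exact: dist_to_set_le.
Qed.

End hausdorff_bound.

(** * Chains inside the triangle, and points below them *)

Section chains_in_triangle.
Context (R : realType).
Notation pt := (R * R)%type.

Lemma corner_rest (v : seq pt) k : (k <= (size v).+1)%N ->
  (1, 1) - corner v k = \sum_(k <= j < (size v).+1) edge_of v j.
Proof. by move=> kn; rewrite telescope_sumr// (@corner_last _ v (size v).+1). Qed.

(** Every edge before a corner is gentler than every edge after it; summing this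
    over all pairs of such edges gives the middle inequality. *)
Lemma corner_below_diagonal n (v : n.-tuple pt) k : chain_edges v n -> (k <= n.+1)%N ->
  [/\ 0 <= (corner v k).2, (corner v k).2 <= (corner v k).1 & (corner v k).1 <= 1].
Proof.
move=> [pe se] kn.
have sum1 := corner_sum v k.
have := @corner_rest v k; rewrite size_tuple => /(_ kn) sum2.
have c1 : (corner v k).1 = \sum_(i < k) (edge_of v i).1 by rewrite sum1 fst_sum.
have c2 : (corner v k).2 = \sum_(i < k) (edge_of v i).2 by rewrite sum1 snd_sum.
have d1 : 1 - (corner v k).1 = \sum_(k <= j < n.+1) (edge_of v j).1 by rewrite -fst_sum -sum2.
have d2 : 1 - (corner v k).2 = \sum_(k <= j < n.+1) (edge_of v j).2 by rewrite -snd_sum -sum2.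
have pos j : (j < n.+1)%N -> 0 < (edge_of v j).1 /\ 0 < (edge_of v j).2.
  by move=> jn; have /andP[] := pe j jn.
have c2_ge0 : 0 <= (corner v k).2.
  by rewrite c2 sumr_ge0// => i _; have [] := pos i (leq_trans (ltn_ord i) kn); move=> _ /ltW.
have d1_ge0 : 0 <= 1 - (corner v k).1.
  rewrite d1 big_nat_cond sumr_ge0// => j /andP[/andP[_ jn] _].
  by have [/ltW] := pos j jn.
suff : (corner v k).2 * (1 - (corner v k).1) <= (corner v k).1 * (1 - (corner v k).2) by split; lra.
rewrite d1 d2 c1 c2 !big_distrlr /=; apply: ler_sum => i _.
rewrite big_nat_cond [leRHS]big_nat_cond; apply: ler_sum => j /andP[/andP[kj jn] _].
by apply: ltW; exact: se (leq_trans (ltn_ord i) kj) jn.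
Qed.

Lemma chain_in_triangle n (e : n.-tuple pt) i : convex_chain e ->
  triangle (tnth (chain_pts 0 e) i).
Proof.
set v := chain_pts 0 e; rewrite -(chain_ptsK e) -/v => /convex_chainP ce.
have [h1 h2 h3] := corner_below_diagonal ce (leqW (ltn_ord i)).
have -> : tnth v i = Phi (corner v i.+1) by rewrite /corner Phi_invK /= -tnth_nth.
by move: (corner v i.+1) h1 h2 h3 => p h1 h2 h3; apply/triangleP; rewrite /Phi /=; split; lra.
Qed.

(** For a convex chain, the corner where the slope of the edges passes [1]; the formula
    makes sense for unsorted edges and does not depend on their order. *)
Definition under_vertex (e : seq pt) : pt := \sum_(x <- e | under 1 x) x.

(** In terms of [under_vertex], the roof over [ptA], [ptB] and this corner covers [tent c]. *)
Definition high (c : R) (e : seq pt) : Prop := let V := under_vertex e in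
  c * (2 - V.1 - V.2) <= V.1 - V.2 /\ c * (V.1 + V.2) <= V.1 - V.2.

Lemma under_vertex_perm (s s' : seq pt) : perm_eq s s' -> under_vertex s = under_vertex s'.
Proof. by move=> ss; exact: perm_big. Qed.

Lemma measurable_under_vertex n : measurable_fun setT (fun e : n.-tuple pt => under_vertex e).
Proof.
rewrite (_ : (fun _ => _) = fun e : n.-tuple pt => (\sum_(x <- e) (if under 1 x then x.1 else 0),
    \sum_(x <- e) (if under 1 x then x.2 else 0))).
  apply: measurable_fun_pair; apply: measurable_sum_stat; apply: measurable_fun_ifT => //;
    by [exact: measurable_under|exact: measurable_fst|exact: measurable_snd].
apply/funext => e; rewrite [LHS]surjective_pairing /under_vertex fst_sum snd_sum.
by congr pair; rewrite big_mkcond.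
Qed.

Lemma measurable_high n c : measurable [set e : n.-tuple pt | high c e].
Proof.
have mV := @measurable_under_vertex n.
have mV1 : measurable_fun setT (fun e : n.-tuple pt => (under_vertex e).1) by exact: measurableT_comp.
have mV2 : measurable_fun setT (fun e : n.-tuple pt => (under_vertex e).2) by exact: measurableT_comp.
apply: measurableI; apply: measurable_set_le; do ?exact: measurable_funB.
  by apply: measurable_funM => //; apply: measurable_funB => //; exact: measurable_funB.
by apply: measurable_funM => //; exact: measurable_funD.
Qed.

Lemma below_roof (v : seq pt) V c p : V \in v -> 0 < c -> c * V.1 <= V.2 -> c * (2 - V.1) <= V.2 ->
  tent c p -> below_chain v p.
Proof.
move=> Vv c0 cV1 cV2 [p0 pc1 pc2].
have x0 : 0 < p.1 by have := lt_trans p0 pc1; rewrite pmulr_rgt0.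
have x2 : 0 < 2 - p.1 by have := lt_trans p0 pc2; rewrite pmulr_rgt0.
split=> //; first by apply/andP; split; lra.
have cH := hull_convex (S := [set ptA; ptB; V]).
have HA : hull [set ptA; ptB; V] ptA by apply: sub_hull; left; left.
have HB : hull [set ptA; ptB; V] ptB by apply: sub_hull; left; right.
have HV : hull [set ptA; ptB; V] V by apply: sub_hull; right.
exists V; have [pV|pV] := lerP p.1 V.1.
  have V0 : 0 < V.1 by lra.
  have t1 : p.1 / V.1 <= 1 by rewrite ler_pdivrMr// mul1r.
  exists (p.1 / V.1 * V.2); split=> //.
    apply: lt_le_trans pc1 _; rewrite [leRHS]mulrAC ler_pdivlMr//.
    by rewrite -mulrA [_ * V.1]mulrC mulrA [p.1 * _]mulrC ler_pM2r.
  have := cH _ _ _ HV HA (ltW (divr_gt0 x0 V0)) t1.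
  by rewrite convE /ptA /= !mulr0 !addr0 divfK// gt_eqF.
have V2 : 0 < 2 - V.1 by lra.
have t1 : (2 - p.1) / (2 - V.1) <= 1 by rewrite ler_pdivrMr// mul1r; lra.
exists ((2 - p.1) / (2 - V.1) * V.2); split=> //.
  apply: lt_le_trans pc2 _; rewrite [leRHS]mulrAC ler_pdivlMr//.
  by rewrite -mulrA [_ * (2 - V.1)]mulrC mulrA [(2 - p.1) * _]mulrC ler_pM2r.
have := cH _ _ _ HV HB (ltW (divr_gt0 x2 V2)) t1.
rewrite convE /ptB /= mulr0 addr0; congr (hull _ (_, _)).
by field; rewrite gt_eqF.
Qed.

Lemma high_below n (v : n.-tuple pt) c p : 0 < c -> convex_chain (increments v) ->
  high c (increments v) -> tent c p -> below_chain v p.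
Proof.
move=> c0 cv; have /and3P[/andP[pe _] st _] := cv.
pose j := count (under 1) (increments v).
have jn : (j <= n)%N by rewrite -[leqRHS](size_tuple (increments v)) count_size.
have VE : under_vertex (increments v) = corner v j.
  by rewrite /under_vertex -big_filter filter_under// -/j -edge_sum_take.
rewrite /high VE; case: (posnP j) => [->|j0] [h1 h2].
  by exfalso; move: h1; rewrite corner0 /=; lra.
set W := nth ptA (ptB :: v) j.
have cE : corner v j = Phi_inv W by [].
have WE : Phi (corner v j) = W by rewrite cE Phi_invK.
have W1 : W.1 = 2 - (corner v j).1 - (corner v j).2 by rewrite -WE.
have W2 : W.2 = (corner v j).1 - (corner v j).2 by rewrite -WE.
apply: (@below_roof v W) => //.
- rewrite /W -(prednK j0) /=; apply: mem_nth; rewrite size_tuple prednK//.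
- by rewrite W1 W2; exact: h1.
- by rewrite W1 W2 (_ : 2 - _ = (corner v j).1 + (corner v j).2); [exact: h2|ring].
Qed.

End chains_in_triangle.

(** * Probabilities of configurations with a given number of vertices *)

Section probability_bounds.
Local Open Scope ereal_scope.
Context (R : realType) d (T : measurableType d) (P : probability T R) (N : nat).
Notation pt := (R * R)%type.
Notation plane := (@plane R).
Notation triangle := (@triangle R).
Notation share := (@share R triangle).
Variables (U : 'I_N -> {RV P >-> pt}).
Hypothesis hU : iid_uniform_triangle U.

Let indU := hU.1.
Let unifU := hU.2.
Let mT := @measurable_triangle R.
Let T0 := @plane_triangle_gt0 R.
Let Ty := @plane_triangle_lty R.

Definition conf (w : T) (i : 'I_N) : pt := U i w.

(** The exceptional configurations put a point on a side, or two points on a vertical line. *)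
Lemma almost_surely_generic : exists Z : set T, [/\ measurable Z, P Z = 0 &
  forall w, ~ Z w -> generic (conf w)].
Proof.
pose A (x : 'I_N + 'I_N + 'I_N * 'I_N) : set T := match x with
  | inl (inl i) => U i @^-1` (~` triangle)
  | inl (inr i) => U i @^-1` (@side_lines R)
  | inr ij => if ij.1 == ij.2 then set0 else [set w | (U ij.1 w).1 == (U ij.2 w).1]
  end.
have mA x : measurable (A x).
  case: x => [[i|i]|[i j]] /=.
  - by apply: (measurable_funPTI (U i)); exact: measurableC.
  - apply: (measurable_funPTI (U i)); exact: measurable_side_lines.
  - case: eqP => // _; apply: measurable_set_eq; apply: measurableT_comp => //.
have A0 x : P (A x) = 0.
  case: x => [[i|i]|[i j]] /=.
  - rewrite (prob_share mT T0 Ty unifU)//; last exact: measurableC.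
    by rewrite /share setICl measure0 mul0r.
  - apply: (prob_null mT T0 Ty unifU); first exact: measurable_side_lines.
    exact: plane_side_lines.
  - case: eqVneq => [_|ij]; first exact: measure0.
    exact: (prob_same_abscissa mT T0 Ty indU unifU).
exists [set w | exists x, A x w]; split.
- exact: measurable_exists.
- apply/eqP; rewrite -measure_le0.
  apply: le_trans (measure_le_sum P _ mA _) _; [exact: measurable_exists|by []|].
  by rewrite big1 => // x _; exact: A0.
move=> w nA; split=> [i|i j ij].
  have ti : triangle (conf w i) by apply: contrapT => nt; apply: nA; exists (inl (inl i)).
  apply: contrapT => ni; apply: nA; exists (inl (inr i)); exact: not_inner_null.
apply/eqP; apply: contrapT => /negP ij'; apply: nA; exists (inr (i, j)) => /=.
by rewrite (negPf ij'); apply/eqP.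
Qed.

Lemma measurable_conf i : measurable_fun setT (fun w => conf w i).
Proof. exact: measurable_funPT. Qed.

Variable n : nat.
Definition injection := {s : {ffun 'I_n -> 'I_N} | injectiveb s}.
Definition mk_injection (s : {ffun 'I_n -> 'I_N}) (s_inj : injectiveb s) : injection :=
  exist _ s s_inj.
Definition selections : R := #|{: injection}|%:R.
(** Common to the upper and the lower bound, so that it disappears from conditional probabilities. *)
Definition prefactor : R := (selections * (2 / fine (plane triangle)) ^+ n / (n`!)%:R)%R.
Definition n_vertices : set T := [set w | vertex_count (conf w) = n].

Lemma measurable_n_vertices : measurable n_vertices.
Proof. exact: (measurable_vertex_count measurable_conf). Qed.

Lemma prefactor_gt0 : (n <= N)%N -> (0 < prefactor)%R.
Proof.
move=> nN; rewrite /prefactor divr_gt0 ?ltr0n ?fact_gt0// mulr_gt0//.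
  rewrite /selections ltr0n; apply/card_gt0P.
  have inj : injectiveb [ffun i : 'I_n => widen_ord nN i].
    by apply/injectiveP => i j; rewrite !ffunE => /(congr1 val) /= /val_inj.
  by exists (mk_injection inj).
by rewrite exprn_gt0// divr_gt0// fine_triangle_gt0.
Qed.

Definition chain_event (s : injection) (B : set (n.-tuple pt)) (D : set pt) : set T :=
  [set w | ([set e : n.-tuple pt | convex_chain e] `&` B) (increments (selected U (val s) w))] `&`
  others_in U (val s) D.

Lemma measurable_convex_chain : measurable [set e : n.-tuple pt | convex_chain e].
Proof.
rewrite (_ : mkset _ = [set e : n.-tuple pt | simplex e] `&`
   ([set e : n.-tuple pt | pairwise (@steeper R) e] `&` @last_steepest R n)).
  apply: measurableI; first exact: measurable_simplex.
  by apply: measurableI; [exact: measurable_pairwise_steeper|exact: measurable_last_steepest].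
by apply/seteqP; split=> e /=; [move/and3P => [? ? ?]|move=> [? [? ?]]; apply/and3P].
Qed.

Lemma measurable_chain_event s B D : measurable B -> measurable D -> measurable (chain_event s B D).
Proof.
move=> mB mD; apply: measurableI; last exact: measurable_others_in.
have m1 := measurableT_comp (@measurable_increments R n) (measurable_selected U (val s)).
have := m1 measurableT _ (measurableI _ _ measurable_convex_chain mB).
by rewrite setTI.
Qed.

Lemma prob_chain_event s B D : measurable B -> measurable D ->
  P (chain_event s B D) = ((2 / fine (plane triangle)) ^+ n * share D ^+ (N - n))%:E *
    powm plane n ([set e : n.-tuple pt | convex_chain e] `&` B).
Proof.
move=> mB mD; have sI : injective (val s) by apply/injectiveP; exact: (valP s).
rewrite /chain_event (law_increments mT T0 Ty indU unifU sI)//.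
- by apply: measurableI => //; exact: measurable_convex_chain.
- by move=> e [ce _] i; exact: chain_in_triangle.
Qed.

Section upper_bound.
Variables (Q : finType) (B : Q -> set (n.-tuple pt)) (D : Q -> set pt) (x : Q -> R) (E : set T).
Hypothesis mB : forall q, measurable (B q).
Hypothesis Bperm : forall q (t : 'S_n) e, B q e -> B q (permt t e).
Hypothesis mD : forall q, measurable (D q).
Hypothesis mE : measurable E.
Hypothesis Bx : forall q, powm plane n (B q) <= (x q)%:E.
Hypothesis EB : forall w (s : 'I_n -> 'I_N), generic (conf w) -> E w ->
  convex_chain (increments (selected U s w)) ->
  vertex_seq (conf w) = ptB :: rcons (selected U s w) ptA ->
  exists q, B q (increments (selected U s w)) /\ others_in U s (D q) w.

(** Sum over the choices of the vertices in order. The chain of a given choice has the law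
    of [law_increments], and restricting to sorted edges costs the factor [n!]. *)
Lemma prob_n_vertices_le :
  P (E `&` n_vertices) <= (prefactor * \sum_q share (D q) ^+ (N - n) * x q)%:E.
Proof.
have [Z [mZ Z0 gZ]] := almost_surely_generic.
pose A (i : option (injection * Q)) : set T :=
  if i is Some sq then chain_event sq.1 (B sq.2) (D sq.2) else Z.
have mA i : measurable (A i) by case: i => [[s q]|] //=; exact: measurable_chain_event.
apply: (le_trans (measure_le_sum P (measurableI _ _ mE measurable_n_vertices) mA _)).
  move=> w [Ew nw]; have [Zw|nZ] := pselect (Z w); first by exists None.
  have [s [sI cs vs]] := vertex_chain (gZ w nZ) nw.
  have sb : injectiveb [ffun i => s i] by apply/injectiveP => i j; rewrite !ffunE; exact: sI.
  have selE : selected U [ffun i => s i] w = [tuple conf w (s i) | i < n].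
    by apply: eq_from_tnth => i; rewrite !tnth_mktuple ffunE.
  have [||q [Bq oq]] := EB (s := [ffun i => s i]) (gZ w nZ) Ew; rewrite ?selE//.
  have cs' : convex_chain (increments (selected U [ffun i => s i] w)) by rewrite selE.
  by exists (Some (mk_injection sb, q)); split; [split; [exact: cs'|exact: Bq]|exact: oq].
rewrite (bigD1 None)//= Z0 add0e.
have bound q : powm plane n ([set e : n.-tuple pt | convex_chain e] `&` B q) <= (x q / (n`!)%:R)%:E.
  have mS : measurable ([set e : n.-tuple pt | pairwise (@steeper R) e] `&` B q).
    by apply: measurableI => //; exact: measurable_pairwise_steeper.
  have H1 : powm plane n ([set e : n.-tuple pt | convex_chain e] `&` B q) <=
      powm plane n ([set e : n.-tuple pt | pairwise (@steeper R) e] `&` B q).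
    apply: le_measure; rewrite ?inE//; last by move=> e [/and3P[_ ? _] ?].
    by apply: measurableI => //; exact: measurable_convex_chain.
  apply: le_trans H1 _.
  have := le_trans (powm_sorted_le (mB q) (@Bperm q)) (Bx q).
  by rewrite muleC -lee_pdivlMr ?ltr0n ?fact_gt0// EFinM.
rewrite (eq_bigl (fun i : option (injection * Q) => isSome i)); last by case.
have -> : \sum_(i : option (injection * Q) | isSome i) P (A i) = \sum_(sq : injection * Q) P (A (Some sq)).
  rewrite (reindex_omap Some id) => [|[i|]//]; first by apply: eq_bigl => i; rewrite /= eqxx.
pose g q := ((2 / fine (plane triangle)) ^+ n * share (D q) ^+ (N - n) * (x q / (n`!)%:R))%R.
apply: (@le_trans _ _ (\sum_(sq : injection * Q) (g sq.2)%:E)).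
  have k0 q : (0 <= (2 / fine (plane triangle)) ^+ n * share (D q) ^+ (N - n))%R.
    rewrite mulr_ge0// exprn_ge0//; last exact: share_ge0.
    by rewrite divr_ge0// ltW// fine_triangle_gt0.
  apply: lee_sum => sq _; rewrite -[P (A _)]/(P (chain_event sq.1 (B sq.2) (D sq.2))).
  by rewrite prob_chain_event// [leRHS]EFinM; apply: lee_wpmul2l => //; rewrite lee_fin.
rewrite -(pair_bigA _ (fun (_ : injection) q => (g q)%:E)).
have const_sum (X : \bar R) : \sum_(i : injection) X = selections%:E * X.
  by rewrite sumr_const /selections mule_natl.
rewrite const_sum sumEFin -EFinM lee_fin /prefactor !mulr_sumr.
apply: ler_sum => q _; rewrite le_eqVlt; apply/orP; left; apply/eqP; rewrite /g.
by move: (_ ^+ n)%R (share (D q) ^+ (N - n))%R => a b; ring.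
Qed.

End upper_bound.

(** If the selected points form a chain in [high c] and the others are in [tent c], then the
    vertices are exactly the selected points; such events are disjoint for distinct choices. *)
Lemma prob_n_vertices_ge (c y : R) : (0 < c)%R -> (c <= 1)%R -> (0 <= y)%R ->
  y%:E <= powm plane n ([set e : n.-tuple pt | simplex e] `&` @last_steepest R n `&`
    [set e : n.-tuple pt | high c e]) ->
  (prefactor * (c ^+ (N - n) * y))%:E <= P n_vertices.
Proof.
move=> c0 c1 y0 yH; set H := _ `&` _ in yH.
have mH : measurable H.
  apply: measurableI; last exact: measurable_high.
  by apply: measurableI; [exact: measurable_simplex|exact: measurable_last_steepest].
have Hperm (t : 'S_n) e : H e -> H (permt t e).
  have pe := perm_eq_permt t e.
  move=> [[se le] he]; split; [split|].
  - by rewrite /= (perm_simplex pe).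
  - by rewrite /last_steepest /= (perm_last_edge pe) (perm_all _ pe).
  - by rewrite /high /= (under_vertex_perm pe).
pose A (s : injection) := chain_event s [set e : n.-tuple pt | high c e] (tent c).
have mhigh := @measurable_high R n c; have mtent := measurable_tent c.
have mA s : measurable (A s) by exact: measurable_chain_event.
have sel s w : selected U (val s) w = [tuple conf w (val s i) | i < n] by [].
have below s w : A s w -> convex_chain (increments [tuple conf w (val s i) | i < n]) /\
    (forall j, j \notin codom (val s) -> below_chain [tuple conf w (val s i) | i < n] (conf w j)).
  move=> [[cs hs] os]; split=> // j js; apply: (high_below c0 cs hs); exact: os.
have := @measure_ge_sum _ _ _ P injection n_vertices A measurable_n_vertices mA.
have sI (s : injection) : injective (val s) by apply/injectiveP; exact: (valP s).
move=> /(_ _ _)/(le_trans _); apply; last 2 first.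
- by move=> s w /below[cs bs]; exact: (chain_vertex_count (sI s) cs bs).
- move=> s t w /below[cs bs] /below[ct bt]; apply: val_inj; apply/ffunP.
  exact: (chain_selection_uniq cs bs ct bt).
rewrite (eq_bigr (fun=> ((2 / fine (plane triangle)) ^+ n * c ^+ (N - n))%:E *
    powm plane n ([set e : n.-tuple pt | convex_chain e] `&` [set e : n.-tuple pt | high c e]))); last first.
  by move=> s _; have := prob_chain_event s mhigh mtent; rewrite share_tent.
have const_sum (X : \bar R) : \sum_(i : injection) X = selections%:E * X.
  by rewrite sumr_const /selections mule_natl.
rewrite const_sum.
have bound : (y / (n`!)%:R)%:E <= powm plane n ([set e : n.-tuple pt | convex_chain e] `&` [set e : n.-tuple pt | high c e]).
  rewrite (_ : _ `&` _ = [set e : n.-tuple pt | pairwise (@steeper R) e] `&` H); last first.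
    apply/seteqP; split=> e /=; first by move=> [/and3P[? ? ?] ?].
    by move=> [? [[? ?] ?]]; split=> //; apply/and3P.
  rewrite EFinM lee_pdivrMr ?ltr0n ?fact_gt0// muleC.
  apply: le_trans yH _; apply: (le_powm_sorted mH Hperm).
  by move=> e [[/andP[]]].
have k0 : (0 <= (2 / fine (plane triangle)) ^+ n * c ^+ (N - n))%R.
  by rewrite mulr_ge0// exprn_ge0// ?divr_ge0// ltW// fine_triangle_gt0.
apply: (@le_trans _ _ (selections%:E * (((2 / fine (plane triangle)) ^+ n * c ^+ (N - n))%:E * (y / (n`!)%:R)%:E))).
  rewrite -!EFinM lee_fin /prefactor le_eqVlt; apply/orP; left; apply/eqP.
  by move: (_ ^+ n)%R (c ^+ (N - n))%R => a b; ring.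
by do 2 (apply: lee_wpmul2l; first by rewrite lee_fin ?ler0n).
Qed.

Lemma cond_prob_le (E : set T) (A x y : R) : measurable E -> (0 < A)%R -> (0 < y)%R ->
  P (E `&` n_vertices) <= (A * x)%:E -> (A * y)%:E <= P n_vertices ->
  cond_prob P E n_vertices <= (x / y)%:E.
Proof.
move=> mE A0 y0 ub lb; rewrite /cond_prob.
have fin : P n_vertices \is a fin_num by exact: fin_num_measure measurable_n_vertices.
have fin2 : P (E `&` n_vertices) \is a fin_num.
  by apply: fin_num_measure; apply: measurableI => //; exact: measurable_n_vertices.
move: ub lb; rewrite -(fineK fin) -(fineK fin2) !lee_fin => ub lb.
have f0 : (0 < fine (P n_vertices))%R by apply: lt_le_trans lb; exact: mulr_gt0.
rewrite inver gt_eqF// -EFinM lee_fin ler_pdivrMr// mulrAC ler_pdivlMr//.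
have x0 : (0 <= x)%R.
  by have := le_trans (fine_ge0 (measure_ge0 P _)) ub; rewrite pmulr_rge0.
have h1 : (fine (P (E `&` n_vertices)) * y <= A * x * y)%R by rewrite ler_wpM2r// ltW.
have h2 : (x * (A * y) <= x * fine (P n_vertices))%R by rewrite ler_wpM2l.
lra.
Qed.

End probability_bounds.

(** * Volume estimates *)

Section volume_estimates.
Context (R : realType).
Notation pt := (R * R)%type.
Notation plane := (@plane R).

(** The common shape of the estimates: [n] edges, each of weight [e^2 / n^2], up
    to an exponential factor. *)
Definition scale (n : nat) (z : R) : R := (expR 2 / n%:R ^+ 2 * z) ^+ n.

Lemma scaleE n z : scale n z = scale n 1 * z ^+ n.
Proof. by rewrite /scale mulr1 -exprMn. Qed.

Lemma scale_gt0 n z : 0 < z -> (0 < n)%N -> 0 < scale n z.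
Proof. by move=> z0 n0; rewrite exprn_gt0// mulr_gt0// divr_gt0 ?expR_gt0// exprn_gt0// ltr0n. Qed.

Lemma scale_le n z z' : 0 <= z -> z <= z' -> scale n z <= scale n z'.
Proof.
move=> z0 zz'; have e0 : 0 <= expR 2 / n%:R ^+ 2 :> R by rewrite divr_ge0 ?expR_ge0// exprn_ge0.
by apply: lerXn2r; rewrite ?nnegrE ?mulr_ge0// ?(le_trans z0)// ler_wpM2l.
Qed.

Lemma simplex_upper n : (0 < n)%N ->
  (powm plane n [set e : n.-tuple pt | simplex e] <= (scale n 1)%:E)%E.
Proof.
move=> n0; have n0' : 0 < n%:R :> R by rewrite ltr0n.
rewrite /scale mulr1; apply: (@powm_le_weight _ _ _ (qweight (expR 2) n%:R n%:R)).
- exact: measurable_simplex.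
- exact: measurable_weight2.
- by move=> x; apply: weight2_ge0; exact: expR_ge0.
- by rewrite integral_qweight ?expR_ge0.
move=> e /andP[pe /andP[l1 l2]]; rewrite prod_qweight pe -expRM_natl -expRD -[leLHS]expR0 ler_expR.
have h1 : n%:R * (edge_sum e).1 <= n%:R * 1 by rewrite ler_pM2l// ltW// -subr_gt0.
have h2 : n%:R * (edge_sum e).2 <= n%:R * 1 by rewrite ler_pM2l// ltW// -subr_gt0.
by rewrite mulNr; move: h1 h2; lra.
Qed.

(** Bernoulli: [n] is absorbed by [(1 + a)^n]. *)
Lemma linear_geometric_small (z c : R) : 0 <= z -> z < 1 -> 0 < c ->
  exists n0, forall n, (n0 <= n)%N -> n.+1%:R * z ^+ n <= c.
Proof.
move=> z0 z1 c0; pose a := (1 - z) / 2; pose y := (1 + a) * z.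
have a0 : 0 < a by rewrite /a; lra.
have a1 : a <= 1 by rewrite /a; lra.
have y0 : 0 <= y by rewrite mulr_ge0//; lra.
have y1 : y < 1 by rewrite /y /a; nra.
have [n0 H] := geometric_small y0 y1 (mulr_gt0 c0 a0).
exists n0 => n /H; rewrite /y exprMn => Hn.
rewrite -(ler_pM2r a0); apply: le_trans Hn; rewrite mulrAC ler_wpM2r ?exprn_ge0//.
elim: n => [|n IHn]; first by rewrite expr0 mul1r.
rewrite exprS; have : 1 <= (1 + a) ^+ n by rewrite exprn_ege1//; lra.
move: ((1 + a) ^+ n) IHn => b; rewrite -[n.+2%:R]natr1; nra.
Qed.

Lemma measurable_simplexD_high n c :
  measurable ([set e : n.-tuple pt | simplex e] `\` [set e : n.-tuple pt | high c e]).
Proof. by apply: measurableD; [exact: measurable_simplex|exact: measurable_high]. Qed.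

(** The four ways for the corner of slope [1] to be far from its typical
    position [(3/4, 1/4)]. *)
Definition corner_shift (b : bool * bool) : R * R :=
  let s := (-1) ^+ b.1 in if b.2 then (s, 0) else (0, s).

Definition shifted n (b : bool * bool) : set (n.-tuple pt) :=
  @deviation R n 1 0 (corner_shift b).1 (corner_shift b).2 16^-1.

Lemma not_high_shifted n : (0 < n)%N -> forall e : n.-tuple pt,
  simplex e -> ~ high 3^-1 e -> exists b, shifted b e.
Proof.
move=> n0 e se nh; have n0' : 0 < n%:R :> R by rewrite ltr0n.
apply: contrapT => nS; apply: nh.
set V := under_vertex e.
have sumE al be : \sum_(x <- e) stat n 1 0 al be x = n%:R * (al * V.1 + be * V.2).
  rewrite /V /under_vertex fst_sum snd_sum !mulr_sumr -big_split /= mulr_sumr.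
  by rewrite [RHS]big_mkcond; apply: eq_bigr => x _; rewrite /stat; case: ifP => // _; rewrite add0r.
have meanE al be : stat_mean 1 0 al be = al * (3 / 4) + be / 4 :> R.
  by rewrite /stat_mean; field.
have bound b : (corner_shift b).1 * V.1 + (corner_shift b).2 * V.2 <
    (corner_shift b).1 * (3 / 4) + (corner_shift b).2 / 4 + 16^-1.
  rewrite ltNge; apply/negP => H; apply: nS; exists b; split=> //=.
  by rewrite sumE meanE ler_pM2l.
have B1 := bound (true, true); have B2 := bound (false, true).
have B3 := bound (true, false); have B4 := bound (false, false).
rewrite /corner_shift /= expr1 expr0 in B1 B2 B3 B4.
by rewrite /high -/V; split; lra.
Qed.

Lemma chernoff_family (Q : finType) (c : Q -> R * (R * R * R)) (eps : R) : 0 < eps ->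
  (forall q, [/\ 0 < (c q).1, `|(c q).2.1.1| <= 1, `|(c q).2.1.2| <= 1 & `|(c q).2.2| <= 1]) ->
  exists rho, 0 < rho < 1 /\ forall q n, (0 < n)%N ->
    (powm plane n (@deviation R n (c q).1 (c q).2.1.1 (c q).2.1.2 (c q).2.2 eps) <= (scale n rho)%:E)%E.
Proof.
move=> e0 hc.
have ex q : exists rho, 0 < rho < 1 /\ forall n, (0 < n)%N ->
    (powm plane n (@deviation R n (c q).1 (c q).2.1.1 (c q).2.1.2 (c q).2.2 eps) <= (scale n rho)%:E)%E.
  have [h1 h2 h3 h4] := hc q; have [rho r01 H] := chernoff h1 e0 h2 h3 h4.
  by exists rho.
have [f hf] := choice ex.
exists (\big[Num.max/2^-1]_q f q); split.
  apply/andP; split.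
    by apply: (@lt_le_trans _ _ 2^-1); [rewrite invr_gt0|exact: bigmax_ge_id].
  by apply/bigmax_ltP; split=> [|q _]; [rewrite invf_lt1//; lra|have [/andP[]] := hf q].
move=> q n n0; have [/andP[f0 _] /(_ n n0) H] := hf q.
apply: le_trans H _; rewrite lee_fin; apply: scale_le; first exact: ltW.
exact: le_bigmax.
Qed.

Lemma shifted_small : exists rho, 0 < rho < 1 /\ forall n, (0 < n)%N ->
  (powm plane n ([set e : n.-tuple pt | simplex e] `\` [set e : n.-tuple pt | high (3^-1 : R) e]) <=
   (4 * scale n rho)%:E)%E.
Proof.
pose c (b : bool * bool) : R * (R * R * R) := (1, (0, (corner_shift b).1, (corner_shift b).2)).
have e0 : 0 < 16^-1 :> R by rewrite invr_gt0.
have [|rho [r01 H]] := chernoff_family (c := c) e0.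
  by move=> [[] []]; rewrite /c /corner_shift /= ?expr1 ?expr0 ?normrN ?normr0 ?normr1; split.
exists rho; split=> // n n0.
have mS (b : bool * bool) : measurable (@shifted n b) by exact: measurable_deviation.
have H1 := measure_le_sum (powm plane n) (@measurable_simplexD_high n 3^-1) mS
  (fun e se => not_high_shifted n0 se.1 se.2).
apply: le_trans H1 _.
apply: (@le_trans _ _ (\sum_(b : bool * bool) (scale n rho)%:E)%E).
  by apply: lee_sum => b _; exact: (H b n n0).
by rewrite sumEFin lee_fin sumr_const card_prod card_bool mulr_natl.
Qed.

(** The corner where the slope passes [1] is typically at [(3/4, 1/4)], well inside
    [high 3^-1]; what is outside is exponentially smaller than the whole simplex. *)
Lemma high_lower : exists r0 : R, 0 < r0 < 1 /\ forall eta, r0 < eta -> eta < 1 ->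
  exists n0, forall n, (n0 <= n)%N -> (0 < n)%N ->
  ((scale n eta / (2 * n.+1%:R))%:E <= powm plane n ([set e : n.-tuple pt | simplex e] `&`
     @last_steepest R n `&` [set e : n.-tuple pt | high (3^-1 : R) e]))%E.
Proof.
have [rho [/andP[r0 r1] H]] := shifted_small.
exists rho; split; first by rewrite r0.
move=> eta re e1; have e0 := lt_trans r0 re.
have [n1 H1] := simplex_lower e0 e1.
have q0 : 0 <= rho / eta by rewrite divr_ge0// ltW.
have q1 : rho / eta < 1 by rewrite ltr_pdivrMr// mul1r.
have [n2 H2] := linear_geometric_small q0 q1 (divr_gt0 ltr01 (ltr0Sn R 15)).
exists (maxn n1 n2) => n; rewrite geq_max => /andP[nn1 nn2] n0.
set X := powm plane n _; rewrite leNgt; apply/negP => Xlt.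
have mH := @measurable_high R n 3^-1.
have := le_trans (H1 n nn1 n0) (simplex_le_last_steepest mH); rewrite -/X.
have s0 := scale_gt0 e0 n0; have n1' : 0 < n.+1%:R :> R by rewrite ltr0n.
have le2 : (X + powm plane n ([set e : n.-tuple pt | simplex e] `\` [set e : n.-tuple pt | high (3^-1 : R) e]) <=
    (scale n eta / (2 * n.+1%:R) + 4 * scale n rho)%:E)%E.
  by rewrite EFinD; apply: leeD; [exact: ltW|exact: H].
have le3 := lee_wpmul2l (x := n.+1%:R%:E) _ le2.
move=> /le_trans/(_ (le3 _)); rewrite lee_fin => /(_ (ltW n1')); rewrite -EFinM lee_fin.
apply/negP; rewrite -ltNge -/(scale n eta) mulrDr.
have -> : n.+1%:R * (scale n eta / (2 * n.+1%:R)) = scale n eta / 2 by field; rewrite addrC natr1 gt_eqF.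
have -> : scale n rho = scale n eta * (rho / eta) ^+ n.
  by rewrite [LHS]scaleE [scale n eta]scaleE -mulrA; congr (_ * _); rewrite -exprMn [eta * _]mulrC divfK// gt_eqF.
have := ler_wpM2l (ltW s0) (H2 n nn2).
by move: (scale n eta) s0 ((rho / eta) ^+ n) => S S0 G; rewrite mulrCA; lra.
Qed.

(** An explicit box of chains passing very close to [ptC]: one long edge, almost
    along the first axis, followed by edges of size [eta / n] and slope at most [2], so
    that the last edge is the steepest. It has an exponentially small share of the
    simplex, but only exponentially. *)
Lemma flat_lower (eta : R) : 0 < eta -> eta <= 10^-1 -> forall n, (0 < n)%N ->
  (((eta ^+ 2 / (4 * n%:R ^+ 2)) ^+ n)%:E <= powm plane n ([set e : n.-tuple pt | simplex e] `&`
     @last_steepest R n `&` [set e : n.-tuple pt | high (1 - 6 * eta) e]))%E.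
Proof.
move=> e0 e1 [//|k] _; set n := k.+1.
have n0' : 0 < n%:R :> R by rewrite ltr0n.
have n1' : 1 <= n%:R :> R by rewrite ler1n.
pose h := eta / n%:R; have h0 : 0 < h by rewrite divr_gt0.
have hn : n%:R * h = eta by rewrite /h mulrC divfK// gt_eqF.
pose A (i : 'I_n) : set pt := if i == ord0 then `[1 - 2 * eta, 1 - eta]%classic `*` `[eta / 2, eta]%classic
  else `[h / 2, h]%classic `*` `[h / 2, h]%classic.
have mA i : measurable (A i) by rewrite /A; case: ifP => _; exact: measurableX.
pose v (i : 'I_n) : R := if i == ord0 then eta * (eta / 2) else (h / 2) * (h / 2).
have Av i : plane (A i) = (v i)%:E.
  by rewrite /A /v; case: ifP => _; (rewrite rect_plane; [congr EFin; field|lra|lra]).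
have hE : eta ^+ 2 / (4 * n%:R ^+ 2) = (h / 2) * (h / 2) by rewrite /h; field; rewrite gt_eqF.
have heta : h <= eta by rewrite /h ler_pdivrMr// ler_peMr// ltW.
apply: (@le_trans _ _ (powm plane n (box A))).
  rewrite powm_box// (eq_bigr (fun i => (v i)%:E)); last by move=> i _; exact: Av.
  rewrite prodEFin lee_fin hE -[X in _ ^+ X]card_ord -prodr_const; apply: ler_prod => i _.
  have h2 : 0 <= h / 2 by lra.
  apply/andP; split; first exact: mulr_ge0.
  by rewrite /v; case: ifP => // _; apply: ler_pM => //; lra.
apply: le_measure; rewrite ?inE; first exact: measurable_box.
  apply: measurableI; last exact: measurable_high.
  by apply: measurableI; [exact: measurable_simplex|exact: measurable_last_steepest].
move=> e eA.
have e_ord0 : [/\ 1 - 2 * eta <= (tnth e ord0).1, (tnth e ord0).1 <= 1 - eta,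
    eta / 2 <= (tnth e ord0).2 & (tnth e ord0).2 <= eta].
  by have := eA ord0; rewrite /A eqxx => -[/=]; rewrite !in_itv /= => /andP[? ?] /andP[? ?].
have e_other i : i != ord0 -> [/\ h / 2 <= (tnth e i).1, (tnth e i).1 <= h,
    h / 2 <= (tnth e i).2 & (tnth e i).2 <= h].
  by move=> i0; have := eA i; rewrite /A (negPf i0) => -[/=]; rewrite !in_itv /= => /andP[? ?] /andP[? ?].
have epos i : 0 < (tnth e i).1 /\ 0 < (tnth e i).2.
  have [->|i0] := eqVneq i ord0; first by have [? ? ? ?] := e_ord0; split; lra.
  by have [? ? ? ?] := e_other i i0; split; lra.
have rest (f : 'I_n -> R) : (forall i, i != ord0 -> f i <= h) -> \sum_(i | i != ord0) f i <= eta - h.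
  move=> fh; apply: (@le_trans _ _ (\sum_(i < n | i != ord0) h)); first exact: ler_sum.
  rewrite sumr_const cardC1 card_ord /= -mulr_natl -hn -[n%:R]natr1 mulrDl mul1r addrK.
  by [].
have S1 : (edge_sum e).1 = (tnth e ord0).1 + \sum_(i | i != ord0) (tnth e i).1.
  by rewrite edge_sum1E big_tuple (bigD1 ord0).
have S2 : (edge_sum e).2 = (tnth e ord0).2 + \sum_(i | i != ord0) (tnth e i).2.
  by rewrite edge_sum2E big_tuple (bigD1 ord0).
have r1 : \sum_(i | i != ord0) (tnth e i).1 <= eta - h.
  by apply: rest => i i0; have [] := e_other i i0.
have r2 : \sum_(i | i != ord0) (tnth e i).2 <= eta - h.
  by apply: rest => i i0; have [] := e_other i i0.
have p1 : 0 <= \sum_(i | i != ord0) (tnth e i).1 by apply: sumr_ge0 => i _; have [/ltW] := epos i.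
have p2 : 0 <= \sum_(i | i != ord0) (tnth e i).2 by apply: sumr_ge0 => i _; have [_ /ltW] := epos i.
have [a1 a2 b1 b2] := e_ord0.
have l1 : (last_edge e).1 = 1 - (edge_sum e).1 by [].
have l2 : (last_edge e).2 = 1 - (edge_sum e).2 by [].
have l1b : 0 < (last_edge e).1 <= 2 * eta by rewrite l1 S1; apply/andP; split; lra.
have l2b : 1 - 2 * eta <= (last_edge e).2 by rewrite l2 S2; lra.
have [l1p l1u] := andP l1b.
split; [split|].
- apply/andP; split; first by apply/all_tnthP => i; have [? ?] := epos i; apply/andP.
  by apply/andP; split=> //; lra.
- apply/all_tnthP => i; rewrite /= /steeper.
  have [->|i0] := eqVneq i ord0.
    have t1 : (tnth e ord0).2 * (last_edge e).1 <= eta * (2 * eta).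
      by clear -e0 b1 b2 l1p l1u; apply: ler_pM => //; lra.
    have t2 : (1 - 2 * eta) * (1 - 2 * eta) <= (tnth e ord0).1 * (last_edge e).2.
      by clear -e1 a1 l2b; apply: ler_pM => //; lra.
    by clear -t1 t2 e0 e1; nra.
  have [x1 x2 y1 y2] := e_other i i0.
  have t1 : (tnth e i).2 * (last_edge e).1 <= h * (2 * eta).
    by clear -y1 y2 l1p l1u h0; apply: ler_pM => //; lra.
  have t2 : (h / 2) * (1 - 2 * eta) <= (tnth e i).1 * (last_edge e).2.
    by clear -e1 x1 l2b h0; apply: ler_pM => //; lra.
  by clear -t1 t2 e0 e1 h0; nra.
have VE : under_vertex e = \sum_(i < n | under 1 (tnth e i)) tnth e i by rewrite /under_vertex big_tuple.
have u0 : under 1 (tnth e ord0) by rewrite /under mul1r; lra.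
have V1 : 1 - 2 * eta <= (under_vertex e).1.
  rewrite VE fst_sum (bigD1 ord0)//=; apply: le_trans a1 _; rewrite lerDl sumr_ge0// => i _.
  by have [/ltW] := epos i.
have V2 : 0 <= (under_vertex e).2.
  by rewrite VE snd_sum sumr_ge0// => i _; have [_ /ltW] := epos i.
have sumle (f : 'I_n -> R) (Q : pred 'I_n) : (forall i, 0 <= f i) -> \sum_(i | Q i) f i <= \sum_i f i.
  by move=> f0; rewrite [leRHS](bigID Q) /= lerDl sumr_ge0.
have V2' : (under_vertex e).2 <= 2 * eta.
  apply: (@le_trans _ _ (edge_sum e).2); last by rewrite S2; lra.
  by rewrite VE snd_sum edge_sum2E big_tuple; apply: sumle => i; have [_ /ltW] := epos i.
have V1' : (under_vertex e).1 <= 1.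
  apply: (@le_trans _ _ (edge_sum e).1); last by rewrite S1; lra.
  by rewrite VE fst_sum edge_sum1E big_tuple; apply: sumle => i; have [/ltW] := epos i.
clear -e0 e1 V1 V2 V1' V2'; have c0 : 0 <= 1 - 6 * eta by lra.
rewrite /high /=; split.
  have := ler_wpM2l c0 (_ : 2 - (under_vertex e).1 - (under_vertex e).2 <= 1 + 2 * eta).
  move=> /(_ _)/le_trans; apply; nra.
have := ler_wpM2l c0 (_ : (under_vertex e).1 + (under_vertex e).2 <= 1 + 2 * eta).
move=> /(_ _)/le_trans; apply; nra.
Qed.

End volume_estimates.

(** * The two limits *)

Section limits.
Context (R : realType).
Notation pt := (R * R)%type.
Notation plane := (@plane R).
Variable m : nat -> nat.

Lemma ereal_cvg0 (f : nat -> \bar R) : (forall n, 0 <= f n)%E ->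
  (forall c : R, 0 < c -> exists n0, forall n, (n0 <= n)%N -> (f n <= c%:E)%E) ->
  f n @[n --> \oo] --> 0%E.
Proof.
move=> f0 fc; have fin n c : (f n <= c%:E)%E -> f n \is a fin_num.
  by move=> fnc; rewrite ge0_fin_numE// (le_lt_trans fnc)// ltry.
apply/fine_cvgP; split.
  by have [n0 H] := fc 1 ltr01; exists n0 => // n /= /H /fin.
apply/cvgrPdist_le => c c0; have [n0 H] := fc c c0; exists n0 => // n /= /H fnc.
rewrite sub0r normrN ger0_norm ?fine_ge0//.
by rewrite -lee_fin fineK//; exact: fin fnc.
Qed.

Lemma cond_prob_ge0 d (T : measurableType d) (P : probability T R) (E F : set T) :
  (0 <= cond_prob P E F)%E.
Proof. by rewrite /cond_prob mule_ge0// inve_ge0. Qed.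

Lemma deviation_perm n (r k al be eps : R) (t : 'S_n) e :
  deviation r k al be eps e -> deviation r k al be eps (permt t e).
Proof.
have pe := perm_eq_permt t e; move=> [se le]; split; first by rewrite /= (perm_simplex pe).
by rewrite /= (perm_big _ pe).
Qed.

Lemma ratio_gt0 L (i : 'I_L) : 0 < ratio R i.
Proof. by rewrite /ratio divr_gt0 ?ltr0n// subn_gt0. Qed.

Lemma direction_le1 (b : bool * 'I_3) : [/\ `|(direction R b).1.1| <= 1,
  `|(direction R b).1.2| <= 1 & `|(direction R b).2| <= 1].
Proof.
rewrite /direction /=; have H (c : bool) : `|(-1) ^+ b.1 * c%:R : R| <= 1.
  by rewrite normrM normr_sign mul1r; case: c; rewrite ?normr1 ?normr0.
by split; exact: H.
Qed.

Lemma inner_triangle (p : pt) : inner p -> triangle p.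
Proof. by move=> [? ? ?]; apply/triangleP; split; lra. Qed.

(** Upper bound: chains far from the parabola, no constraint on the other points. Lower
    bound: chains in [high 3^-1], the other points in [tent 3^-1], at the price
    [3^-m], which is subexponential. *)
Lemma near_parabola (eps c : R) : 0 < eps -> 0 < c ->
  (forall M, exists n0, forall n, (n0 <= n)%N -> (M * m n <= n)%N) ->
  exists n0, forall n, (n0 <= n)%N ->
  forall d (T : measurableType d) (P : probability T R) (U : 'I_(n + m n) -> {RV P >-> pt}),
  iid_uniform_triangle U ->
  (cond_prob P [set w | (eps < unif_dist2 (Xn n (conf U w), Yn n (conf U w)) (@Xlim R, @Ylim R))%R]
    (n_vertices U n) <= c%:E)%E.
Proof.
move=> eps0 c0 hm.
have [L Leps] : exists L : nat, 10 / L.+1%:R <= eps.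
  have [L HL] := small_inverse (divr_gt0 eps0 (ltr0Sn R 9)).
  by exists L; move: HL; move: (L.+1%:R^-1) => a; lra.
pose Q := ('I_L * (bool * 'I_3))%type.
pose cf (q : Q) : R * (R * R * R) := (ratio R q.1, direction R q.2).
have [||rho [/andP[rho0 rho1] Hrho]] := @chernoff_family R Q cf (2 * L.+1%:R)^-1.
- by rewrite invr_gt0 mulr_gt0// ltr0n.
- by move=> q; have [? ? ?] := direction_le1 q.2; split=> //; exact: ratio_gt0.
have [r0 [/andP[r00 r01] Hhigh]] := high_lower R.
pose r := Num.max rho r0.
have rr : rho <= r /\ r0 <= r by rewrite !le_max !lexx orbT.
have r_gt0 : 0 < r by rewrite lt_max rho0.
have r_lt1 : r < 1 by rewrite gt_max rho1.
(* [scale n eta] bounds the simplex from below and [scale n r] the deviations from above;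
   [be] takes up the factor [3^m] while keeping [r * be < eta]. *)
pose eta := (1 + r) / 2; pose be := 2 * eta / (eta + r).
have er : r < eta by rewrite /eta; lra.
have e1 : eta < 1 by rewrite /eta; lra.
have e0 : 0 < eta by lra.
have b1 : 1 < be by rewrite /be ltr_pdivlMr; lra.
have b0 : 0 < be by lra.
pose z := r * be / eta.
have zE : z = 2 * r / (eta + r) by rewrite /z /be; field; rewrite !gt_eqF// addr_gt0.
have z0 : 0 <= z by rewrite zE divr_ge0; lra.
have z1 : z < 1 by rewrite zE ltr_pdivrMr; lra.
have [n1 H1] := Hhigh eta (le_lt_trans rr.2 er) e1.
have c' : 0 < c / (2 * #|{: Q}|%:R + 1) by rewrite divr_gt0// ltr_wpDl// mulr_ge0.
have [n2 H2] := linear_geometric_small z0 z1 c'.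
have b10 : 0 <= be^-1 by rewrite invr_ge0 ltW.
have b11 : be^-1 < 1 by rewrite invf_lt1.
have [M HM] := geometric_small b10 b11 (divr_gt0 ltr01 (ltr0Sn R 2)).
have [n3 H3] := hm M.
exists (maxn (maxn n1 n2) (maxn n3 (2 * L.+1))) => n.
rewrite !geq_max => /andP[/andP[nn1 nn2] /andP[nn3 nL]] d T P U hU.
have n0 : (0 < n)%N by apply: leq_trans nL.
have mU := measurable_conf U.
have mE : measurable [set w | (eps < unif_dist2 (Xn n (conf U w), Yn n (conf U w)) (@Xlim R, @Ylim R))%R].
  exact: (measurable_unif_dist2 mU).
pose y := (3^-1 : R) ^+ (n + m n - n) * (scale n eta / (2 * n.+1%:R)).
have n1' : 0 < n.+1%:R :> R by rewrite ltr0n.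
have y0' : 0 < scale n eta / (2 * n.+1%:R) by rewrite divr_gt0 ?scale_gt0// mulr_gt0.
have y0 : 0 < y by rewrite mulr_gt0// exprn_gt0// invr_gt0.
have lb : ((prefactor R (n + m n) n * y)%:E <= P (n_vertices U n))%E.
  apply: (prob_n_vertices_ge hU); [by rewrite invr_gt0|by rewrite invf_le1//; lra|exact: ltW|].
  exact: H1.
have mB (q : Q) : measurable (@bad_chain R n L q) by exact: measurable_deviation.
have Bperm (q : Q) (t : 'S_n) e : @bad_chain R n L q e -> bad_chain q (permt t e).
  exact: deviation_perm.
have Bx (q : Q) : (powm plane n (@bad_chain R n L q) <= (scale n rho)%:E)%E := Hrho q n n0.
have mD (q : Q) : measurable [set: pt] by exact: measurableT.
have ub := prob_n_vertices_le hU mB Bperm mD mE Bx.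
apply: le_trans (cond_prob_le mE (prefactor_gt0 R (leq_addr _ _)) y0 (ub _) lb) _.
  move=> w s gw Ew cs vs; apply: contrapT => nq; move: Ew; apply/negP; rewrite -leNgt.
  apply: le_trans Leps; apply: (chain_near_parabola nL cs vs) => q bq.
  by apply: nq; exists q; split.
rewrite lee_fin ler_pdivrMr//.
have -> : \sum_(q : Q) share triangle [set: pt] ^+ (n + m n - n) * scale n rho = #|{: Q}|%:R * scale n rho.
  have -> : share triangle [set: pt] = 1 :> R.
    by rewrite /share setTI divff// gt_eqF// fine_triangle_gt0.
  by rewrite expr1n mul1r sumr_const mulr_natl.
rewrite /y addKn.
set t := 3^-1 ^+ m n; have t0 : 0 < t by rewrite exprn_gt0// invr_gt0.
have tb : 1 <= t * be ^+ n.
  have h3 : 3 <= be ^+ M.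
    have := HM M (leqnn M); rewrite exprVn div1r lef_pV2 ?posrE ?exprn_gt0//.
  have h4 : (3 : R) ^+ m n <= be ^+ n.
    apply: (@le_trans _ _ (be ^+ (M * m n))); first by rewrite exprM; apply: lerXn2r; rewrite ?nnegrE// exprn_ge0// ltW.
    by rewrite ler_weXn2l// ?ltW// H3.
  by rewrite /t exprVn mulrC ler_pdivlMr ?exprn_gt0// mul1r.
have s1 : scale n rho <= scale n r by apply: scale_le; [exact: ltW|exact: rr.1].
apply: (@le_trans _ _ (#|{: Q}|%:R * scale n r)); first by rewrite ler_wpM2l.
rewrite (scaleE n r) (scaleE n eta); have S0 := @scale_gt0 R n 1 ltr01 n0.
move: (scale n 1) S0 => S S0.
have := H2 n nn2; have zn : z ^+ n * eta ^+ n = r ^+ n * be ^+ n.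
  by rewrite -!exprMn /z divfK// gt_eqF.
have a0 : 0 < r ^+ n by rewrite exprn_gt0.
have h0 : 0 < eta ^+ n by rewrite exprn_gt0.
move: (z ^+ n) (eta ^+ n) (r ^+ n) (be ^+ n) zn a0 h0 tb => zz h a b zn a0 h0 tb.
rewrite ler_pdivlMr; last by rewrite ltr_wpDl// mulr_ge0.
set q := #|{: Q}|%:R; have q0 : 0 <= q by [].
move=> Hz.
have -> : c * (t * (S * h / (2 * n.+1%:R))) = S * (c * (t * h)) / (2 * n.+1%:R).
  by field; rewrite addrC natr1 gt_eqF.
rewrite ler_pdivlMr ?mulr_gt0//.
have -> : q * (S * a) * (2 * n.+1%:R) = S * (2 * q * n.+1%:R * a) by ring.
rewrite ler_pM2l//.
have k0 : 0 <= 2 * q * n.+1%:R * a by rewrite !mulr_ge0// ltW.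
apply: (@le_trans _ _ (2 * q * n.+1%:R * a * (t * b))); first by rewrite ler_peMr.
have -> : 2 * q * n.+1%:R * a * (t * b) = (n.+1%:R * zz * (2 * q)) * (t * h).
  have -> : 2 * q * n.+1%:R * a * (t * b) = 2 * q * n.+1%:R * t * (a * b) by ring.
  by rewrite -zn; ring.
rewrite ler_wpM2r ?mulr_ge0 ?(ltW t0) ?(ltW h0)//.
have zz0 : 0 <= n.+1%:R * zz.
  have : 0 <= zz * h by rewrite zn; have : 0 < t * b by [exact: lt_le_trans tb]; rewrite pmulr_rgt0// => b00; rewrite mulr_ge0// ltW.
  by rewrite pmulr_lge0// => ?; rewrite mulr_ge0// ltW.
by move: Hz; rewrite mulrDr mulr1; lra.
Qed.

(** If the hull is far from the triangle, some corner has no point nearby, which each of the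
    [m] other points avoids with probability at most [t < 1]. Against this, chains passing
    close to [ptC] leave to the other points a share [c1 > t] of the triangle; the cost of
    such chains is exponential in [n], hence negligible. *)
Lemma fill_triangle (eps c : R) : 0 < eps -> 0 < c ->
  (forall M, exists n0, forall n, (n0 <= n)%N -> (M * n <= m n)%N) ->
  exists n0, forall n, (n0 <= n)%N ->
  forall d (T : measurableType d) (P : probability T R) (U : 'I_(n + m n) -> {RV P >-> pt}),
  iid_uniform_triangle U ->
  (cond_prob P [set w | (eps < hausdorff_dist (hull (range (conf U w))) triangle)%R]
    (n_vertices U n) <= c%:E)%E.
Proof.
move=> eps0 c0 hm.
pose t := \big[Num.max/2^-1]_(q : 'I_3) share triangle (far_from q eps).
have t0 : 0 < t by apply: (@lt_le_trans _ _ 2^-1); [rewrite invr_gt0|exact: bigmax_ge_id].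
have t1 : t < 1.
  by apply/bigmax_ltP; split=> [|q _]; [rewrite invf_lt1//; lra|exact: share_far].
have share_le q : share triangle (far_from q eps) <= t by exact: le_bigmax.
(* The constant makes [1 - 6 * eta] at least the midpoint of [t] and [1]. *)
pose eta : R := Num.min 10^-1 ((1 - t) / 12).
have eta0 : 0 < eta by rewrite lt_min invr_gt0 ltr0n divr_gt0// subr_gt0.
have eta1 : eta <= 10^-1 by rewrite ge_min lexx.
have eta2 : eta <= (1 - t) / 12 by rewrite ge_min lexx orbT.
pose c1 := 1 - 6 * eta.
have tc1 : t < c1 by rewrite /c1; lra.
have c10 : 0 < c1 by lra.
have c11 : c1 <= 1 by rewrite /c1; lra.
pose th := t / c1.
have th0 : 0 < th by rewrite divr_gt0.
have th1 : th < 1 by rewrite ltr_pdivrMr// mul1r.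
pose C := 4 * expR 2 / eta ^+ 2.
have C0 : 0 < C by rewrite divr_gt0 ?mulr_gt0 ?expR_gt0 ?exprn_gt0.
have invC : 0 < (2 * C)^-1 by rewrite invr_gt0 mulr_gt0.
have [M HM] := geometric_small (ltW th0) th1 invC.
have [n1 H1] := hm M.
have half0 : 0 <= 2^-1 :> R by rewrite invr_ge0.
have half1 : 2^-1 < 1 :> R by rewrite invf_lt1//; lra.
have [n2 H2] := geometric_small half0 half1 (divr_gt0 c0 (ltr0Sn R 2)).
exists (maxn (maxn n1 n2) 1) => n; rewrite !geq_max => /andP[/andP[nn1 nn2] n0] d T P U hU.
have n0' : 0 < n%:R :> R by rewrite ltr0n.
have i0 : 'I_(n + m n) by exists 0%N; rewrite ltn_addr.
have mU := measurable_conf U.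
have mE : measurable [set w | (eps < hausdorff_dist (hull (range (conf U w))) triangle)%R].
  exact: (measurable_hausdorff_dist mU).
pose W := (eta ^+ 2 / (4 * n%:R ^+ 2)) ^+ n.
have W0 : 0 < W by rewrite exprn_gt0// divr_gt0 ?mulr_gt0 ?exprn_gt0.
pose y := c1 ^+ (n + m n - n) * W.
have y0 : 0 < y by rewrite mulr_gt0// exprn_gt0.
have lb : ((prefactor R (n + m n) n * y)%:E <= P (n_vertices U n))%E.
  by apply: (prob_n_vertices_ge hU) => //; [exact: ltW|exact: flat_lower].
have mB (q : 'I_3) : measurable [set e : n.-tuple pt | simplex e] by exact: measurable_simplex.
have Bperm (q : 'I_3) (tau : 'S_n) e : [set e : n.-tuple pt | simplex e] e ->
    [set e : n.-tuple pt | simplex e] (permt tau e).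
  by move=> se; rewrite /= (perm_simplex (perm_eq_permt tau e)).
have Bx (q : 'I_3) : (powm plane n [set e : n.-tuple pt | simplex e] <= (scale n 1)%:E)%E.
  exact: simplex_upper.
have mD (q : 'I_3) : measurable (far_from q eps) by exact: measurable_far.
have ub := prob_n_vertices_le hU mB Bperm mD mE Bx.
apply: le_trans (cond_prob_le mE (prefactor_gt0 R (leq_addr _ _)) y0 (ub _) lb) _.
  move=> w s gw Ew cs vs; apply: contrapT => nq; move: Ew; apply/negP; rewrite -leNgt.
  apply: hausdorff_le => // [i|q].
    exact: inner_triangle (gw.1 i).
  apply: contrapT => nj; apply: nq; exists q; split; first by case/and3P: cs.
  move=> j _ /=; rewrite /far_from /= leNgt; apply/negP => lt; apply: nj.
  by exists j.
rewrite lee_fin ler_pdivrMr// /y addKn.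
have CW : scale n 1 = C ^+ n * W.
  rewrite /scale /W -exprMn mulr1 /C; congr (_ ^+ n).
  by field; rewrite !gt_eqF// exprn_gt0.
have t_pow : t ^+ m n = th ^+ m n * c1 ^+ m n by rewrite -exprMn /th divfK// gt_eqF.
have th_pow : th ^+ m n * C ^+ n <= 2^-1 ^+ n.
  apply: (@le_trans _ _ ((2 * C)^-1 ^+ n * C ^+ n)).
    rewrite ler_wpM2r ?exprn_ge0 ?(ltW C0)//.
    apply: (@le_trans _ _ (th ^+ (M * n))); first by rewrite ler_wiXn2l ?(ltW th0) ?(ltW th1)// H1.
    rewrite exprM; apply: lerXn2r; last exact: HM.
      by rewrite nnegrE exprn_ge0// ltW.
    by rewrite nnegrE ltW.
  rewrite -exprMn (_ : (2 * C)^-1 * C = 2^-1)//.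
  by rewrite invfM mulrAC -mulrA divff ?mulr1// gt_eqF.
apply: (@le_trans _ _ (3 * (t ^+ m n * (C ^+ n * W)))).
  apply: (@le_trans _ _ (\sum_(q : 'I_3) t ^+ m n * (C ^+ n * W))).
    have CW0 : 0 <= C ^+ n * W.
      by apply: mulr_ge0; [apply: exprn_ge0; exact: ltW|exact: ltW].
    apply: ler_sum => q _; rewrite CW; apply: ler_wpM2r => //.
    by apply: lerXn2r; rewrite ?nnegrE ?(ltW t0) ?share_ge0//; exact: share_le.
  by rewrite sumr_const card_ord mulr_natl.
rewrite t_pow.
have c1m : 0 < c1 ^+ m n by rewrite exprn_gt0.
have h := H2 n nn2.
have -> : 3 * (th ^+ m n * c1 ^+ m n * (C ^+ n * W)) = 3 * (th ^+ m n * C ^+ n) * (c1 ^+ m n * W) by ring.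
apply: ler_wpM2r; first by apply: mulr_ge0; exact: ltW.
by rewrite mulrC -ler_pdivlMr//; exact: le_trans th_pow h.
Qed.

End limits.

Theorem theorem1p4 (R : realType) (m : nat -> nat)
    (d : nat -> measure_display) (T : forall n, measurableType (d n))
    (P : forall n, probability (T n) R)
    (U : forall n, 'I_(n + m n) -> {RV (P n) >-> (R * R)%type})
    (hU : forall n, (1 <= n)%N -> iid_uniform_triangle (U n)) :
  ((fun n => (m n)%:R : R) =o_\oo (fun n => n%:R : R) ->
     cvg0_in_prob (fun n => Qlaw (U n) n)
       (fun n u => unif_dist2 (Xn n u, Yn n u) (Xlim, Ylim)))
  /\
  ((m n)%:R / n%:R @[n --> \oo] --> (+oo : set_system R) ->
     cvg0_in_prob (fun n => Qlaw (U n) n)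
       (fun n u => hausdorff_dist (hull (range u)) triangle)).
Proof.
split=> hm eps eps0; (apply: ereal_cvg0 => [n|c c0]; first exact: cond_prob_ge0).
- have hm' M : exists n0, forall n, (n0 <= n)%N -> (M * m n <= n)%N.
    have M0 : 0 < M.+1%:R^-1 :> R by rewrite invr_gt0.
    have [n0 _ H] := (eqoP _ _ _).1 hm _ M0; exists n0 => n /H.
    rewrite /= !ger0_norm// ler_pdivlMl// -natrM ler_nat.
    by apply: leq_trans; rewrite leq_mul2r leqnSn orbT.
  have [n0 H] := near_parabola eps0 c0 hm'.
  by exists (maxn n0 1) => n; rewrite geq_max => /andP[nn0 n1]; apply: H => //; exact: hU.
- have hm' M : exists n0, forall n, (n0 <= n)%N -> (M * n <= m n)%N.
    have [n0 _ H] := (cvgryPge _).1 hm M%:R; exists (maxn n0 1) => n; rewrite geq_max => /andP[/H /= + n1].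
    by rewrite ler_pdivlMr ?ltr0n// -natrM ler_nat.
  have [n0 H] := fill_triangle eps0 c0 hm'.
  by exists (maxn n0 1) => n; rewrite geq_max => /andP[nn0 n1]; apply: H => //; exact: hU.
Qed.
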